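(* Let $N\ge3$, $k\ge1$, and let $A=(a_{ij})$ be a real symmetric $k\times k$ matrix with $\sum_{j=1}^k a_{ij}=1$ for every $i$. Let $\Lambda_1=1,\Lambda_2,\dots,\Lambda_k$ be the eigenvalues of $A$ counted with multiplicity. Consider the linear system $$-\Delta v_i=\frac{N(N+2)}{(1+|x|^2)^2}\sum_{j=1}^k a_{ij}v_j\ \text{ in }\mathbb{R}^N,\qquad v_i\in D^{1,2}(\mathbb{R}^N),\qquad i=1,\dots,k. \qquad ( * )$$ Then $( * )$ has a solution $v=(v_1,\dots,v_k)\neq(0,\dots,0)$ if and only if $$\Lambda_i=\lambda_n:=\frac{(2n+N-2)(2n+N)}{N(N+2)}\qquad( ** )$$ for some $i\in\{1,\dots,k\}$ and some $n\in\mathbb{N}=\{0,1,2,\dots\}$. The solutions coming from an equality $( ** )$ are the linear combinations of functions $$c_h\,w_{n,h},\qquad h=0,\dots,n,$$ where $c_h\in\mathbb{R}^k$ satisfies $Ac_h=\lambda_n c_h$ and $w_{n,h}$ is any function of the form $$w_{n,h}(r,\theta)=\frac{r^h}{(1+r^2)^{h+\frac{N-2}{2}}}\,P_{n-h}^{\left(h+\frac{N-2}{2},\,h+\frac{N-2}{2}\right)}\!\left(\frac{1-r^2}{1+r^2}\right)Y_h(\theta),$$ with $r=|x|$, $\theta=x/|x|$ and $Y_h$ a spherical harmonic on $\mathbb{S}^{N-1}$ associated with the eigenvalue $h(h+N-2)$. If several equalities of the form $( ** )$ hold at the same time, the set of solutions of $( * )$ is the linear span of the associated solutions. In particular, one always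 has $\Lambda_1=1=\lambda_1$, and the corresponding solutions are given by $$v=c_0\Bigl(x\cdot\nabla U+\frac{N-2}{2}U\Bigr)+\sum_{i=1}^N c_i\frac{\partial U}{\partial x_i}$$ for $c_0,c_1,\dots,c_N\in\mathbb{R}^k$ such that $Ac_i=c_i$ for all $i\in\{0,1,\dots,N\}$.
   Context: $2^*=\frac{2N}{N-2}$ and $D^{1,2}(\mathbb{R}^N)=\{u\in L^{2^*}(\mathbb{R}^N): |\nabla u|\in L^2(\mathbb{R}^N)\}$; equations are understood in the weak sense. The row-sum condition says that $(1,\dots,1)$ is an eigenvector of $A$ with eigenvalue $1$, so one can set $\Lambda_1=1$. The standard bubble is $$U(x)=\frac{[N(N-2)]^{\frac{N-2}{4}}}{(1+|x|^2)^{\frac{N-2}{2}}}.$$ The Jacobi polynomials are $$P_m^{(\beta,\gamma)}(\xi)=\sum_{s=0}^m\binom{m+\beta}{s}\binom{m+\gamma}{m-s}\left(\frac{\xi-1}{2}\right)^{m-s}\left(\frac{\xi+1}{2}\right)^s .$$ *)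

(* Defs.v *)
From HB Require Import structures.
From mathcomp Require Import all_boot all_order all_algebra.
From mathcomp Require Import all_classical all_reals all_analysis.

Set Implicit Arguments.
Unset Strict Implicit.
Unset Printing Implicit Defensive.

Import Order.TTheory GRing.Theory Num.Theory.
Import numFieldNormedType.Exports.

Local Open Scope classical_set_scope.
Local Open Scope ring_scope.

(* R^n is 'rV[R]_n, with the sigma-algebra generated by the coordinates. *)
Definition rV_display : measure_display.
Proof. exact: default_measure_display. Qed.

Section measurable_rV.
Context {R : realType} {n : nat}.

Definition rV_coord (i : 'I_n) (x : 'rV[R]_n) : measurableTypeR R := x ord0 i.

Let rV_set0 : g_sigma_preimage rV_coord set0.
Proof. exact: sigma_algebra0. Qed.

Let rV_setC A : g_sigma_preimage rV_coord A -> g_sigma_preimage rV_coord (~` A).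
Proof. exact: sigma_algebraC. Qed.

Let rV_bigcup (F : (set _)^nat) : (forall i, g_sigma_preimage rV_coord (F i)) ->
  g_sigma_preimage rV_coord (\bigcup_i (F i)).
Proof. exact: sigma_algebra_bigcup. Qed.

HB.instance Definition _ := @isMeasurable.Build rV_display
  'rV[R]_n (g_sigma_preimage rV_coord) rV_set0 rV_setC rV_bigcup.

Lemma measurable_rV_coord (i : 'I_n) : measurable_fun setT (rV_coord i).
Proof.
move=> _ Y mY; rewrite setTI; apply: sub_sigma_algebra => /=.
rewrite -bigcup_seq/=; exists i => /=; first by rewrite mem_index_enum.
by exists Y => //; rewrite setTI.
Qed.

Lemma measurable_fun_rVP d (T : measurableType d) (f : T -> 'rV[R]_n) :
  (forall i, measurable_fun setT (rV_coord i \o f)) -> measurable_fun setT f.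
Proof.
move=> mf _ Y mY; rewrite setTI.
have : image_set_system setT f measurable Y.
  suff : g_sigma_preimage rV_coord `<=` image_set_system setT f measurable by exact.
  apply: smallest_sub.
    exact/sigma_algebra_image/sigma_algebra_measurable.
  move=> A; rewrite -bigcup_seq/= => -[i _ [B mB <-]].
  rewrite /image_set_system/= !setTI.
  by have := mf i measurableT B mB; rewrite setTI.
by rewrite /image_set_system/= setTI.
Qed.

End measurable_rV.

Section lebesgue_rV.
Context {R : realType}.

Definition cons_rV n (p : measurableTypeR R * 'rV[R]_n) : 'rV[R]_n.+1 :=
  row_mx (const_mx p.1 : 'rV[R]_1) p.2.

Lemma cons_rV0 n p : @cons_rV n p ord0 ord0 = p.1.
Proof. by rewrite /cons_rV mxE; case: splitP => // j _; rewrite mxE. Qed.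

Lemma cons_rVS n p i : @cons_rV n p ord0 (lift ord0 i) = p.2 ord0 i.
Proof.
rewrite /cons_rV mxE; case: splitP => [j|j] /=; rewrite /bump/= add1n.
  by case: j => -[].
by rewrite add1n => -[/val_inj ->].
Qed.

Lemma measurable_cons_rV n : measurable_fun setT (@cons_rV n).
Proof.
apply: measurable_fun_rVP => i.
have [->|[j ->]] : i = ord0 \/ exists j, i = lift ord0 j.
  by case: (unliftP ord0 i) => [j ->|->]; [right; exists j|left].
- rewrite (_ : _ \o _ = fst) //; apply/funext => p /=; exact: cons_rV0.
- rewrite (_ : _ \o _ = rV_coord j \o snd); last first.
    by apply/funext => p /=; exact: cons_rVS.
  by apply: measurableT_comp => //; exact: measurable_rV_coord.
Qed.

Definition uncons_rV n (x : 'rV[R]_n.+1) : measurableTypeR R * 'rV[R]_n :=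
  (x ord0 ord0, \row_i x ord0 (lift ord0 i)).

Lemma measurable_uncons_rV n : measurable_fun setT (@uncons_rV n).
Proof.
apply/measurable_fun_pairP; split; first exact: (measurable_rV_coord ord0).
apply: measurable_fun_rVP => i.
rewrite (_ : _ \o _ = rV_coord (lift ord0 i)); first exact: measurable_rV_coord.
by apply/funext => x; rewrite /rV_coord/= mxE.
Qed.

Lemma cons_rVK n : cancel (@cons_rV n) (@uncons_rV n).
Proof.
move=> [a x]; rewrite /uncons_rV cons_rV0; congr (_, _).
by apply/rowP => i; rewrite mxE cons_rVS.
Qed.

Section step.
Variables (n : nat) (m : {sigma_finite_measure set 'rV[R]_n -> \bar R}).

Definition lebesgue_rV_step : set 'rV[R]_n.+1 -> \bar R :=
  pushforward (lebesgue_measure \x m)%E (@cons_rV n).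


Let step0 : lebesgue_rV_step set0 = 0%E.
Proof. by rewrite /lebesgue_rV_step /pushforward preimage_set0 measure0. Qed.

Let step_ge0 (B : set 'rV[R]_n.+1) : (0 <= lebesgue_rV_step B)%E.
Proof. by rewrite /lebesgue_rV_step /pushforward measure_ge0. Qed.

Let step_sigma_additive : semi_sigma_additive lebesgue_rV_step.
Proof.
have mcons (B : set 'rV[R]_n.+1) : measurable B -> measurable (@cons_rV n @^-1` B).
  by move=> mB; rewrite -[X in measurable X]setTI; exact: measurable_cons_rV.
move=> F mF tF mUF; rewrite /lebesgue_rV_step /pushforward preimage_bigcup.
apply: measure_semi_sigma_additive.
- by move=> i; exact: mcons.
- apply/trivIsetP => /= i j _ _ ij; rewrite -preimage_setI.
  by move/trivIsetP : tF => /(_ _ _ _ _ ij) ->//; rewrite preimage_set0.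
- by rewrite -preimage_bigcup; exact: mcons.
Qed.

HB.instance Definition _ := isMeasure.Build _ _ _ lebesgue_rV_step
  step0 step_ge0 step_sigma_additive.

Let step_sigma_finite : sigma_finite setT lebesgue_rV_step.
Proof.
have /sigma_finiteP[F [TF ndF Foo]] := sigma_finiteT (@lebesgue_measure R).
have /sigma_finiteP[G [TG ndG Goo]] := sigma_finiteT m.
exists (fun i => @uncons_rV n @^-1` (F i `*` G i)).
  rewrite -preimage_bigcup (_ : \bigcup_i _ = setT) ?preimage_setT//.
  apply/seteqP; split => // -[x y] _.
  have : [set: measurableTypeR R] x by [].
  have : [set: 'rV[R]_n] y by [].
  rewrite TF TG => -[j _ Gy] [i _ Fx]; exists (maxn i j) => //; split.
    by move: x Fx; exact/subsetPset/ndF/leq_maxl.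
  by move: y Gy; exact/subsetPset/ndG/leq_maxr.
move=> i; have [mF Fi] := Foo i; have [mG Gi] := Goo i; split.
  rewrite -[X in measurable X]setTI; apply: measurable_uncons_rV => //.
  exact: measurableX.
rewrite /lebesgue_rV_step /pushforward -comp_preimage.
rewrite (_ : _ \o _ = id); last by apply/funext => p /=; exact: cons_rVK.
by rewrite preimage_id product_measure1E// lte_mul_pinfty// ge0_fin_numE.
Qed.

HB.instance Definition _ := Measure_isSigmaFinite.Build _ _ _ lebesgue_rV_step
  step_sigma_finite.

End step.

(* N-dimensional Lebesgue measure, as an iterated product *)
Fixpoint lebesgue_rV n : {sigma_finite_measure set 'rV[R]_n -> \bar R} :=
  match n with
  | 0 => \d_ (0 : 'rV[R]_0)
  | n'.+1 => lebesgue_rV_step (lebesgue_rV n')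
  end.

End lebesgue_rV.

Section euclidean.
Context {R : realType} {N : nat}.
Implicit Types (f g u : 'rV[R]_N -> R) (x : 'rV[R]_N).

(* Euclidean norm; the library norm `|x| on 'rV is the sup norm. *)
Definition enorm x : R := Num.sqrt (\sum_i x ord0 i ^+ 2).

Definition partial (i : 'I_N) f : 'rV[R]_N -> R :=
  fun x => 'D_(delta_mx ord0 i) f x.

Definition laplacian f : 'rV[R]_N -> R := fun x => \sum_i partial i (partial i f) x.

(* C^oo: all iterated partial derivatives exist and are continuous *)
Definition smooth f := forall s : seq 'I_N,
  let g := foldr partial f s in
  continuous g /\ forall i x, derivable g x (delta_mx ord0 i).

(* C_c^oo(R^N) *)
Definition test_function f :=
  smooth f /\ compact (closure [set x | f x != 0]).

Definition locally_integrable_rV f := forall K : set 'rV[R]_N,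
  compact K -> (lebesgue_rV N).-integrable K (EFin \o f).

Definition weak_gradient u (G : 'rV[R]_N -> 'rV[R]_N) :=
  locally_integrable_rV u /\
  forall l, locally_integrable_rV (fun x => G x ord0 l) /\
    forall phi, test_function phi ->
      (\int[lebesgue_rV N]_x (u x * partial l phi x)%:E =
       - \int[lebesgue_rV N]_x (G x ord0 l * phi x)%:E)%E.

Definition crit_exp : R := (2 * N)%:R / (N%:R - 2).

Definition D12 u :=
  u \in Lfun (lebesgue_rV N) crit_exp%:E /\
  exists2 G, weak_gradient u G & enorm \o G \in Lfun (lebesgue_rV N) 2%:E.

(* Weak solutions of
   - Delta v_i = N (N + 2) / (1 + |x|^2)^2 \sum_j a_ij v_j, v_i in D^{1,2}.
   Weak gradients are unique a.e., so the choice of G below is immaterial. *)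
Definition weak_solution k (A : 'M[R]_k) (v : 'rV[R]_N -> 'cV[R]_k) :=
  (forall i, D12 (fun x => v x i ord0)) /\
  forall i G, weak_gradient (fun x => v x i ord0) G ->
    forall phi, test_function phi ->
      (\int[lebesgue_rV N]_x (\sum_l G x ord0 l * partial l phi x)%:E =
       \int[lebesgue_rV N]_x
         ((N * (N + 2))%:R / (1 + enorm x ^+ 2) ^+ 2
          * (\sum_j A i j * v x j ord0) * phi x)%:E)%E.

(* Spherical harmonics on the unit sphere. Functions on the sphere are given
   by arbitrary extensions to R^N. *)
Definition homogeneous_polynomial d f :=
  exists c : {ffun 'I_N -> 'I_d.+1} -> R, forall x,
    f x = \sum_(a : {ffun 'I_N -> 'I_d.+1} | (\sum_i a i == d)%N)
            c a * \prod_i x ord0 i ^+ a i.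

Definition spherical_harmonic Y := exists d P,
  [/\ homogeneous_polynomial d P, (forall x, laplacian P x = 0) &
      forall x, enorm x = 1 -> Y x = P x].

(* Laplace-Beltrami operator of the unit sphere, at a point of the sphere:
   Laplacian of the extension that is constant along rays *)
Definition laplace_beltrami Y : 'rV[R]_N -> R :=
  laplacian (fun x => Y ((enorm x)^-1 *: x)).

Definition spherical_harmonic_eig (mu : R) Y :=
  spherical_harmonic Y /\
  forall x, enorm x = 1 -> - laplace_beltrami Y x = mu * Y x.

Definition bubble x : R :=
  (N%:R * (N%:R - 2)) `^ ((N%:R - 2) / 4)
    / (1 + enorm x ^+ 2) `^ ((N%:R - 2) / 2).

End euclidean.

Section jacobi.
Context {R : realType}.

(* binomial coefficient with real upper argument *)
Definition gbinom (a : R) (s : nat) : R :=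
  (\prod_(i < s) (a - i%:R)) / s`!%:R.

Definition jacobi (m : nat) (b c xi : R) : R :=
  \sum_(s < m.+1) gbinom (m%:R + b) s * gbinom (m%:R + c) (m - s)
    * ((xi - 1) / 2) ^+ (m - s) * ((xi + 1) / 2) ^+ s.

End jacobi.

Section solutions.
Context {R : realType}.

Definition lambda (N n : nat) : R :=
  (2 * n%:R + N%:R - 2) * (2 * n%:R + N%:R) / (N%:R * (N%:R + 2)).

(* The value at x = 0, where theta = x / |x| is undefined, is irrelevant. *)
Definition wfun (N n h : nat) (Y : 'rV[R]_N -> R) (x : 'rV[R]_N) : R :=
  let r := enorm x in
  let b := h%:R + (N%:R - 2) / 2 in
  r ^+ h / (1 + r ^+ 2) `^ b
    * jacobi (n - h) b b ((1 - r ^+ 2) / (1 + r ^+ 2))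
    * Y (r^-1 *: x).

Definition lin_span (V : lmodType R) (S : set V) : set V :=
  [set v | exists m (a : 'I_m -> R) (g : 'I_m -> V),
     (forall j, S (g j)) /\ v = \sum_j a j *: g j].

Definition associated_solutions (N k : nat) (A : 'M[R]_k) (n : nat) :
    set ('rV[R]_N -> 'cV[R]_k) :=
  lin_span [set v | exists h c Y,
    [/\ (h <= n)%N, A *m c = lambda N n *: c,
        spherical_harmonic_eig (h%:R * (h%:R + N%:R - 2)) Y &
        v = fun x => wfun n h Y x *: c]].

End solutions.

Arguments lambda {R} N n.
Arguments associated_solutions {R} N {k} A n.

(* Main.v *)
(* Inverse stereographic projection conjugates [1/4 (1 + |x|^2)^2 (-Delta)] to the
   conformal Laplacian of the sphere S^N, so spherical harmonics of degree n on S^N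
   become the functions w_{n,h}, which solve the scalar equation with factor lambda_n.
   After replacing the angular factor r^h Y_h by the homogeneous harmonic polynomial
   it comes from, this is the Jacobi differential equation.

   Conversely, testing a weak solution v against these explicit functions (a cutoff
   argument justified by decay) shows that the vector of moments of v against a
   solution of level n is an eigenvector of A for lambda_n, hence vanishes unless
   lambda_n is an eigenvalue. Subtracting the orthogonal projections of v on the
   finitely many admissible levels leaves a function with all moments zero. Harmonic
   decomposition of homogeneous polynomials and the nondegeneracy of the Jacobi
   polynomials identify the span of all levels with polynomials in the stereographic
   coordinates. The indicators of the orthants {x_i >= a_i} are bounded pointwise
   limits of these, so the remainder vanishes almost everywhere. *)
From HB Require Import structures.
From mathcomp Require Import all_boot all_order all_algebra.
From mathcomp Require Import all_classical all_reals all_analysis.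
From mathcomp Require Import measurable_realfun ring lra perm spectral complex.
Require Import Defs.

Set Implicit Arguments.
Unset Strict Implicit.
Unset Printing Implicit Defensive.

Import Order.TTheory GRing.Theory Num.Theory.
Import numFieldNormedType.Exports.

Local Open Scope classical_set_scope.
Local Open Scope ring_scope.

(** Weak solutions are never shown to be regular: they enter only through integrals against explicit
    functions, and only explicit functions are differentiated. Hence the inductive class [elem],
    closed under partial derivatives, and the immediate trade of every weak gradient for the
    Laplacian of a test function. The cutoff step rests on a count of exponents: the explicit
    solutions decay like |x|^(2-N), so the terms produced by differentiating the cutoff decay like
    |x|^(-N), uniformly in its scale; this lies in L^(2N/(N+2)), the dual of the space that contains
    D^{1,2}, and dominated convergence applies. The pairing weighted by the potential is, up to a
    constant, the L^2 product on the sphere, for which distinct levels are orthogonal. Each level is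
    finite-dimensional, and injectivity of n -> lambda_n leaves at most k admissible levels, so the
    projection to subtract is a finite sum. The functions w_{n,h} have an arbitrary value at the
    origin, hence every comparison with their smooth versions is made off the origin or almost
    everywhere. *)

Lemma is_derive_line (R : realType) (V : normedModType R) (f : V -> R) (x v : V) (d : R) :
  is_derive x v f d <-> is_derive (0 : R) 1 (fun t : R => f (t *: v + x)) d.
Proof.
have E : (fun h : R => h^-1 *: ((f \o shift x) (h *: v) - f x)) =
  (fun h : R => h^-1 *: (((fun t : R => f (t *: v + x)) \o shift 0) (h *: 1) - (fun t : R => f (t *: v + x)) 0)).
  apply/funext => h /=; rewrite scale0r add0r addr0.
  by congr (_ *: (f (_ *: _ + _) - _)); rewrite /GRing.scale/= mulr1.
split => -[D Dv]; constructor.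
- by rewrite /derivable -E.
- by rewrite /derive -E.
- by rewrite /derivable E.
- by rewrite /derive E.
Qed.

(** Along the direction [v] everything is a function of one real variable, so a mere directional
    derivative of [f] is enough for the chain rule with an outer function on the line. *)
Lemma is_derive_comp (R : realType) (V : normedModType R) (f : V -> R) (g : R -> R)
    (x v : V) (df dg : R) :
  is_derive x v f df -> is_derive (f x) 1 g dg ->
  is_derive x v (fun y => g (f y)) (dg * df).
Proof.
move=> /is_derive_line Hf Hg; apply/is_derive_line.
have Hg' : is_derive (f (0 *: v + x)) 1 g dg by rewrite scale0r add0r.
exact: (@is_derive1_comp _ g (fun t : R => f (t *: v + x)) 0 _ _ Hg' Hf).
Qed.

Section pointwise_rules.
Context {R : realType} {V : normedModType R}.
Implicit Types (f g : V -> R) (x v : V) (a b : R).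

Lemma is_derive_eqr f x v a b : is_derive x v f a -> a = b -> is_derive x v f b.
Proof. by move=> ? <-. Qed.

Lemma is_derive_const c x v : is_derive x v (fun _ : V => c : R) 0.
Proof. exact: is_derive_cst. Qed.

Lemma is_derive_addf f g x v a b : is_derive x v f a -> is_derive x v g b ->
  is_derive x v (fun y => f y + g y) (a + b).
Proof. by move=> Hf Hg; exact: (@is_deriveD _ _ _ f g x v a b Hf Hg). Qed.

Lemma is_derive_oppf f x v a : is_derive x v f a -> is_derive x v (fun y => - f y) (- a).
Proof. by move=> Hf; exact: (@is_deriveN _ _ _ f x v a Hf). Qed.

Lemma is_derive_mulf f g x v a b : is_derive x v f a -> is_derive x v g b ->
  is_derive x v (fun y => f y * g y) (a * g x + f x * b).
Proof.
move=> Hf Hg; have -> : a * g x + f x * b = f x *: b + g x *: a.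
  by rewrite /GRing.scale/= addrC [g x * a]mulrC.
exact (@is_deriveM _ _ f g x v a b Hf Hg).
Qed.

Lemma is_derive_scalef c f x v a : is_derive x v f a ->
  is_derive x v (fun y => c * f y) (c * a).
Proof.
move=> Hf; have H := @is_derive_mulf (fun=> c) f x v 0 a (is_derive_cst _ _ _) Hf.
by apply: is_derive_eqr H _; rewrite mul0r add0r.
Qed.

Lemma is_derive_expf n f x v a : is_derive x v f a ->
  is_derive x v (fun y => f y ^+ n) (n%:R * f x ^+ n.-1 * a).
Proof.
move=> Hf; elim: n => [|n IH].
  by rewrite !mul0r; under eq_fun do rewrite expr0; exact: is_derive_cst.
under eq_fun do rewrite exprS.
apply: is_derive_eqr (is_derive_mulf Hf IH) _.
by case: n {IH} => [|n] /=; rewrite ?expr0 ?exprS; ring.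
Qed.

Lemma is_derive_sumf (I : Type) (s : seq I) (F : I -> V -> R) (dF : I -> R) x v :
  (forall i, is_derive x v (F i) (dF i)) ->
  is_derive x v (fun y => \sum_(i <- s) F i y) (\sum_(i <- s) dF i).
Proof.
move=> HF; elim: s => [|i s IH].
  rewrite big_nil (_ : (fun _ => _) = cst 0); first exact: is_derive_cst.
  by apply/funext => y; rewrite big_nil.
rewrite big_cons (_ : (fun _ => _) = (fun y => F i y + \sum_(j <- s) F j y)).
  exact: is_derive_addf.
by apply/funext => y; rewrite big_cons.
Qed.

End pointwise_rules.

Lemma is_derive_invf (R : realType) (x : R) : x != 0 ->
  is_derive x 1 (fun t : R => t^-1) (- x ^- 2).
Proof.
move=> x0; apply: is_derive_eq; first by apply: (@is_deriveV _ id).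
by rewrite /GRing.scale /= mulr1.
Qed.

Lemma is_derive_continuous (R : realType) (f : R -> R) (x d : R) :
  is_derive x 1 f d -> {for x, continuous f}.
Proof. by move=> [D _]; apply: differentiable_continuous; exact/derivable1_diffP. Qed.

(** The difference quotient at 0 is at most [C] times |h|. This settles the delicate point of
    [bump_profile], the junction at 0. *)
Lemma is_derive0_quadratic (R : realType) (f : R -> R) (C : R) :
  f 0 = 0 -> (forall t, `|f t| <= C * t ^+ 2) -> is_derive (0 : R) 1 f 0.
Proof.
move=> f0 fC.
have C0 : 0 <= C by have := fC 1; rewrite expr1n mulr1; apply: le_trans.
have L : (fun h : R => h^-1 *: ((f \o shift 0) (h *: 1) - f 0)) @ 0^' --> (0 : R).
  apply/cvgrPdist_le => e e0.
  near=> h.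
  rewrite f0 subr0 sub0r normrN /= addr0 /GRing.scale/= mulr1 normrM normfV.
  have h0 : h != 0 by near: h; exact: nbhs_dnbhs_neq.
  have hn : 0 < `|h| by rewrite normr_gt0.
  rewrite ler_pdivrMl//; apply: (le_trans (fC h)).
  have -> : C * h ^+ 2 = (C * `|h|) * `|h| by rewrite -mulrA -expr2 real_normK// num_real.
  rewrite [leRHS]mulrC ler_pM2r//.
  (* [C] may be 0, so it is enlarged to C + 1 before the division. *)
  apply: (@le_trans _ _ ((C + 1) * `|h|)); first by rewrite ler_pM2r// lerDl.
  rewrite -ler_pdivlMl; last by rewrite ltr_wpDl.
  near: h; apply/dnbhs0_le; by rewrite mulr_gt0// invr_gt0 ltr_wpDl.
constructor; first by apply/cvg_ex; exists 0.
exact/cvg_lim.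
Unshelve. all: end_near. Qed.

(** * The smooth cutoff profile *)

Section bump.
Context {R : realType}.
Implicit Types (k : nat) (t : R).

(** The factors t^-k make the family generated by e^(-1/t) closed under differentiation: level k
    goes to levels k + 1 and k + 2, so smoothness needs a single derivative formula. *)
Definition bump_profile k t : R := if 0 < t then t^-1 ^+ k * expR (- t^-1) else 0.

(** Use y <= e^y at y = u / (k + 1) and raise to the power k: the resulting exponent k u / (k + 1)
    is at most u. Dividing by k + 1 rather than k covers k = 0. *)
Lemma exprn_le_expR k (u : R) : 0 <= u -> u ^+ k <= k.+1%:R ^+ k * expR u.
Proof.
move=> u0.
have k0 : (0 : R) < k.+1%:R by [].
have -> : u ^+ k = k.+1%:R ^+ k * (u / k.+1%:R) ^+ k.
  by rewrite -exprMn mulrCA divff ?mulr1// gt_eqF.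
rewrite ler_pM2l ?exprn_gt0//.
apply: (@le_trans _ _ (expR (u / k.+1%:R) ^+ k)).
  apply: lerXn2r; rewrite ?nnegrE ?expR_ge0 ?divr_ge0//.
  by apply: le_trans (expR_ge1Dx _); rewrite lerDr.
rewrite -expRM_natl ler_expR mulrCA ler_piMr// ler_pdivrMr// mul1r ler_nat//.
Qed.

Lemma bump_profile_bound k t : `|bump_profile k t| <= k.+1%:R ^+ k.
Proof.
rewrite /bump_profile; case: ifPn => t0; last by rewrite normr0.
have u0 : 0 <= t^-1 by rewrite invr_ge0 ltW.
rewrite ger0_norm ?mulr_ge0 ?exprn_ge0 ?expR_ge0// expRN ler_pdivrMr ?expR_gt0//.
exact: exprn_le_expR.
Qed.

(** Two of the inverse powers in the uniform bound at level k + 2 pay for t^2. *)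
Lemma bump_profile_quadratic k t : `|bump_profile k t| <= k.+3%:R ^+ k.+2 * t ^+ 2.
Proof.
have := bump_profile_bound k.+2 t; rewrite /bump_profile; case: ifPn => t0 H; last first.
  by rewrite normr0 mulr_ge0 ?sqr_ge0// exprn_ge0.
rewrite -ler_pdivrMr ?exprn_gt0//; apply: le_trans H.
rewrite -[X in _ / X]ger0_norm ?sqr_ge0// -normfV -normrM le_eqVlt; apply/orP; left.
by apply/eqP; congr (`| _ |); rewrite -(addn2 k) exprD [t^-1 ^+ 2]exprVn mulrAC.
Qed.

Lemma is_derive_bump_profile k t :
  is_derive t 1 (bump_profile k) (bump_profile k.+2 t - k%:R * bump_profile k.+1 t).
Proof.
have [t0|t0|->] := ltrgt0P t.
- apply: (@near_eq_is_derive _ _ _ (fun t => t^-1 ^+ k * expR (- t^-1))).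
  + near=> s; rewrite /bump_profile ifT//; near: s; exact: lt_nbhsr.
  + have tN0 : t != 0 by rewrite gt_eqF.
    have H1 := is_derive_invf tN0.
    have H2 := @is_derive_comp _ _ (fun s : R => - s^-1) expR t 1 _ _ (is_derive_oppf H1) (is_derive_expR _).
    apply: is_derive_eqr (is_derive_mulf (is_derive_expf k H1) H2) _.
    rewrite /bump_profile t0 opprK -exprVn.
    case: k => [|k] /=; first by rewrite !(mul0r, mulr0) expr0; ring.
    set u := t^-1; rewrite !exprS; ring.
- rewrite /bump_profile !ifF ?(lt_gtF t0)// mulr0 subr0.
  apply: (@near_eq_is_derive _ _ _ (cst 0)).
  near=> s; rewrite ifF//; apply/negP => s0.
  have : s < 0 by near: s; exact: lt_nbhsl.
  by move=> /(lt_trans s0); rewrite ltxx.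
- rewrite {2 3}/bump_profile ltxx mulr0 subr0.
  apply: (@is_derive0_quadratic _ _ (k.+3%:R ^+ k.+2)); last exact: bump_profile_quadratic.
  by rewrite /bump_profile ltxx.
Unshelve. all: end_near. Qed.

End bump.

Lemma continuous_bigsum (R : realType) (T : topologicalType) (I : Type) (r : seq I)
    (F : I -> T -> R) : (forall i, continuous (F i)) ->
  continuous (fun y => \sum_(i <- r) F i y).
Proof.
move=> HF; elim: r => [|i r IH] x.
  by under eq_fun do rewrite big_nil; apply: cst_continuous.
rewrite (_ : (fun _ => _) = (fun y => F i y + \sum_(j <- r) F j y)).
  by apply: continuousD; [exact: HF|exact: IH].
by apply/funext => y; rewrite big_cons.
Qed.

(** * Explicit functions stable under partial derivatives *)

Section elem.
Context {R : realType} {N : nat}.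
Local Notation V := 'rV[R]_N.
Local Notation e i := (delta_mx ord0 i : V).
Implicit Types (f g : V -> R) (x : V) (c s : R).

Definition sqn x : R := \sum_i x ord0 i ^+ 2.

Definition rho c x : R := (1 + sqn x) `^ (- c).

(** It vanishes where s |x|^2 >= 1; the remaining ball exhausts the space as s decreases to 0. *)
Definition bump k s x : R := bump_profile k (1 - s * sqn x).

(* A class of explicit functions stable under [partial], so that smoothness needs
   only continuity and differentiability of the atoms. *)
Inductive elem : (V -> R) -> Prop :=
| elem_cst c : elem (fun=> c)
| elem_coord i : elem (fun x => x ord0 i)
| elem_rho c : elem (rho c)
| elem_bump k s : elem (bump k s)
| elem_add f g : elem f -> elem g -> elem (fun x => f x + g x)
| elem_mul f g : elem f -> elem g -> elem (fun x => f x * g x).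

Lemma sqn_ge0 x : 0 <= sqn x.
Proof. by apply: sumr_ge0 => i _; exact: sqr_ge0. Qed.

Lemma sqn1_gt0 x : 0 < 1 + sqn x.
Proof. by rewrite ltr_pwDl// sqn_ge0. Qed.

Lemma enorm_sqr x : enorm x ^+ 2 = sqn x.
Proof. by rewrite sqr_sqrtr// sqn_ge0. Qed.

Lemma is_derive_coord i j x : is_derive x (e i) (fun y : V => y ord0 j) (i == j)%:R.
Proof.
have E : (fun t : R => t^-1 *: (((fun y : V => y ord0 j) \o shift x) (t *: e i) - x ord0 j)) @ 0^'
    --> ((i == j)%:R : R).
  apply/cvgrPdist_le => eps eps0; near=> t.
  rewrite /= !mxE addrK eqxx /= [_ *: (_ * _)]/GRing.scale/= mulrA mulVf ?mul1r; last first.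
    by near: t; exact: nbhs_dnbhs_neq.
  by rewrite eq_sym subrr normr0 ltW.
constructor; first by apply/cvg_ex; exists (i == j)%:R.
exact/cvg_lim.
Unshelve. all: end_near. Qed.

Lemma is_derive_sqn i x : is_derive x (e i) sqn (2 * x ord0 i).
Proof.
have H := @is_derive_sumf _ _ _ (index_enum 'I_N) _ _ x (e i)
   (fun j => is_derive_expf 2 (is_derive_coord i j x)).
apply: is_derive_eqr H _.
rewrite (bigD1 i)//= big1 ?addr0 ?eqxx ?mulr1//.
by move=> j ji; rewrite eq_sym (negPf ji) mulr0.
Qed.

Lemma is_derive_rho i c x :
  is_derive x (e i) (rho c) (- (2 * c) * x ord0 i * rho (c + 1) x).
Proof.
have H1 := is_derive_addf (is_derive_const 1 x (e i)) (is_derive_sqn i x).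
have H := is_derive_comp (f := fun y => 1 + sqn y) H1 (is_derive1_powR (- c) (sqn1_gt0 x)).
apply: is_derive_eqr H _.
rewrite /rho opprD; ring.
Qed.

Lemma is_derive_bump i k s x :
  is_derive x (e i) (bump k s)
    (- (2 * s) * x ord0 i * (bump k.+2 s x - k%:R * bump k.+1 s x)).
Proof.
have H1 := is_derive_addf (is_derive_const 1 x (e i))
  (is_derive_oppf (is_derive_scalef s (is_derive_sqn i x))).
have H := is_derive_comp (f := fun y => 1 - s * sqn y) H1 (is_derive_bump_profile k _).
apply: is_derive_eqr H _; rewrite /bump; ring.
Qed.

Lemma elem_opp f : elem f -> elem (fun x => - f x).
Proof.
move=> ef; rewrite (_ : (fun _ => _) = (fun x => -1 * f x)).
  by apply: elem_mul => //; exact: elem_cst.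
by apply/funext => x; rewrite mulN1r.
Qed.

Lemma elem_sub f g : elem f -> elem g -> elem (fun x => f x - g x).
Proof. by move=> ef eg; apply: elem_add => //; exact: elem_opp. Qed.

Lemma elem_scale c f : elem f -> elem (fun x => c * f x).
Proof. by move=> ef; apply: elem_mul => //; exact: elem_cst. Qed.

Lemma elem_sum (I : Type) (r : seq I) (F : I -> V -> R) :
  (forall i, elem (F i)) -> elem (fun x => \sum_(i <- r) F i x).
Proof.
move=> HF; elim: r => [|i r IH].
  by under eq_fun do rewrite big_nil; exact: elem_cst.
by under eq_fun do rewrite big_cons; exact: elem_add.
Qed.

Lemma elem_exp f n : elem f -> elem (fun x => f x ^+ n).
Proof.
move=> ef; elim: n => [|n IH].
  by under eq_fun do rewrite expr0; exact: elem_cst.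
by under eq_fun do rewrite exprS; exact: elem_mul.
Qed.

Lemma elem_horner (p : {poly R}) f : elem f -> elem (fun x => p.[f x]).
Proof.
move=> ef; under eq_fun do rewrite horner_coef.
by apply: elem_sum => i; apply: elem_scale; exact: elem_exp.
Qed.

Lemma elem_sqn : elem sqn.
Proof. by apply: elem_sum => i; apply: elem_exp; exact: elem_coord. Qed.

Lemma elem_derivative f : elem f -> exists2 df : 'I_N -> V -> R,
  forall i, elem (df i) & forall i x, is_derive x (e i) f (df i x).
Proof.
elim=> {f} [c|j|c|k s|f g _ [df Ef Df] _ [dg Eg Dg]|f g ef [df Ef Df] eg [dg Eg Dg]].
- exists (fun _ _ => 0) => [i|i x]; [exact: elem_cst|exact: is_derive_cst].
- exists (fun i _ => (i == j)%:R) => [i|i x]; [exact: elem_cst|exact: is_derive_coord].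
- exists (fun i x => - (2 * c) * x ord0 i * rho (c + 1) x) => [i|i x].
    apply: elem_mul (elem_rho _); apply: elem_scale; exact: elem_coord.
  exact: is_derive_rho.
- exists (fun i x => - (2 * s) * x ord0 i * (bump k.+2 s x - k%:R * bump k.+1 s x)) => [i|i x].
    apply: elem_mul; first by apply: elem_scale; exact: elem_coord.
    by apply: elem_sub; [|apply: elem_scale]; exact: elem_bump.
  exact: is_derive_bump.
- exists (fun i x => df i x + dg i x) => [i|i x]; first exact: elem_add.
  exact: is_derive_addf.
- exists (fun i x => df i x * g x + f x * dg i x) => [i|i x].
    by apply: elem_add; apply: elem_mul.
  exact: is_derive_mulf.
Qed.

Lemma coord_rV_continuous i : continuous (fun x : V => x ord0 i).
Proof. exact: coord_continuous. Qed.

Lemma elem_continuous f : elem f -> continuous f.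
Proof.
have csqn : continuous sqn.
  move=> x; apply: continuous_bigsum => i y.
  by under eq_fun do rewrite expr2; apply: continuousM; exact: coord_rV_continuous.
elim=> {f} [c|j|c|k s|f g _ cf _ cg|f g _ cf _ cg] x.
- exact: cst_continuous.
- exact: coord_rV_continuous.
- apply: (@continuous_comp _ _ _ (fun y => 1 + sqn y) (fun t => t `^ (- c))).
    by apply: continuousD; [exact: cst_continuous|exact: csqn].
  apply: is_derive_continuous; exact: (is_derive1_powR _ (sqn1_gt0 x)).
- apply: (@continuous_comp _ _ _ (fun y => 1 - s * sqn y) (bump_profile k)).
    apply: continuousB; first exact: cst_continuous.
    by apply: continuousM; [exact: cst_continuous|exact: csqn].
  apply: is_derive_continuous; exact: is_derive_bump_profile.
- by apply: continuousD; [exact: cf|exact: cg].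
- by apply: continuousM; [exact: cf|exact: cg].
Qed.

Lemma partialE i f x (d : R) : is_derive x (e i) f d -> partial i f x = d.
Proof. by move=> H; rewrite /partial derive_val. Qed.

Lemma elem_partial i f : elem f -> elem (partial i f).
Proof.
move=> /elem_derivative[df Ef Df]; rewrite (_ : partial i f = df i)//.
by apply/funext => x; exact: partialE.
Qed.

Lemma elem_is_derive i f x : elem f -> is_derive x (e i) f (partial i f x).
Proof. by move=> /elem_derivative[df Ef Df]; rewrite (partialE (Df i x)). Qed.

Lemma elem_smooth f : elem f -> smooth f.
Proof.
move=> ef s; have {ef} : elem (foldr partial f s).
  by elim: s => //= i s IH; exact: elem_partial.
move: (foldr _ _ _) => g eg /=; split; first exact: elem_continuous.
by move=> i x; have [] := elem_is_derive i x eg.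
Qed.

Lemma elem_laplacian f : elem f -> elem (laplacian f).
Proof. by move=> ef; apply: elem_sum => i; do 2 apply: elem_partial. Qed.

Lemma partial_add i f g x : elem f -> elem g ->
  partial i (fun y => f y + g y) x = partial i f x + partial i g x.
Proof. by move=> ef eg; apply: partialE; apply: is_derive_addf; exact: elem_is_derive. Qed.

Lemma partial_mul i f g x : elem f -> elem g ->
  partial i (fun y => f y * g y) x = partial i f x * g x + f x * partial i g x.
Proof. by move=> ef eg; apply: partialE; apply: is_derive_mulf; exact: elem_is_derive. Qed.

Lemma partial_scale i c f x : elem f -> partial i (fun y => c * f y) x = c * partial i f x.
Proof. by move=> ef; apply: partialE; apply: is_derive_scalef; exact: elem_is_derive. Qed.

Lemma laplacian_add f g x : elem f -> elem g ->
  laplacian (fun y => f y + g y) x = laplacian f x + laplacian g x.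
Proof.
move=> ef eg; rewrite /laplacian -big_split/=; apply: eq_bigr => i _.
rewrite -partial_add; [|exact: elem_partial..].
have -> // : partial i (fun y => f y + g y) = (fun y => partial i f y + partial i g y).
by apply/funext => y; exact: partial_add.
Qed.

Lemma laplacian_scale c f x : elem f -> laplacian (fun y => c * f y) x = c * laplacian f x.
Proof.
move=> ef; rewrite /laplacian mulr_sumr; apply: eq_bigr => i _.
rewrite -partial_scale; last exact: elem_partial.
have -> // : partial i (fun y => c * f y) = (fun y => c * partial i f y).
by apply/funext => y; exact: partial_scale.
Qed.

Lemma laplacian_mul f g x : elem f -> elem g ->
  laplacian (fun y => f y * g y) x =
  laplacian f x * g x + 2 * (\sum_i partial i f x * partial i g x) + f x * laplacian g x.
Proof.
move=> ef eg; rewrite /laplacian mulr_suml !mulr_sumr -!big_split/=.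
apply: eq_bigr => i _.
rewrite (_ : partial i (fun y => f y * g y) =
    (fun y => partial i f y * g y + f y * partial i g y)); last first.
  by apply/funext => y; exact: partial_mul.
have [ef' eg'] := (elem_partial i ef, elem_partial i eg).
rewrite partial_add; [|exact: elem_mul..].
rewrite !partial_mul//.
move: (partial i (partial i f) x) (partial i (partial i g) x) (partial i f x) (partial i g x) (f x) (g x).
by move=> a b c d u v; ring.
Qed.

End elem.

(** * Homogeneous polynomials and their harmonic decomposition *)

Section hpoly.
Context {R : realType} {N : nat}.
Local Notation V := 'rV[R]_N.
Local Notation e i := (delta_mx ord0 i : V).
Implicit Types (f g H P : V -> R) (x : V) (d h j : nat).

(** Generators replace families of coefficients, so that each property is an induction over
    multiplication by a coordinate and addition. The zero function has every degree, since
    derivatives may vanish. [hpoly_of_homogeneous] and [homogeneous_of_hpoly] match this with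
    [homogeneous_polynomial]. *)
Inductive hpoly : nat -> (V -> R) -> Prop :=
| hpoly_zero d : hpoly d (fun=> 0)
| hpoly_cst c : hpoly 0 (fun=> c)
| hpoly_coord d i f : hpoly d f -> hpoly d.+1 (fun x => x ord0 i * f x)
| hpoly_add d f g : hpoly d f -> hpoly d g -> hpoly d (fun x => f x + g x).

Lemma hpoly_elem d f : hpoly d f -> elem f.
Proof.
elim=> {d f} [d|c|d i f _ ef|d f g _ ef _ eg]; [exact: elem_cst..| |exact: elem_add].
by apply: elem_mul => //; exact: elem_coord.
Qed.

Lemma hpoly_mul d d' f g : hpoly d f -> hpoly d' g -> hpoly (d + d') (fun x => f x * g x).
Proof.
move=> + Hg; elim=> {d f} [d|c|d i f _ IH|d f1 f2 _ IH1 _ IH2].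
- by under eq_fun do rewrite mul0r; exact: hpoly_zero.
- rewrite add0n; elim: Hg => {d' g} [d|c'|d i g _ IH|d g1 g2 _ IH1 _ IH2].
  + by under eq_fun do rewrite mulr0; exact: hpoly_zero.
  + exact: hpoly_cst.
  + by under eq_fun do rewrite mulrCA; exact: hpoly_coord.
  + by under eq_fun do rewrite mulrDr; exact: hpoly_add.
- by under eq_fun do rewrite -mulrA; rewrite addSn; exact: hpoly_coord.
- by under eq_fun do rewrite mulrDl; exact: hpoly_add.
Qed.

Lemma hpoly_scale c d f : hpoly d f -> hpoly d (fun x => c * f x).
Proof. by move=> hf; rewrite -(add0n d); apply: hpoly_mul => //; exact: hpoly_cst. Qed.

Lemma hpoly_exp d f n : hpoly d f -> hpoly (d * n) (fun x => f x ^+ n).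
Proof.
move=> hf; elim: n => [|n IH].
  by under eq_fun do rewrite expr0; rewrite muln0; exact: hpoly_cst.
by under eq_fun do rewrite exprS; rewrite mulnS; exact: hpoly_mul.
Qed.

Lemma hpoly_sum d (I : Type) (r : seq I) (P : pred I) (F : I -> V -> R) :
  (forall i, P i -> hpoly d (F i)) -> hpoly d (fun x => \sum_(i <- r | P i) F i x).
Proof.
move=> HF; elim: r => [|i r IH].
  by under eq_fun do rewrite big_nil; exact: hpoly_zero.
have [Pi|Pi] := boolP (P i).
  by under eq_fun do rewrite big_cons Pi; apply: hpoly_add => //; exact: HF.
by under eq_fun do rewrite big_cons (negPf Pi).
Qed.

Lemma hpoly_prod (I : Type) (r : seq I) (D : I -> nat) (F : I -> V -> R) :
  (forall i, hpoly (D i) (F i)) ->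
  hpoly (\sum_(i <- r) D i)%N (fun x => \prod_(i <- r) F i x).
Proof.
move=> HF; elim: r => [|i r IH].
  rewrite big_nil (_ : (fun _ => _) = (fun=> 1)); first exact: hpoly_cst.
  by apply/funext => x; rewrite big_nil.
rewrite big_cons (_ : (fun _ => _) = (fun x => F i x * \prod_(j <- r) F j x)).
  exact: hpoly_mul.
by apply/funext => x; rewrite big_cons.
Qed.

Lemma hpoly_coord1 i : hpoly 1 (fun x => x ord0 i).
Proof.
by rewrite (_ : (fun _ => _) = (fun x : V => x ord0 i * 1)); [apply: hpoly_coord; exact: hpoly_cst|
  apply/funext => x; rewrite mulr1].
Qed.

Lemma hpoly_sqn : hpoly 2 sqn.
Proof. by apply: hpoly_sum => i _; exact: (hpoly_exp 2 (hpoly_coord1 i)). Qed.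

Lemma hpoly_homogeneous d f t x : hpoly d f -> f (t *: x) = t ^+ d * f x.
Proof.
elim=> {d f} [d|c|d i f _ IH|d f g _ IH1 _ IH2].
- by rewrite mulr0.
- by rewrite expr0 mul1r.
- by rewrite mxE IH exprS; ring.
- by rewrite IH1 IH2 mulrDr.
Qed.

Lemma partial_cst i c x : partial i (fun _ : V => c) x = 0.
Proof. by apply: partialE; exact: is_derive_const. Qed.

Lemma partial_coord (i j : 'I_N) x : partial i (fun y : V => y ord0 j) x = (i == j)%:R.
Proof. by apply: partialE; exact: is_derive_coord. Qed.

Lemma hpoly_partial i d f : hpoly d f ->
  if d is d'.+1 then hpoly d' (partial i f) else partial i f = (fun=> 0).
Proof.
elim=> {d f} [d|c|d j f hf IH|d f g hf IH1 hg IH2].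
- rewrite (_ : partial i _ = (fun=> 0)); first by case: d => // d; exact: hpoly_zero.
  by apply/funext => x; exact: partial_cst.
- by apply/funext => x; exact: partial_cst.
- rewrite (_ : partial i _ = (fun x => (i == j)%:R * f x + x ord0 j * partial i f x)).
    apply: hpoly_add; first exact: hpoly_scale.
    case: d hf IH => [|d] hf IH; last exact: hpoly_coord.
    by rewrite IH; under eq_fun do rewrite mulr0; exact: hpoly_zero.
  apply/funext => x; rewrite partial_mul ?partial_coord//; first exact: elem_coord.
  exact: hpoly_elem hf.
- rewrite (_ : partial i _ = (fun x => partial i f x + partial i g x)).
    case: d hf hg IH1 IH2 => [_ _ -> ->|d hf hg IH1 IH2]; last exact: hpoly_add.
    by apply/funext => x; rewrite addr0.
  by apply/funext => x; rewrite partial_add//; [exact: hpoly_elem hf|exact: hpoly_elem hg].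
Qed.

Lemma hpoly_euler d f x : hpoly d f -> \sum_i x ord0 i * partial i f x = d%:R * f x.
Proof.
elim=> {d f} [d|c|d j f hf IH|d f g hf IH1 hg IH2].
- by rewrite mulr0 big1// => i _; rewrite partial_cst mulr0.
- by rewrite mul0r big1// => i _; rewrite partial_cst mulr0.
- under eq_bigr => i _.
    rewrite partial_mul ?partial_coord; [|exact: elem_coord|exact: hpoly_elem hf].
    rewrite mulrDr mulrCA [x ord0 i * (x ord0 j * _)]mulrCA; over.
  rewrite big_split/= -mulr_sumr IH (bigD1 j)//= eqxx big1 => [|i ij].
    by rewrite -natr1 mul1r addr0; ring.
  by rewrite (negPf ij) mul0r.
- under eq_bigr => i _.
    rewrite partial_add; [|exact: hpoly_elem hf|exact: hpoly_elem hg].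
    rewrite mulrDr; over.
  by rewrite big_split/= IH1 IH2 mulrDr.
Qed.

Lemma hpoly_laplacian d f : hpoly d f ->
  if d is d'.+2 then hpoly d' (laplacian f) else laplacian f = (fun=> 0).
Proof.
case: d => [|[|d]] hf.
- apply/funext => x; rewrite /laplacian big1// => i _.
  by have -> := hpoly_partial i hf; rewrite partial_cst.
- apply/funext => x; rewrite /laplacian big1// => i _.
  by rewrite (hpoly_partial i (hpoly_partial i hf)).
- by apply: hpoly_sum => i _; exact: (hpoly_partial i (hpoly_partial i hf)).
Qed.

Definition harmonic_hpoly d f := hpoly d f /\ forall x, laplacian f x = 0.

(** For a radial [g] the functions [g1] and [g2] are the successive values of g'/r, given without
    division so that the origin is included. The Laplacian of [g] is N g1 + |x|^2 g2, and Euler's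
    identity turns the cross term into 2 h g1 H. *)
Lemma laplacian_radial_mul (g g1 g2 : V -> R) h H x : elem g -> elem g1 ->
  (forall i y, partial i g y = y ord0 i * g1 y) ->
  (forall i y, partial i g1 y = y ord0 i * g2 y) ->
  harmonic_hpoly h H ->
  laplacian (fun y => g y * H y) x =
  ((N%:R + 2 * h%:R) * g1 x + sqn x * g2 x) * H x.
Proof.
move=> eg eg1 Dg Dg1 [hH H0]; have eH := hpoly_elem hH.
rewrite laplacian_mul// H0 mulr0 addr0.
have -> : laplacian g x = N%:R * g1 x + sqn x * g2 x.
  rewrite /laplacian.
  under eq_bigr => i _.
    have -> : partial i g = (fun y => y ord0 i * g1 y) by apply/funext => y.
    rewrite partial_mul//; last exact: elem_coord.
    rewrite partial_coord eqxx mul1r Dg1 mulrA -expr2; over.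
  by rewrite big_split/= sumr_const card_ord mulr_natl -mulr_suml.
under eq_bigr do rewrite Dg mulrAC.
by rewrite -mulr_suml (hpoly_euler _ hH); ring.
Qed.

Lemma partial_sqn_exp i n x :
  partial i (fun y => sqn y ^+ n) x = x ord0 i * (2 * n%:R * sqn x ^+ n.-1).
Proof.
apply: partialE; apply: is_derive_eqr (is_derive_expf n (is_derive_sqn i x)) _.
by ring.
Qed.

Lemma laplacian_sqn_exp_mul h H n x : harmonic_hpoly h H ->
  laplacian (fun y => sqn y ^+ n.+1 * H y) x =
  2 * n.+1%:R * (N%:R + 2 * n%:R + 2 * h%:R) * (sqn x ^+ n * H x).
Proof.
move=> hH.
rewrite (@laplacian_radial_mul _ (fun y => 2 * n.+1%:R * sqn y ^+ n)
   (fun y => 2 * n.+1%:R * (2 * n%:R * sqn y ^+ n.-1)) h)//.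
- by case: n => [|n] /=; rewrite ?expr0 ?exprS; ring.
- by apply: elem_exp; exact: elem_sqn.
- by apply: elem_scale; apply: elem_exp; exact: elem_sqn.
- by move=> i y; rewrite partial_sqn_exp.
- move=> i y; rewrite partial_scale ?partial_sqn_exp; last by apply: elem_exp; exact: elem_sqn.
  by ring.
Qed.

Inductive harmonic_sum : nat -> (V -> R) -> Prop :=
| harmonic_sum_atom j h H : harmonic_hpoly h H ->
    harmonic_sum (h + 2 * j) (fun x => sqn x ^+ j * H x)
| harmonic_sum_add d f g : harmonic_sum d f -> harmonic_sum d g ->
    harmonic_sum d (fun x => f x + g x).

Lemma harmonic_sum_hpoly d f : harmonic_sum d f -> hpoly d f.
Proof.
elim=> {d f} [j h H [hH _]|d f g _ IH1 _ IH2]; last exact: hpoly_add.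
by rewrite addnC; apply: hpoly_mul => //; apply: hpoly_exp; exact: hpoly_sqn.
Qed.

(** By [laplacian_sqn_exp_mul] the Laplacian of |x|^(2j+2) H is a positive multiple [c] of |x|^(2j)
    H, so a preimage is obtained by raising the power of |x|^2 and dividing by [c]. *)
Lemma harmonic_sum_laplacian_surj d f : (0 < N)%N -> harmonic_sum d f ->
  exists2 Q, harmonic_sum d.+2 Q & forall x, laplacian Q x = f x.
Proof.
move=> N0; elim=> {d f} [j h H hH|d f g _ [Q1 HQ1 E1] _ [Q2 HQ2 E2]].
- pose c : R := 2 * j.+1%:R * (N%:R + 2 * j%:R + 2 * h%:R).
  have c0 : c != 0.
    by rewrite gt_eqF// mulr_gt0 ?mulr_gt0// -addrA ltr_wpDr ?ltr0n// addr_ge0 ?mulr_ge0.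
  have [hpH H0] := hH; have eH := hpoly_elem hpH.
  exists (fun x => sqn x ^+ j.+1 * (c^-1 * H x)) => [|x].
    rewrite -addn2 -addnA -[X in (_ + X)%N]mulnSr.
    apply: harmonic_sum_atom; split; first exact: hpoly_scale.
    by move=> x; rewrite laplacian_scale// H0 mulr0.
  under eq_fun do rewrite mulrCA.
  rewrite laplacian_scale; last first.
    by apply: elem_mul => //; apply: elem_exp; exact: elem_sqn.
  by rewrite (laplacian_sqn_exp_mul j x hH) mulKf.
- have [e1 e2] := (hpoly_elem (harmonic_sum_hpoly HQ1), hpoly_elem (harmonic_sum_hpoly HQ2)).
  exists (fun x => Q1 x + Q2 x) => [|x]; first exact: harmonic_sum_add.
  by rewrite laplacian_add// E1 E2.
Qed.

(* Induction on the degree: if [laplacian f] decomposes, correct it away by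
   [harmonic_sum_laplacian_surj], leaving a harmonic remainder. *)
Lemma harmonic_decomposition d f : (0 < N)%N -> hpoly d f -> harmonic_sum d f.
Proof.
move=> N0; have low n g : hpoly n g -> laplacian g = (fun=> 0) -> harmonic_sum n g.
  move=> hg g0; have := @harmonic_sum_atom 0 n g; rewrite muln0 addn0.
  under eq_fun do rewrite expr0 mul1r.
  by apply; split => // x; rewrite g0.
have [n] := ubnP d; elim: n d f => // n IH [|[|d]] f dn hf.
- by apply: low => //; exact: (hpoly_laplacian hf).
- by apply: low => //; exact: (hpoly_laplacian hf).
- have hL := hpoly_laplacian hf; rewrite /= in hL.
  have [|Q HQ EQ] := harmonic_sum_laplacian_surj N0 (IH _ _ _ hL).
    by rewrite ltnS in dn; rewrite (leq_trans _ dn).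
  have hQ := harmonic_sum_hpoly HQ.
  have -> : f = (fun x => (f x + -1 * Q x) + Q x).
    by apply/funext => x; rewrite mulN1r subrK.
  apply: harmonic_sum_add => //; apply: low.
    by apply: hpoly_add => //; exact: hpoly_scale.
  have [ef eQ] := (hpoly_elem hf, hpoly_elem hQ).
  apply/funext => x; rewrite laplacian_add ?laplacian_scale//; last exact: elem_scale.
  by rewrite EQ mulN1r subrr.
Qed.

Lemma hpoly_of_homogeneous d f : homogeneous_polynomial d f -> hpoly d f.
Proof.
move=> [c E]; rewrite (_ : f = fun x => \sum_(a : {ffun 'I_N -> 'I_d.+1} | (\sum_i a i == d)%N)
            c a * \prod_i x ord0 i ^+ a i); last by apply/funext.
apply: hpoly_sum => a /eqP ad; apply: hpoly_scale; rewrite -[X in hpoly X]ad.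
apply: hpoly_prod => i; rewrite -[X in hpoly X]mul1n; apply: hpoly_exp; exact: hpoly_coord1.
Qed.

Lemma homogeneous_monomial d (c : R) (g : 'I_N -> nat) : (\sum_i g i = d)%N ->
  homogeneous_polynomial d (fun x : V => c * \prod_i x ord0 i ^+ g i).
Proof.
move=> gd.
have gle i : (g i < d.+1)%N by rewrite ltnS -gd (bigD1 i)//= leq_addr.
pose a0 : {ffun 'I_N -> 'I_d.+1} := [ffun i => Ordinal (gle i)].
exists (fun a => if a == a0 then c else 0) => x.
have a0g i : nat_of_ord (a0 i) = g i by rewrite ffunE.
rewrite (bigD1 a0)/=; last by under eq_bigr do rewrite a0g; rewrite gd.
rewrite eqxx [X in _ + X]big1 ?addr0 => [|a /andP[_ /negPf ->]]; last by rewrite mul0r.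
by congr (_ * _); apply: eq_bigr => i _; rewrite a0g.
Qed.

Lemma homogeneous_add d f g : homogeneous_polynomial d f -> homogeneous_polynomial d g ->
  homogeneous_polynomial d (fun x => f x + g x).
Proof.
move=> [c E] [c' E']; exists (fun a => c a + c' a) => x; rewrite E E' -big_split/=.
by apply: eq_bigr => a _; rewrite mulrDl.
Qed.

(** Monomials are first collected in a list with unbounded exponents, where multiplication by a
    coordinate is a map. The exponents fit into ['I_d.+1] afterwards, because they add up to d. *)
Lemma homogeneous_of_hpoly d f : hpoly d f -> homogeneous_polynomial d f.
Proof.
move=> hf.
have [J] : exists2 J : seq (R * ('I_N -> nat)), forall p, List.In p J -> (\sum_i p.2 i = d)%N &
    f = fun x => \sum_(p <- J) p.1 * \prod_i x ord0 i ^+ p.2 i.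
  elim: hf => {d f} [d|c|d j f _ [J HJ ->]|d f g _ [J HJ ->] _ [K HK ->]].
  - by exists [::] => //; apply/funext => x; rewrite big_nil.
  - exists [:: (c, fun=> 0%N)] => [p /= [<-|//]|]; first by rewrite big1.
    apply/funext => x; rewrite big_cons big_nil addr0 /=.
    by rewrite [X in _ * X]big1 ?mulr1// => i _; rewrite expr0.
  - exists [seq (p.1, fun i => (p.2 i + (i == j))%N) | p <- J] => [p|].
      move=> /List.in_map_iff[q [<- /HJ qd]] /=.
      by rewrite big_split/= qd -big_mkcond/= big_pred1_eq addn1.
    apply/funext => x; rewrite big_map mulr_sumr; apply: eq_bigr => p _ /=.
    rewrite mulrCA; congr (_ * _).
    under [RHS]eq_bigr do rewrite exprD.
    rewrite big_split/= mulrC; congr (_ * _).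
    by rewrite (bigD1 j)//= eqxx expr1 big1 ?mulr1// => i /negPf ->; rewrite expr0.
  - exists (J ++ K) => [p /List.in_app_iff[/HJ//|/HK//]|].
    by apply/funext => x; rewrite big_cat.
move=> HJ ->; elim: J HJ => [|p J IH] HJ.
  under eq_fun do rewrite big_nil; exists (fun=> 0) => x.
  by rewrite big1// => a _; rewrite mul0r.
under eq_fun do rewrite big_cons; apply: homogeneous_add.
  by apply: homogeneous_monomial; apply: HJ; left.
by apply: IH => q qJ; apply: HJ; right.
Qed.

End hpoly.

(** * Jacobi polynomials with equal parameters *)

Section jacobi_polynomial.
Context {R : realType}.
Implicit Types (b c t : R) (m i j n : nat) (p q : {poly R}).

Definition jac_term i j : {poly R} :=
  (2^-1 *: ('X - 1)) ^+ i * (2^-1 *: ('X + 1)) ^+ j.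

Definition jac_coef m b (s : nat) : R :=
  gbinom (m%:R + b) s * gbinom (m%:R + b) (m - s).

Definition jac_poly m b : {poly R} :=
  \sum_(s < m.+1) jac_coef m b s *: jac_term (m - s) s.

Lemma horner_jac_term i j t :
  (jac_term i j).[t] = ((t - 1) / 2) ^+ i * ((t + 1) / 2) ^+ j.
Proof. by rewrite /jac_term !hornerE ![2^-1 * _]mulrC. Qed.

Lemma horner_jac_poly m b t : (jac_poly m b).[t] = jacobi m b b t.
Proof.
rewrite /jac_poly horner_sum; apply: eq_bigr => s _.
by rewrite hornerZ horner_jac_term /jac_coef mulrA.
Qed.

Lemma deriv_jac_term i j : (jac_term i j)^`() =
  (i%:R / 2) *: jac_term i.-1 j + (j%:R / 2) *: jac_term i j.-1.
Proof.
rewrite /jac_term derivM !deriv_exp !derivZ.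
have -> : ('X - 1 : {poly R})^`() = 1 by rewrite -polyC1 derivB derivX derivC subr0.
have -> : ('X + 1 : {poly R})^`() = 1 by rewrite -polyC1 derivD derivX derivC addr0.
rewrite -!scalerAl !mul1r !scalerMnl -scalerAl -scalerAr.
by rewrite !mulr_natl.
Qed.

(** With i + j fixed, the Jacobi operator couples a term only to its two neighbours. The truncated
    predecessors at i = 0 or j = 0 are harmless, as they come with the factor i or j. *)
Lemma jac_term_ode b i j t (T := jac_term i j) :
  (1 - t ^+ 2) * T^`()^`().[t] - 2 * (b + 1) * t * T^`().[t]
    + (i + j)%:R * ((i + j)%:R + 2 * b + 1) * T.[t] =
  j%:R * (j%:R + b) * (T.[t] - (jac_term i.+1 j.-1).[t])
  - i%:R * (i%:R + b) * ((jac_term i.-1 j.+1).[t] - T.[t]).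
Proof.
rewrite /T !(deriv_jac_term, derivD, derivZ) !(hornerD, hornerZ, horner_jac_term).
case: i {T} => [|[|i]]; case: j => [|[|j]] /=;
  rewrite ?addn0 ?add0n ?addn1 ?add1n ?expr0 ?expr1 ?exprS; by field.
Qed.

Lemma gbinomS b s : gbinom b s.+1 * s.+1%:R = (b - s%:R) * gbinom b s.
Proof.
rewrite /gbinom big_ord_recr/= factS natrM.
have : s`!%:R != 0 :> R by rewrite pnatr_eq0 -lt0n fact_gt0.
move=> f0; have s0 : s.+1%:R != 0 :> R by rewrite pnatr_eq0.
rewrite invfM; move: (\prod_(i < s) _) (b - s%:R) => P q.
transitivity (q * (P / s`!%:R) * (s.+1%:R^-1 * s.+1%:R)); first by ring.
by rewrite mulVf// mulr1.
Qed.

(** Both sides reduce to the same product by [gbinomS]. This is the balance that makes neighbouring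
    contributions cancel in the differential equation. *)
Lemma jac_coefS m b s : (s < m)%N ->
  s.+1%:R * (s.+1%:R + b) * jac_coef m b s.+1 =
  (m - s)%:R * ((m - s)%:R + b) * jac_coef m b s.
Proof.
move=> sm; rewrite /jac_coef.
have H1 := gbinomS (m%:R + b) s.
have H2 := gbinomS (m%:R + b) (m - s.+1).
have E : ((m - s.+1).+1 = m - s)%N by rewrite subnSK.
rewrite E in H2.
have -> : (m - s)%:R = m%:R - s%:R :> R by rewrite natrB// ltnW.
have E2 : (m - s.+1)%:R = m%:R - s.+1%:R :> R by rewrite natrB.
rewrite E2 natrB ?(ltnW sm)// -[in m%:R + b - _]natr1 in H2.
transitivity (gbinom (m%:R + b) s.+1 * s.+1%:R * ((s.+1%:R + b) * gbinom (m%:R + b) (m - s.+1))).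
  by ring.
rewrite H1 -[s.+1%:R]natr1.
transitivity ((m%:R + b - s%:R) * gbinom (m%:R + b) s *
   ((m%:R + b - (m%:R - (s%:R + 1))) * gbinom (m%:R + b) (m - s.+1))); first by ring.
by rewrite -H2; ring.
Qed.

(** [W s] is the exchange between the terms s - 1 and s. By [jac_coefS] each summand equals W s
    minus W (s + 1), and nothing flows through the two ends. *)
Lemma jac_poly_ode m b t (P := jac_poly m b) :
  (1 - t ^+ 2) * P^`()^`().[t] - 2 * (b + 1) * t * P^`().[t]
    + m%:R * (m%:R + 2 * b + 1) * P.[t] = 0.
Proof.
pose L q := (1 - t ^+ 2) * q^`()^`().[t] - 2 * (b + 1) * t * q^`().[t]
    + m%:R * (m%:R + 2 * b + 1) * q.[t].
have LD q1 q2 : L (q1 + q2) = L q1 + L q2 by rewrite /L !(derivD, hornerD); ring.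
have LZ c q : L (c *: q) = c * L q by rewrite /L !(derivZ, hornerZ); ring.
have L0 : L 0 = 0 by rewrite /L !(deriv0, horner0); ring.
rewrite -/(L P) /P /jac_poly (big_morph L LD L0).
(* the sum telescopes *)
pose W s := s%:R * (s%:R + b) * jac_coef m b s *
  ((jac_term (m - s) s).[t] - (jac_term (m - s).+1 s.-1).[t]).
have E (s : 'I_m.+1) : L (jac_coef m b s *: jac_term (m - s) s) =
    (if (s < m)%N then - W s.+1 else 0) + W s.
  rewrite LZ /L; have sm : (s <= m)%N by rewrite -ltnS.
  have := jac_term_ode b (m - s) s t; rewrite subnK// => ->.
  case: ifPn => [lt_sm|]; last first.
    rewrite -leqNgt => ms; have -> : nat_of_ord s = m by apply/eqP; rewrite eqn_leq sm.
    by rewrite /W subnn mul0r mul0r add0r subr0; ring.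
  rewrite /W jac_coefS// subnSK//.
  have -> : (m - s.+1 = (m - s).-1)%N by rewrite subnS.
  by rewrite /=; ring.
under eq_bigr do rewrite E.
rewrite big_split/= big_ord_recr/= ltnn addr0.
under eq_bigr do rewrite ltn_ord.
rewrite big_ord_recl.
have -> : W 0%N = 0 by rewrite /W; ring.
by rewrite add0r -big_split/= big1// => i _; rewrite addNr.
Qed.

Lemma gbinom_gt0 b s : s%:R < b + 1 -> 0 < gbinom b s.
Proof.
move=> sb; rewrite /gbinom divr_gt0 ?ltr0n ?fact_gt0//.
apply: prodr_gt0 => i _; rewrite subr_gt0 -(ltrD2r 1) (le_lt_trans _ sb)//.
by rewrite natr1 ler_nat.
Qed.

Lemma jac_coef_gt0 m b s : 0 <= b -> (s <= m)%N -> 0 < jac_coef m b s.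
Proof.
move=> b0 sm; have le k : (k <= m)%N -> k%:R < m%:R + b + 1 :> R.
  by move=> km; rewrite ltr_pwDr// ler_wpDr// ler_nat.
by rewrite mulr_gt0// gbinom_gt0// le// leq_subr.
Qed.

Lemma size_jac_poly_le m b : (size (jac_poly m b) <= m.+1)%N.
Proof.
apply: (leq_trans (size_sum _ _ _)); apply/bigmax_leqP => s _.
apply: (leq_trans (size_scale_leq _ _)).
have H n (q : {poly R}) : (size q <= 2)%N -> (size (q ^+ n) <= n.+1)%N.
  move=> q2; apply: (leq_trans (size_exp_leq _ _)); rewrite ltnS.
  by rewrite -{2}(mul1n n) leq_mul2r; apply/orP; right; case: (size q) q2.
apply: (leq_trans (size_mul_leq _ _)).
have s1 : (size (2^-1 *: ('X - 1) : {poly R}) <= 2)%N.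
  by apply: (leq_trans (size_scale_leq _ _)); rewrite -polyC1 size_XsubC.
have s2 : (size (2^-1 *: ('X + 1) : {poly R}) <= 2)%N.
  by apply: (leq_trans (size_scale_leq _ _)); rewrite -polyC1 size_XaddC.
have h1 := H (m - s)%N _ s1; have h2 := H s _ s2.
have sm : (s <= m)%N by rewrite -ltnS.
apply: (@leq_trans ((m - s).+1 + s.+1).-1); first by rewrite -!subn1 leq_sub2r// leq_add.
by rewrite addSn addnS /= subnK.
Qed.

(** Every summand contributes to degree m with the same positive sign, because [b] is nonnegative,
    so the contributions cannot cancel. *)
Lemma jac_poly_lead m b : 0 <= b -> (jac_poly m b)`_m != 0.
Proof.
move=> b0.
have T1 i j : (jac_term i j)`_(i + j) = 2^-1 ^+ (i + j).
  rewrite /jac_term -polyC1 !exprZn -scalerAl -scalerAr scalerA -exprD coefZ.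
  have m1 : ('X - 1%:P : {poly R}) ^+ i \is monic by exact/monic_exp/monicXsubC.
  have m2 : ('X + 1%:P : {poly R}) ^+ j \is monic.
    by apply: monic_exp; rewrite -[1%:P]opprK -polyCN monicXsubC.
  suff -> : (('X - 1%:P) ^+ i * ('X + 1%:P) ^+ j : {poly R})`_(i + j) = 1 by rewrite mulr1.
  have m12 : ('X - 1%:P : {poly R}) ^+ i * ('X + 1%:P) ^+ j \is monic by rewrite rpredM.
  have sz : size (('X - 1%:P : {poly R}) ^+ i * ('X + 1%:P) ^+ j) = (i + j).+1.
    rewrite size_monicM// ?monic_neq0// size_exp_XsubC.
    rewrite -[1%:P in X in size X]opprK -polyCN size_exp_XsubC.
    by rewrite addSn addnS.
  by have /monicP := m12; rewrite lead_coefE sz.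
have pos s : (s <= m)%N -> 0 < (jac_coef m b s *: jac_term (m - s) s)`_m.
  move=> sm; rewrite coefZ; have := T1 (m - s)%N s; rewrite subnK// => ->.
  by rewrite mulr_gt0 ?jac_coef_gt0 ?exprn_gt0.
rewrite /jac_poly coef_sum big_ord_recl/= gt_eqF// ltr_pwDl ?pos//.
by apply: sumr_ge0 => s _; apply/ltW/pos; exact: (ltn_ord s).
Qed.

(** Triangularity in the degree: subtracting a suitable multiple of the Jacobi polynomial of the
    same degree lowers the size. The predicate form fits its use, with [Z] the vanishing of a
    moment. *)
Lemma jac_poly_span b (Z : {poly R} -> Prop) : 0 <= b -> Z 0 ->
  (forall p q, Z p -> Z q -> Z (p + q)) -> (forall c p, Z p -> Z (c *: p)) ->
  (forall m, Z (jac_poly m b)) -> forall p, Z p.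
Proof.
move=> b0 Z0 ZD ZZ ZJ p; have [n] := ubnP (size p); elim: n p => // n IH p pn.
have [->//|p0] := eqVneq p 0.
have szp : (0 < size p)%N by rewrite size_poly_gt0.
set m := (size p).-1; set J := jac_poly m b.
have Em : m.+1 = size p by rewrite prednK.
pose c := p`_m / J`_m.
rewrite -(subrK (c *: J) p); apply: ZD; last exact/ZZ/ZJ.
apply: IH; apply: (@leq_trans m.+1); last by rewrite Em -ltnS.
rewrite ltnS; apply/leq_sizeP => j; rewrite leq_eqVlt => /orP[/eqP <-|mj].
  by rewrite coefB coefZ divfK ?subrr// jac_poly_lead.
rewrite coefB coefZ !nth_default ?mulr0 ?subr0//; last by rewrite -Em.
exact: leq_trans (size_jac_poly_le _ _) _.
Qed.

End jacobi_polynomial.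

(** * Explicit solutions of the scalar equation *)

Section bubble_functions.
Context {R : realType} {N : nat}.
Local Notation V := 'rV[R]_N.
Local Notation e i := (delta_mx ord0 i : V).
Implicit Types (f g H P Y : V -> R) (x : V) (d h j n : nat) (p q : {poly R}).

Lemma rhoD c c' x : rho (c + c') x = rho c x * rho c' x.
Proof.
by rewrite /rho opprD powRD//; apply/implyP => _; rewrite gt_eqF// sqn1_gt0.
Qed.

Lemma rho1E x : rho 1 x = (1 + sqn x)^-1.
Proof. by rewrite /rho powR_inv1// ltW// sqn1_gt0. Qed.

Lemma rho_gt0 c x : 0 < rho c x.
Proof. exact: powR_gt0 (sqn1_gt0 x). Qed.

Lemma rho0 x : rho 0 x = 1.
Proof. by rewrite /rho oppr0 powRr0. Qed.

Lemma rho_nat n x : rho n%:R x = rho 1 x ^+ n.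
Proof.
elim: n => [|n IH]; first by rewrite rho0 expr0.
by rewrite -natr1 rhoD IH exprSr.
Qed.

Lemma rho_le c c' x : c' <= c -> rho c x <= rho c' x.
Proof. by move=> cc; rewrite /rho ler_powR ?lerDl ?sqn_ge0 ?lerN2. Qed.

Lemma sqn_rho1 x : sqn x = (rho 1 x)^-1 - 1.
Proof. by rewrite rho1E invrK addrC addKr. Qed.

(** The last stereographic coordinate, as an affine function of [rho 1]. *)
Definition xi x : R := 2 * rho 1 x - 1.

Lemma xiE x : xi x = (1 - enorm x ^+ 2) / (1 + enorm x ^+ 2).
Proof.
rewrite enorm_sqr /xi rho1E; have := sqn1_gt0 x; move: (sqn x) => s s0.
by field; rewrite gt_eqF.
Qed.

Definition rho_poly c p x : R := rho c x * p.[xi x].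

Lemma elem_xi : elem (xi : V -> R).
Proof. by apply: elem_sub; [apply: elem_scale; exact: elem_rho|exact: elem_cst]. Qed.

Lemma elem_rho_poly c p : elem (rho_poly c p : V -> R).
Proof. by apply: elem_mul; [exact: elem_rho|apply: elem_horner; exact: elem_xi]. Qed.

Lemma partial_rho_poly i c p x : partial i (rho_poly c p) x =
  x ord0 i * (- (2 * c) * rho_poly (c + 1) p x - 4 * rho_poly (c + 2) p^`() x).
Proof.
have Dxi := is_derive_addf (is_derive_scalef 2 (is_derive_rho i 1 x)) (is_derive_const (- 1) x (e i)).
have Dp := is_derive_comp (f := xi) Dxi (is_derive_poly p (xi x)).
apply: partialE; apply: is_derive_eqr (is_derive_mulf (is_derive_rho i c x) Dp) _.
have E2 : rho 2 x = rho 1 x * rho 1 x by rewrite (rho_nat 2) expr2.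
rewrite /rho_poly !(rhoD c) [in LHS](rhoD 1 1) E2.
by move: (rho 1 x) (rho c x) (p.[_]) (p^`().[_]) (x ord0 i) => r q a b u; ring.
Qed.

(** The condition says b = h + (N - 2)/2. For this value the first-order terms coming from the
    dimension, from Euler's identity for [H] and from the power of [rho] combine into the Jacobi
    form with equal parameters; 4 rho^2 is the conformal factor. *)
Lemma laplacian_rho_poly_mul b p h H x : harmonic_hpoly h H ->
  2 * b + 2 = N%:R + 2 * h%:R ->
  laplacian (fun y => rho_poly b p y * H y) x =
  4 * rho 1 x ^+ 2 *
   (((1 - xi x ^+ 2) * p^`()^`().[xi x] - 2 * (b + 1) * xi x * p^`().[xi x]
      - b * (b + 1) * p.[xi x]) * (rho b x * H x)).
Proof.
move=> hH bE.
pose g1 c q y : R := - (2 * c) * rho_poly (c + 1) q y - 4 * rho_poly (c + 2) q^`() y.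
have eg c q : elem (g1 c q : V -> R).
  by apply: elem_sub; apply: elem_scale; exact: elem_rho_poly.
rewrite (@laplacian_radial_mul _ _ _ (g1 b p)
   (fun y => - (2 * b) * g1 (b + 1) p y - 4 * g1 (b + 2) p^`() y) h)//.
- rewrite -bE sqn_rho1 /g1 /rho_poly.
  have r0 := rho_gt0 1 x.
  have E2 : rho (b + 2) x = rho b x * rho 1 x ^+ 2 by rewrite rhoD rho_nat.
  have -> : b + 1 + 2 = b + 3 :> R by ring.
  have -> : b + 1 + 1 = b + 2 :> R by ring.
  have -> : b + 2 + 1 = b + 3 :> R by ring.
  have -> : b + 2 + 2 = b + 4 :> R by ring.
  rewrite !(rhoD b) !rho_nat /xi.
  move: r0 (p.[_]) (p^`().[_]) (p^`()^`().[_]) (rho b x) (H x); clear.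
  by move: (rho 1 x) => r r0 p0 p1 p2 q u; field; rewrite gt_eqF.
- exact: elem_rho_poly.
- by move=> i y; rewrite partial_rho_poly.
- move=> i y; rewrite /g1.
  have e1 := elem_rho_poly (b + 1) p.
  have e2 := elem_rho_poly (b + 2) p^`().
  apply: partialE.
  apply: is_derive_eqr (is_derive_addf (is_derive_scalef _ (elem_is_derive i y e1))
     (is_derive_oppf (is_derive_scalef _ (elem_is_derive i y e2)))) _.
  by rewrite !partial_rho_poly /g1; ring.
Qed.

Definition bexp h : R := h%:R + (N%:R - 2) / 2.

Definition potential x : R := (N * (N + 2))%:R * rho 1 x ^+ 2.

(* [wfun] with the angular factor [Y] replaced by the harmonic polynomial
   [H x = r^h Y(x / r)]; unlike [wfun] it is smooth at the origin. *)
Definition whpoly n h H x : R := rho_poly (bexp h) (jac_poly (n - h) (bexp h)) x * H x.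

Lemma elem_whpoly n h H : hpoly h H -> elem (whpoly n h H).
Proof. by move=> hH; apply: elem_mul; [exact: elem_rho_poly|exact: hpoly_elem hH]. Qed.

(** With b = n + (N - 2)/2 one has b (b + 1) = n (n + N - 1) + N (N - 2)/4, the eigenvalue of the
    conformal Laplacian of the sphere S^N. *)
Lemma lambdaE n : (0 < N)%N -> (N * (N + 2))%:R * lambda N n =
  4 * (n%:R + (N%:R - 2) / 2) * (n%:R + (N%:R - 2) / 2 + 1) :> R.
Proof.
move=> N0; have Nn : (N%:R : R) != 0 by rewrite pnatr_eq0 -lt0n.
have N2 : (N%:R : R) + 2 != 0 by rewrite -natrD pnatr_eq0 addn2.
by rewrite /lambda natrM natrD; field; rewrite Nn N2.
Qed.

(** With m = n - h and b = [bexp h], the Jacobi constant m (m + 2b + 1) plus b (b + 1) equals (m +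
    b)(m + b + 1). Since m + b = n + (N - 2)/2, the eigenvalue depends on n alone and not on h. *)
Lemma laplacian_whpoly n h H x : (0 < N)%N -> (h <= n)%N -> harmonic_hpoly h H ->
  laplacian (whpoly n h H) x = - (lambda N n * (potential x * whpoly n h H x)).
Proof.
move=> N0 hn hH; rewrite (@laplacian_rho_poly_mul _ _ h)//; last first.
  by rewrite /bexp; field.
set J := jac_poly _ _; set b := bexp h.
have := jac_poly_ode (n - h) b (xi x); rewrite -/J.
move=> /(canRL (addrK _)); rewrite sub0r => ->.
rewrite /whpoly /rho_poly -/b -/J /potential.
transitivity (- ((N * (N + 2))%:R * lambda N n * (rho 1 x ^+ 2 * (rho b x * J.[xi x] * H x))));
  last by ring.
rewrite lambdaE//.
have -> : (n%:R + (N%:R - 2) / 2 : R) = (n - h)%:R + b.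
  by rewrite natrB// /b /bexp; ring.
by move: (rho 1 x) (rho b x) (J.[_]) (H x) ((n - h)%:R : R) => r q u v m; ring.
Qed.

Lemma wfunE n h Y H x : hpoly h H -> (forall y, enorm y = 1 -> Y y = H y) -> x != 0 ->
  wfun n h Y x = whpoly n h H x.
Proof.
move=> hH YH x0.
have s0 : 0 < sqn x.
  rewrite lt_def sqn_ge0 andbT; apply/eqP => s0; case/eqP: x0.
  apply/rowP => i; rewrite mxE; apply/eqP; rewrite -sqrf_eq0; apply/eqP.
  by apply: (psumr_eq0P _ s0) => // j _; exact: sqr_ge0.
have e0 : enorm x != 0 by rewrite -sqrf_eq0 enorm_sqr gt_eqF.
have eg0 : 0 <= enorm x by exact: sqrtr_ge0.
rewrite /wfun YH; last first.
  rewrite {1}/enorm; under eq_bigr do rewrite mxE exprMn.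
  rewrite -mulr_sumr -/(sqn x) -enorm_sqr -exprMn mulVf// expr1n sqrtr1//.
rewrite (hpoly_homogeneous _ _ hH) -xiE -horner_jac_poly enorm_sqr.
rewrite /whpoly /rho_poly /rho powRN -/(bexp h) exprVn.
have : enorm x ^+ h != 0 by rewrite expf_neq0.
move: (enorm x ^+ h) (_ `^ _)^-1 (_.[_]) (H x) => a b c u a0.
by rewrite -!mulrA [a * _]mulrCA; congr (_ * _); rewrite mulrCA mulVKf// .
Qed.

End bubble_functions.

(** * Borel sets of R^n *)

Section borel_rV.
Context {R : realType}.

Lemma open_measurable_rV n (O : set 'rV[R]_n) : open O -> measurable O.
Proof.
move=> oO.
pose B (q : 'rV[rat]_n) (k : nat) : set 'rV[R]_n :=
  [set x | forall i, `|ratr (q ord0 i) - x ord0 i| < k.+1%:R^-1].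
have mB q k : measurable (B q k).
  rewrite (_ : B q k = \big[setI/setT]_i
     (rV_coord i @^-1` ball (ratr (q ord0 i) : R) k.+1%:R^-1)); last first.
    rewrite -bigcap_seq; apply/seteqP; split => x /= Bx i.
      by move=> _; exact: Bx.
    by apply: (Bx i); rewrite /= mem_index_enum.
  apply: bigsetI_measurable => i _; rewrite -[X in measurable X]setTI.
  by apply: measurable_rV_coord => //; exact: measurable_ball.
have -> : O = \bigcup_(p in [set p : 'rV[rat]_n * nat | B p.1 p.2 `<=` O]) B p.1 p.2.
  apply/seteqP; split => [x Ox|x [p] /= pO Bx]; last exact: pO.
  have [e /= e0 eO] : exists2 e : R, 0 < e & ball x e `<=` O.
    by apply/nbhs_ballP; exact: open_nbhs_nbhs.
  (* Both [x] and the points of the small cube lie within 1/(k + 1) of its rational centre, hence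
     the factor 2. *)
  have [k ke] : exists k : nat, 2 * k.+1%:R^-1 < e.
    have := near_infty_natSinv_lt (PosNum (divr_gt0 e0 (ltr0n R 2))) => -[k _ /(_ k (leqnn k)) /= H].
    by exists k; rewrite mulrC -ltr_pdivlMr.
  have K0 : (0 : R) < k.+1%:R^-1 by rewrite invr_gt0.
  have Q i : exists q : rat, `|ratr q - x ord0 i| < k.+1%:R^-1.
    have /rat_in_itvoo[q] : x ord0 i < x ord0 i + k.+1%:R^-1 by rewrite ltrDl.
    rewrite in_itv/= => /andP[q1 q2]; exists q.
    by rewrite ger0_norm ?subr_ge0 ?ltW// ltrBlDl.
  exists (\row_i projT1 (cid (Q i)), k) => /=; last first.
    by move=> i; rewrite mxE; case: cid.
  move=> y Hy; apply: eO; rewrite mx_norm_ball /ball_/= => //.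
  rewrite {1}/Num.norm/= mx_normrE; apply/bigmax_ltP; split=> [//|[a i] _ /=].
  rewrite !mxE (ord1 a) /=; apply: le_lt_trans ke.
  rewrite (_ : x ord0 i - y ord0 i = (ratr (projT1 (cid (Q i))) - y ord0 i)
     - (ratr (projT1 (cid (Q i))) - x ord0 i)); last by ring.
  rewrite (le_trans (ler_normB _ _))// mulr2n mulrDl mul1r lerD//.
    by have := Hy i; rewrite mxE; exact: ltW.
  by apply: ltW; case: cid.
rewrite bigcup_mkcond.
apply: (@countable_bigcupT_measurable); first exact: countableP.
by move=> p; case: ifP.
Qed.

Lemma closed_measurable_rV n (C : set 'rV[R]_n) : closed C -> measurable C.
Proof.
move=> cC; rewrite -[C]setCK; apply: measurableC; apply: open_measurable_rV.
exact: closed_openC.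
Qed.

Lemma continuous_measurable_rV n (f : 'rV[R]_n -> R) : continuous f -> measurable_fun setT f.
Proof.
move=> /continuousP cf; apply: (measurability _ (RGenOpens.measurableE R)).
move=> _ [_ [a [b ->] <-]]; rewrite setTI; apply: open_measurable_rV.
exact/cf/interval_open.
Qed.

End borel_rV.

(** * Fubini, cubes and integrability on compact sets *)

Section lebesgue_rV_integral.
Context {R : realType}.
Local Notation mu n := (@lebesgue_rV R n).

Lemma tonelli_rV n (F : 'rV[R]_n.+1 -> \bar R) : measurable_fun setT F ->
  (forall x, 0 <= F x)%E ->
  (\int[mu n.+1]_x F x = \int[lebesgue_measure]_t \int[mu n]_y F (cons_rV (t, y)))%E.
Proof.
move=> mF F0.
transitivity (\int[pushforward (lebesgue_measure \x mu n)%E (@cons_rV R n)]_x F x)%E => //.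
rewrite ge0_integral_pushforward//; last exact: measurable_cons_rV.
rewrite preimage_setT fubini_tonelli1//.
apply: (measurableT_comp mF); exact: measurable_cons_rV.
by move=> x; exact: F0.
Qed.

Lemma integrable_cons_rV n (F : 'rV[R]_n.+1 -> \bar R) : (mu n.+1).-integrable setT F ->
  (lebesgue_measure \x mu n)%E.-integrable setT (F \o @cons_rV R n).
Proof.
move=> iF; have mF := measurable_int _ iF; apply/integrableP; split.
  apply: (measurableT_comp mF); exact: measurable_cons_rV.
case/integrableP: iF => _; rewrite -[X in integral X _ _]/(pushforward _ (@cons_rV R n)).
rewrite ge0_integral_pushforward// ?preimage_setT//; first exact: measurable_cons_rV.
exact: measurableT_comp.
Qed.

Lemma fubini1_rV n (F : 'rV[R]_n.+1 -> \bar R) : (mu n.+1).-integrable setT F ->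
  (\int[mu n.+1]_x F x = \int[lebesgue_measure]_t \int[mu n]_y F (cons_rV (t, y)))%E.
Proof.
move=> iF; have iFc := integrable_cons_rV iF; have mF := measurable_int _ iF.
transitivity (\int[pushforward (lebesgue_measure \x mu n)%E (@cons_rV R n)]_x F x)%E => //.
rewrite integral_pushforward// ?preimage_setT//; last exact: measurable_cons_rV.
by rewrite -integral12_prod_meas1.
Qed.

Lemma fubini2_rV n (F : 'rV[R]_n.+1 -> \bar R) : (mu n.+1).-integrable setT F ->
  (\int[mu n.+1]_x F x = \int[mu n]_y \int[lebesgue_measure]_t F (cons_rV (t, y)))%E.
Proof.
move=> iF; have iFc := integrable_cons_rV iF; have mF := measurable_int _ iF.
transitivity (\int[pushforward (lebesgue_measure \x mu n)%E (@cons_rV R n)]_x F x)%E => //.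
rewrite integral_pushforward// ?preimage_setT//; last exact: measurable_cons_rV.
by rewrite -integral21_prod_meas1.
Qed.

Implicit Types M : R.

(** Described coordinatewise so that slices of cubes are cubes, which suits inductions on the
    dimension. *)
Definition cube n (c : 'rV[R]_n) (M : R) : set 'rV[R]_n :=
  [set x | forall i, `|c ord0 i - x ord0 i| <= M].

Lemma cube_closed n (c : 'rV[R]_n) M : closed (cube c M).
Proof.
rewrite (_ : cube c M = \bigcap_i ((fun x : 'rV[R]_n => x ord0 i) @^-1` closed_ball_ Num.norm (c ord0 i) M)).
  apply: closed_bigI => i _; apply: closed_comp => [x _|]; first exact: coord_rV_continuous.
  exact: closed_closed_ball_.
by apply/seteqP; split => x /= Hx => [i _|i]; exact: Hx.
Qed.

Lemma cube_measurable n (c : 'rV[R]_n) M : measurable (cube c M).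
Proof. by apply: closed_measurable_rV; exact: cube_closed. Qed.

Lemma lebesgue_cube n (c : 'rV[R]_n) M : 0 <= M -> mu n (cube c M) = ((2 * M) ^+ n)%:E.
Proof.
move=> M0.
have L (a : R) : lebesgue_measure (`[a - M, a + M]%classic : set R) = (2 * M)%:E.
  rewrite lebesgue_measure_itv/= lte_fin; case: ifPn => [_|].
    by rewrite -EFinD; congr EFin; ring.
  rewrite -leNgt => H; have -> : M = 0 by apply/eqP; rewrite eq_le M0 andbT; lra.
  by rewrite mulr0.
elim: n c => [|n IH] c /=.
  by rewrite expr0 diracE mem_set// => -[].
rewrite /lebesgue_rV_step /pushforward.
have -> : @cons_rV R n @^-1` cube c M =
    `[c ord0 ord0 - M, c ord0 ord0 + M]%classic `*` cube (\row_i c ord0 (lift ord0 i)) M.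
  have E (a b : R) : (`|a - b| <= M) = (b \in `[a - M, a + M]).
    by rewrite in_itv/= ler_distl; apply/andP/andP => -[]; lra.
  apply/seteqP; split => [[a y] /= H|[a y] /= [H1 H2] i].
    split; first by have := H ord0; rewrite cons_rV0/= E.
    by move=> i; have := H (lift ord0 i); rewrite cons_rVS mxE.
  case: (unliftP ord0 i) => [j ->|->]; last by rewrite cons_rV0/= E.
  by have := H2 j; rewrite mxE cons_rVS.
rewrite product_measure1E//; last exact: cube_measurable.
transitivity ((2 * M)%:E * ((2 * M) ^+ n)%:E)%E; last by rewrite -EFinM exprS.
congr (_ * _)%E; [exact: L|exact: IH].
Qed.

Lemma lebesgue_rV_set1 n (x : 'rV[R]_n.+1) : mu n.+1 [set x] = 0%E.
Proof.
have -> : [set x] = cube x 0.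
  apply/seteqP; split => [y -> i|y H]; first by rewrite subrr normr0.
  apply/rowP => i; apply/eqP; rewrite eq_sym -subr_eq0 -normr_le0; exact: H.
by rewrite lebesgue_cube// mulr0 expr0n.
Qed.

Lemma compact_sub_cube n (K : set 'rV[R]_n) : compact K ->
  exists2 M, 0 <= M & K `<=` cube 0 M.
Proof.
move=> /compact_bounded[M [Mr HM]]; exists (Num.max (M + 1) 0); first by rewrite le_max lexx orbT.
have := HM (Num.max (M + 1) 0); rewrite lt_max ltrDl ltr01 => /(_ isT) H x Kx i.
rewrite mxE sub0r normrN; apply: le_trans (H x Kx).
by rewrite [leRHS]/Num.norm/= mx_normrE; apply/bigmax_geP; right => /=; exists (ord0, i).
Qed.

Lemma compact_lebesgue_rV n (K : set 'rV[R]_n) : compact K ->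
  measurable K /\ (mu n K < +oo)%E.
Proof.
move=> cK; have mK : measurable K.
  by apply: closed_measurable_rV; apply: compact_closed => //; exact: norm_hausdorff.
split=> //; have [M M0 KM] := compact_sub_cube cK.
apply: (@le_lt_trans _ _ (mu n (cube 0 M))).
  by apply: le_measure; rewrite ?inE//; exact: cube_measurable.
by rewrite lebesgue_cube// ltry.
Qed.

Lemma cube_compact n M : compact (cube (0 : 'rV[R]_n) M).
Proof.
apply: bounded_closed_compact; last exact: cube_closed.
exists `|M|; split; first exact: num_real.
move=> x Mx y Hy /=; rewrite [leLHS]/Num.norm/= mx_normrE; apply/bigmax_leP; split.
  by rewrite (le_trans _ (ltW Mx)).
move=> [a i] _ /=; rewrite (ord1 a) (le_trans _ (ltW Mx))// (le_trans _ (ler_norm M))//.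
by have := Hy i; rewrite mxE sub0r normrN.
Qed.

Lemma continuous_integrable_compact n (K : set 'rV[R]_n) (f : 'rV[R]_n -> R) :
  compact K -> continuous f -> (mu n).-integrable K (EFin \o f).
Proof.
move=> cK cf; have [mK Koo] := compact_lebesgue_rV cK.
apply: measurable_bounded_integrable => //.
  by apply: measurable_funTS; exact: continuous_measurable_rV.
have : compact (f @` K) by apply: continuous_compact => //; exact: continuous_subspaceT.
move=> /compact_bounded[M [Mr HM]]; exists M; split => // y My x Kx.
by apply: (HM y My); exists x.
Qed.

End lebesgue_rV_integral.

(** * Integrals of compactly supported derivatives *)

Section integration_by_parts.
Context {R : realType}.
Local Notation mu n := (@lebesgue_rV R n).
Local Notation e i := (delta_mx ord0 i).
Implicit Types (M : R).

Lemma continuous_into_rV (T : topologicalType) n (f : T -> 'rV[R]_n) :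
  (forall i, continuous (fun t => f t ord0 i)) -> continuous f.
Proof.
move=> cf t A [P /= HP PA].
have : \forall s \near t, forall i : 'I_n, P ord0 i (f s ord0 i).
  by apply: filter_forall => i; exact: (cf i t _ (HP ord0 i)).
apply: filterS => s Hs; apply: PA => i j; rewrite (ord1 i); exact: Hs.
Qed.

Lemma continuous_cons_rV_r n (t : R) : continuous (fun y : 'rV[R]_n => cons_rV (t, y)).
Proof.
apply: continuous_into_rV => i; case: (unliftP ord0 i) => [j ->|->].
  by under eq_fun do rewrite cons_rVS; exact: coord_rV_continuous.
by under eq_fun do rewrite cons_rV0; exact: cst_continuous.
Qed.

Lemma continuous_cons_rV_l n (y : 'rV[R]_n) : continuous (fun t : R => cons_rV (t, y)).
Proof.
apply: continuous_into_rV => i; case: (unliftP ord0 i) => [j ->|->].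
  by under eq_fun do rewrite cons_rVS; exact: cst_continuous.
rewrite (_ : (fun _ => _) = id) => [t //|]; by apply/funext => t; rewrite cons_rV0.
Qed.

Lemma continuous_integrable_cube n (f : 'rV[R]_n -> R) M :
  continuous f -> (forall x, ~ cube 0 M x -> f x = 0) ->
  (mu n).-integrable setT (EFin \o f).
Proof.
move=> cf f0.
have := continuous_integrable_compact (@cube_compact R n M) cf.
rewrite integrable_mkcond; last exact: cube_measurable.
apply: eq_integrable => // x _; rewrite patchE; case: ifPn => //= /negP xc.
by rewrite f0// => Hx; apply: xc; rewrite inE.
Qed.

Lemma is_derive_eq0 n (F dF : 'rV[R]_n -> R) (l : 'I_n) M x :
  (forall x, is_derive x (e l) F (dF x)) -> (forall x, ~ cube 0 M x -> F x = 0) ->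
  ~ cube 0 M x -> dF x = 0.
Proof.
move=> DF F0 xc.
have H : is_derive x (e l) F 0.
  apply: (@near_eq_is_derive _ _ _ (cst 0)).
  have oc : open (~` cube (0 : 'rV[R]_n) M) by apply: closed_openC; exact: cube_closed.
  by apply: filterS (open_nbhs_nbhs (conj oc xc)) => y yc; rewrite F0.
by have [_ <-] := H; have [_ <-] := DF x.
Qed.

Lemma integral_derive1_0 (G g : R -> R) M : 0 <= M -> continuous g ->
  (forall t : R, is_derive t 1 G (g t)) -> (forall t, M < `|t| -> G t = 0) ->
  (\int[lebesgue_measure]_t (g t)%:E = 0)%E.
Proof.
move=> M0 cg DG G0.
have cG : continuous (G : R -> R) by move=> t; exact: is_derive_continuous (DG t).
have g0 t : M < `|t| -> g t = 0.
  move=> Mt; have H : is_derive t 1 G 0.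
    apply: (@near_eq_is_derive _ _ _ (cst 0)).
    have nMt : \forall s \near t, M < `|s| by apply: (cvgr_gt _ (@norm_continuous _ _ t)).
    by near=> s; rewrite G0//; near: s; exact: nMt.
  by have [_ <-] := H; have [_ <-] := DG t.
(* [G] vanishes only strictly beyond [M], so the endpoints are moved out to M + 1 before the
   fundamental theorem is applied. *)
have ab : - (M + 1) < M + 1 by lra.
have := @continuous_FTC2 _ g G _ _ ab.
have N1 : M < `|M + 1| by rewrite ger0_norm; lra.
rewrite (G0 _ N1) G0 ?normrN// subee// => <-; first last.
- by move=> t _; rewrite derive1E; have [] := DG t.
- split => [t _||]; first by have [] := DG t.
    by apply: cvg_at_right_filter; exact: cG.
  by apply: cvg_at_left_filter; exact: cG.
- by apply: continuous_subspaceT.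
rewrite [RHS]integral_mkcond; apply: eq_integral => t _.
rewrite patchE; case: ifPn => // /negP tM; rewrite g0//.
rewrite ltNge; apply/negP => Mt; apply: tM; rewrite inE/= in_itv/=.
by move: Mt; rewrite ler_norml => /andP[]; lra.
Unshelve. all: end_near. Qed.

Lemma rV_lineE n (s : R) (l i : 'I_n) (x : 'rV[R]_n) :
  (s *: e l + x) ord0 i = s * (i == l)%:R + x ord0 i.
Proof. by rewrite !mxE eqxx. Qed.

(** Induction on the dimension with two orders of Fubini. If [l] is not the first coordinate,
    freezing the first one leaves a lower-dimensional instance; if it is, the first coordinate is
    integrated first and the one-variable case applies. *)
Lemma integral_partial_eq0 n (F dF : 'rV[R]_n -> R) (l : 'I_n) M : 0 <= M ->
  continuous dF -> (forall x, is_derive x (e l) F (dF x)) ->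
  (forall x, ~ cube 0 M x -> F x = 0) ->
  (\int[mu n]_x (dF x)%:E = 0)%E.
Proof.
move=> M0; elim: n F dF l => [|n IH] F dF l cdF DF F0; first by have := ltn_ord l.
have iF : (mu n.+1).-integrable setT (EFin \o dF).
  apply: (continuous_integrable_cube cdF) => x; exact: is_derive_eq0 DF F0.
case: (unliftP ord0 l) => [j lj|l0].
- rewrite (fubini1_rV iF) /= -[RHS](integral0 lebesgue_measure setT).
  apply: eq_integral => t _; apply: (IH (fun y => F (cons_rV (t, y))) _ j).
  + by move=> y; apply: continuous_comp; [exact: continuous_cons_rV_r|exact: cdF].
  + move=> y; apply/is_derive_line; have /is_derive_line := DF (cons_rV (t, y)).
    rewrite (_ : (fun s : R => F (s *: e l + cons_rV (t, y))) =
                 (fun s : R => F (cons_rV (t, s *: e j + y))))//.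
    apply/funext => s; congr F; apply/rowP => i; rewrite rV_lineE.
    rewrite lj; case: (unliftP ord0 i) => [i' ->|->].
      by rewrite !cons_rVS rV_lineE (inj_eq (@lift_inj _ ord0)).
    by rewrite !cons_rV0 (negPf (neq_lift _ _)) mulr0 add0r.
  + move=> y yc; apply: F0 => Hc; apply: yc => i.
    by have := Hc (lift ord0 i); rewrite cons_rVS !mxE.
- rewrite (fubini2_rV iF) /= -[RHS](integral0 (mu n) setT).
  apply: eq_integral => y _; apply: (integral_derive1_0 (G := fun t => F (cons_rV (t, y))) M0).
  + by move=> t; apply: continuous_comp; [exact: continuous_cons_rV_l|exact: cdF].
  + move=> t; apply/is_derive_line; have /is_derive_line := DF (cons_rV (t, y)).
    rewrite (_ : (fun s : R => F (s *: e l + cons_rV (t, y))) =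
                 (fun s : R => F (cons_rV (s *: 1 + t, y))))//.
    apply/funext => s; congr F; apply/rowP => i; rewrite rV_lineE.
    rewrite l0; case: (unliftP ord0 i) => [i' ->|->].
      by rewrite !cons_rVS eq_sym (negPf (neq_lift _ _)) mulr0 add0r.
    by rewrite !cons_rV0 eqxx.
  + move=> t Mt; apply: F0 => /(_ ord0); rewrite mxE cons_rV0/= sub0r normrN.
    by rewrite leNgt Mt.
Qed.

End integration_by_parts.

(** * Integrability of powers of 1 + |x|^2 *)

Section rho_integrable.
Context {R : realType}.
Local Notation mu n := (@lebesgue_rV R n).
Implicit Types (q s : R).

Lemma integral_prod_rV_lty n (g : R -> R) : measurable_fun setT g -> (forall t, 0 <= g t) ->
  (\int[lebesgue_measure]_t (g t)%:E < +oo)%E ->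
  (\int[mu n]_x (\prod_i g (x ord0 i))%:E < +oo)%E.
Proof.
move=> mg g0 goo; elim: n => [|n IH].
  under eq_integral do rewrite big_ord0.
  by rewrite /= integral_dirac// diracT mul1e ltry.
have mprod m : measurable_fun setT (fun x : 'rV[R]_m => \prod_i g (x ord0 i)).
  apply: measurable_prod => i _.
  by apply: (measurableT_comp mg); exact: measurable_rV_coord.
rewrite tonelli_rV; last 2 first.
- apply/measurable_EFinP; exact: mprod.
- by move=> x; rewrite lee_fin prodr_ge0.
set I := (\int[mu n]_x _)%E in IH.
have I0 : (0 <= I)%E by apply: integral_ge0 => y _; rewrite lee_fin prodr_ge0.
have inner t : (\int[mu n]_y (\prod_i g (cons_rV (t, y) ord0 i))%:E = (g t)%:E * I)%E.
  rewrite /I -ge0_integralZl//.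
  - apply: eq_integral => y _; rewrite big_ord_recl cons_rV0/= EFinM.
    by under eq_bigr do rewrite cons_rVS.
  - by apply/measurable_EFinP; exact: mprod.
  - by move=> y _; rewrite lee_fin prodr_ge0.
  - by rewrite lee_fin.
under eq_integral do rewrite inner.
rewrite ge0_integralZr//; last 2 first.
- exact/measurable_EFinP.
- by move=> t _; rewrite lee_fin.
rewrite muleC; apply: lte_mul_pinfty => //.
by rewrite ge0_fin_numE.
Qed.

(** By parity it suffices to integrate over t >= 0. There (1 + t)^2 <= 2 (1 + t^2) gives the
    majorant 2^q (1 + t)^(-2q), whose antiderivative is explicit and tends to 0 since 2q > 1. *)
Lemma integral_one_plus_sqr_lty q : 2^-1 < q ->
  (\int[lebesgue_measure]_t (((1 + t ^+ 2) `^ (- q))%:E) < +oo :> \bar R)%E.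
Proof.
move=> q2.
have p0 (t : R) : 0 < 1 + t ^+ 2 by rewrite ltr_pwDl// sqr_ge0.
have cg : continuous (fun t : R => (1 + t ^+ 2) `^ (- q)).
  move=> t; apply: (@continuous_comp _ _ _ (fun y : R => 1 + y ^+ 2) (fun u => u `^ (- q))).
    by apply: continuousD; [exact: cst_continuous|exact: exprn_continuous].
  by apply: is_derive_continuous; exact: (is_derive1_powR _ (p0 t)).
have mg := continuous_measurable_fun cg.
rewrite ge0_symfun_integralT//; last 2 first.
- by move=> t; exact: powR_ge0.
- by move=> t /=; rewrite sqrrN.
rewrite lte_mul_pinfty//.
rewrite -set_itvcy.
pose f (t : R) : R := 2 `^ q * (1 + t) `^ (- (2 * q)).
pose a : R := 1 - 2 * q.
have a0 : a < 0 by rewrite /a; lra.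
pose F (t : R) : R := 2 `^ q / a * (1 + t) `^ a.
have DF (t : R) : 0 <= t -> is_derive t 1 F (f t).
  move=> t0; have t1 : 0 < 1 + t by lra.
  have H1 := is_derive_addf (is_derive_const 1 t (1 : R)) (is_derive_id t (1 : R)).
  have H2 := is_derive_comp (f := fun t : R => 1 + t) H1 (is_derive1_powR a t1).
  apply: is_derive_eqr (is_derive_scalef _ H2) _.
  rewrite /f (_ : - (2 * q) = a - 1); last by rewrite /a; ring.
  by move: (_ `^ (a - 1)) (2 `^ q) => u v; field; rewrite lt_eqF.
have cf (t : R) : 0 <= t -> {for t, continuous f}.
  move=> t0; apply: (@is_derive_continuous _ f t).
  have t1 : 0 < 1 + t by lra.
  have H1 := is_derive_addf (is_derive_const 1 t (1 : R)) (is_derive_id t (1 : R)).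
  have H2 := is_derive_comp (f := fun t : R => 1 + t) H1 (is_derive1_powR (- (2 * q)) t1).
  exact: (is_derive_scalef (2 `^ q) H2).
have mf : measurable_fun setT f.
  apply: measurable_funM => //.
  by apply: (measurableT_comp (measurable_powR _)); exact: measurable_funD.
apply: (@le_lt_trans _ _ (\int[lebesgue_measure]_(t in `[0%R, +oo[) (f t)%:E)%E).
  apply: ge0_le_integral => //.
  - by move=> t _; rewrite lee_fin powR_ge0.
  - by apply/measurable_EFinP; exact: measurable_funTS mg.
  - by apply/measurable_EFinP; exact: measurable_funTS mf.
  - move=> t; rewrite /= in_itv/= andbT => t0; rewrite lee_fin /f.
    have t1 : 0 < 1 + t by lra.
    have -> : (1 + t) `^ (- (2 * q)) = ((1 + t) ^+ 2) `^ (- q).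
      by rewrite -powR_mulrn ?(ltW t1)// -powRrM; congr (_ `^ _); ring.
    rewrite !powRN -ler_pdivrMl ?powR_gt0// -invfM.
    rewrite lef_pV2 ?posrE ?mulr_gt0 ?powR_gt0 ?exprn_gt0//.
    rewrite -powRM ?(ltW (p0 _))//; apply: ge0_ler_powR.
    + by apply: ltW; apply: lt_trans q2; lra.
    + by rewrite nnegrE sqr_ge0.
    + by rewrite nnegrE mulr_ge0// ltW// p0.
    by have := sqr_ge0 (1 - t); nra.
suff -> : (\int[lebesgue_measure]_(t in `[0%R, +oo[) (f t)%:E = 0%:E - (F 0)%:E)%E.
  by rewrite -EFinB ltry.
apply: (@ge0_continuous_FTC2y _ f F 0 0).
- by move=> t _; rewrite mulr_ge0 ?powR_ge0.
- apply/continuous_within_itvcyP; split => [t t0|]; first by apply: cf; apply: ltW; move: t0; rewrite in_itv/= andbT.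
  by apply: cvg_at_right_filter; exact: (cf 0 (lexx _)).
- rewrite -[X in _ --> X](mulr0 (2 `^ q / a)); apply: cvgM; first exact: cvg_cst.
  apply/cvgrPdist_le => eps eps0; near=> t.
  have na : 0 < - a by rewrite oppr_gt0.
  have t1 : eps^-1 `^ (- a)^-1 <= 1 + t.
    by near: t; apply: filterS (nbhs_pinfty_ge (num_real (eps^-1 `^ (- a)^-1))) => t H; rewrite (le_trans H)// lerDr.
  rewrite sub0r normrN ger0_norm ?powR_ge0// -[a]opprK powRN.
  have e1 : 0 < eps^-1 by rewrite invr_gt0.
  rewrite -[leRHS]invrK lef_pV2 ?posrE//; last first.
    by rewrite powR_gt0// (lt_le_trans _ t1)// powR_gt0.
  have -> : eps^-1 = (eps^-1 `^ (- a)^-1) `^ (- a).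
    by rewrite -powRrM mulVf ?gt_eqF// powRr1// ltW.
  have w0 : 0 <= eps^-1 `^ (- a)^-1 by exact: powR_ge0.
  have w1 : 0 <= 1 + t by apply: le_trans t1.
  by apply: ge0_ler_powR; rewrite ?nnegrE// ltW.
- by move=> t t0; have [] := DF t (ltW t0).
- by apply: cvg_at_right_filter; exact: (is_derive_continuous (DF 0 (lexx _))).
- by move=> t; rewrite in_itv/= andbT => t0; rewrite derive1E; have [] := DF t (ltW t0).
Unshelve. all: end_near. Qed.

Lemma prod_sqr_le n (x : 'rV[R]_n) : \prod_i (1 + x ord0 i ^+ 2) <= (1 + sqn x) ^+ n.
Proof.
have -> : (1 + sqn x) ^+ n = \prod_(i < n) (1 + sqn x) by rewrite prodr_const card_ord.
apply: ler_prod => i _.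
rewrite addr_ge0 ?sqr_ge0//= lerD2l /sqn (bigD1 i)//= lerDl.
by apply: sumr_ge0 => j _; exact: sqr_ge0.
Qed.

(** Polar coordinates are avoided: the product of the factors 1 + x_i^2 is at most (1 + |x|^2)^n, so
    the integrand is bounded by a product of one-variable functions with exponent q = s/n > 1/2. *)
Lemma rho_integrable n s : (0 < n)%N -> n%:R / 2 < s ->
  (mu n).-integrable setT (EFin \o rho s).
Proof.
move=> n0 ns; have n0' : (0 : R) < n%:R by rewrite ltr0n.
pose q := s / n%:R.
have q2 : 2^-1 < q by rewrite /q ltr_pdivlMr// mulrC.
have q0 : 0 <= q by apply: ltW; apply: lt_trans q2; lra.
have sq1 (t : R) : 0 < 1 + t ^+ 2 by rewrite ltr_pwDl// sqr_ge0.
have mrho : measurable_fun setT (rho s : 'rV[R]_n -> R).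
  by apply: continuous_measurable_rV; apply: elem_continuous; exact: elem_rho.
have mg : measurable_fun setT (fun t : R => (1 + t ^+ 2) `^ (- q)).
  apply: (measurableT_comp (measurable_powR _)); apply: measurable_funD => //.
apply/integrableP; split; first exact/measurable_EFinP.
have g0 (t : R) : 0 <= (1 + t ^+ 2) `^ (- q) by exact: powR_ge0.
apply: le_lt_trans (integral_prod_rV_lty n mg g0 (integral_one_plus_sqr_lty q2)).
apply: ge0_le_integral => //.
- by apply: measurableT_comp => //; exact/measurable_EFinP.
- apply/measurable_EFinP; apply: measurable_prod => i _.
  by apply: (measurableT_comp mg); exact: measurable_rV_coord.
- move=> x _; rewrite /= lee_fin ger0_norm ?(ltW (rho_gt0 _ _))//.
  have E : \prod_i (1 + x ord0 i ^+ 2) `^ (- q) = (\prod_i (1 + x ord0 i ^+ 2)) `^ (- q).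
    suff [] : 0 <= \prod_i (1 + x ord0 i ^+ 2) /\
       \prod_i (1 + x ord0 i ^+ 2) `^ (- q) = (\prod_i (1 + x ord0 i ^+ 2)) `^ (- q) by [].
    elim/big_rec2: _ => [|i a b _ [b0 ->]]; first by rewrite powR1.
    by rewrite mulr_ge0 ?powRM// ltW.
  rewrite E /rho !powRN lef_pV2 ?posrE ?powR_gt0 ?sqn1_gt0 ?prodr_gt0//.
  have -> : s = n%:R * q by rewrite /q mulrC divfK// gt_eqF.
  rewrite powRrM powR_mulrn ?(ltW (sqn1_gt0 x))//.
  apply: ge0_ler_powR => //; last exact: prod_sqr_le.
    by rewrite nnegrE prodr_ge0// => i _; exact/ltW/sq1.
  by rewrite nnegrE exprn_ge0// ltW// sqn1_gt0.
Qed.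

End rho_integrable.

(** * Polynomials converging to a step function on [0, 1] *)

Section step_polynomial.
Context {R : realType}.
Implicit Types (s : R) (n : nat).

(** The exponent n 2^n places the jump at s = 1/2, because n 2^n s^n = n (2s)^n tends to 0 below 1/2
    and to infinity from 1/2 on. The extra factor n puts the threshold itself on the side of the
    limit 1. *)
Definition step_poly n s : R := 1 - (1 - s ^+ n) ^+ (n * 2 ^ n).

Lemma bernoulli_ge (u : R) K : 0 <= u <= 1 -> 1 - K%:R * u <= (1 - u) ^+ K.
Proof.
move=> /andP[u0 u1]; elim: K => [|K IH]; first by rewrite mul0r subr0 expr0.
have v0 : 0 <= 1 - u by lra.
have K0 : (0 : R) <= K%:R by [].
rewrite exprS; have := ler_wpM2l v0 IH; rewrite -natr1; nra.
Qed.

(** The induction rests on (1 - u)(1 + (K + 1) u) <= 1 + K u. *)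
Lemma bernoulli_le (u : R) K : 0 <= u <= 1 -> (1 - u) ^+ K * (1 + K%:R * u) <= 1.
Proof.
move=> /andP[u0 u1]; elim: K => [|K IH]; first by rewrite expr0; lra.
have v0 : 0 <= 1 - u by lra.
have p0 : 0 <= (1 - u) ^+ K by rewrite exprn_ge0.
have K0 : (0 : R) <= K%:R by [].
apply: le_trans IH; rewrite exprSr -mulrA ler_wpM2l// -natr1; nra.
Qed.

Lemma step_poly_itv n s : 0 <= s <= 1 -> 0 <= step_poly n s <= 1.
Proof.
move=> /andP[s0 s1]; have a0 : 0 <= s ^+ n by rewrite exprn_ge0.
have a1 : s ^+ n <= 1 by rewrite exprn_ile1.
have b0 : 0 <= (1 - s ^+ n) ^+ (n * 2 ^ n) by rewrite exprn_ge0// subr_ge0.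
have b1 : (1 - s ^+ n) ^+ (n * 2 ^ n) <= 1 by rewrite exprn_ile1// ?subr_ge0// lerBlDr lerDl.
by rewrite /step_poly; lra.
Qed.

Lemma cvg_natmul_expr (t : R) : 0 <= t < 1 -> (fun n => n%:R * t ^+ n) @ \oo --> (0 : R).
Proof.
move=> /andP[t0 t1]; pose r := Num.sqrt t.
have r0 : 0 <= r by exact: sqrtr_ge0.
have r1 : r < 1 by rewrite -sqrtr1 ltr_sqrt.
(* One factor r^n absorbs n, since n r^n stays bounded, and the other tends to 0. *)
have tr : t = r * r by rewrite -expr2 sqr_sqrtr.
have bd n : n%:R * r ^+ n <= (1 - r)^-1.
  rewrite -[leRHS]mul1r ler_pdivlMr ?subr_gt0//.
  (* This sharper form passes through the induction: it says that n r^n is at most the geometric sum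
     of the first n powers of r. *)
  have : n%:R * r ^+ n * (1 - r) <= 1 - r ^+ n.
    elim: n => [|n IH]; first by rewrite mul0r mul0r expr0 subrr.
    have p0 : 0 <= r ^+ n by rewrite exprn_ge0.
    have n0 : (0 : R) <= n%:R by [].
    rewrite exprS -natr1.
    have p1 : r * r ^+ n <= 1 by rewrite -exprS exprn_ile1// ltW.
    have r1' : 0 <= 1 - r by rewrite subr_ge0 ltW.
    have := ler_wpM2l r0 IH; have := ler_wpM2r r1' p1.
    by move: (r ^+ n) (n%:R : R) => u m; lra.
  by move=> /le_trans; apply; rewrite lerBlDr lerDl exprn_ge0.
apply/cvgrPdist_le => eps eps0.
have e' : 0 < eps * (1 - r) by rewrite mulr_gt0// subr_gt0.
have := @cvg_expr R r; rewrite ger0_norm// => /(_ r1) /cvgrPdist_le /(_ _ e').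
apply: filterS => n; rewrite !sub0r !normrN ger0_norm ?exprn_ge0// => H.
rewrite ger0_norm ?mulr_ge0 ?exprn_ge0// tr exprMn mulrA.
apply: (@le_trans _ _ ((1 - r)^-1 * (eps * (1 - r)))).
  by apply: ler_pM => //; rewrite ?mulr_ge0 ?exprn_ge0.
by rewrite mulrCA mulVf ?mulr1// gt_eqF// subr_gt0.
Qed.

Lemma cvg_step_poly s : 0 <= s <= 1 ->
  (fun n => step_poly n s) @ \oo --> ((2^-1 <= s)%R%:R : R).
Proof.
move=> s01; have /andP[s0 s1] := s01.
have un n : 0 <= s ^+ n <= 1 by rewrite exprn_ge0// exprn_ile1.
have Kn n : (n * 2 ^ n)%:R * s ^+ n = n%:R * (2 * s) ^+ n.
  by rewrite natrM natrX exprMn mulrA.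
have [s2|s2] := leP.
- have t1 : 1 <= 2 * s by lra.
  apply/cvgrPdist_le => eps eps0.
  have := @near_infty_natSinv_lt R (PosNum eps0).
  apply: filterS => n /= /ltW; apply: le_trans.
  rewrite /step_poly opprB addrCA subrr addr0.
  rewrite ger0_norm; last by rewrite exprn_ge0// subr_ge0; case/andP: (un n).
  rewrite -[leRHS]mul1r ler_pdivlMr//.
  apply: le_trans (bernoulli_le (n * 2 ^ n) (un n)).
  apply: ler_wpM2l; first by rewrite exprn_ge0// subr_ge0; case/andP: (un n).
  by rewrite Kn -natr1 addrC lerD2l ler_peMr// exprn_ege1.
- apply: (@squeeze_cvgr _ _ _ _ (fun=> 0) (fun n => n%:R * (2 * s) ^+ n)).
  + apply: nearW => n; have /andP[-> _] /= := step_poly_itv n s01.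
    have := bernoulli_ge (n * 2 ^ n) (un n); rewrite Kn /step_poly; lra.
  + exact: cvg_cst.
  + by apply: cvg_natmul_expr; lra.
Qed.

End step_polynomial.

(** * Density of polynomials in the stereographic coordinates *)

Section density.
Context {R : realType} {N : nat}.
Local Notation V := 'rV[R]_N.
Local Notation mu := (@lebesgue_rV R N).
Implicit Types (f g : V -> R) (x a : V).

(* The inverse stereographic projection is [x |-> (2 rho 1 x *: x, 2 rho 1 x - 1)]. *)
Inductive sphere_poly : (V -> R) -> Prop :=
| sphere_poly_cst c : sphere_poly (fun=> c)
| sphere_poly_rho : sphere_poly (rho 1)
| sphere_poly_coord i : sphere_poly (fun x => rho 1 x * x ord0 i)
| sphere_poly_add f g : sphere_poly f -> sphere_poly g -> sphere_poly (fun x => f x + g x)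
| sphere_poly_mul f g : sphere_poly f -> sphere_poly g -> sphere_poly (fun x => f x * g x).

Lemma sphere_poly_opp f : sphere_poly f -> sphere_poly (fun x => - f x).
Proof.
move=> hf; under eq_fun do rewrite -mulN1r.
by apply: sphere_poly_mul => //; exact: sphere_poly_cst.
Qed.

Lemma sphere_poly_exp f n : sphere_poly f -> sphere_poly (fun x => f x ^+ n).
Proof.
move=> hf; elim: n => [|n IH].
  by under eq_fun do rewrite expr0; exact: sphere_poly_cst.
by under eq_fun do rewrite exprS; exact: sphere_poly_mul.
Qed.

Lemma sphere_poly_prod (I : Type) (r : seq I) (F : I -> V -> R) :
  (forall i, sphere_poly (F i)) -> sphere_poly (fun x => \prod_(i <- r) F i x).
Proof.
move=> HF; elim: r => [|i r IH].
  by under eq_fun do rewrite big_nil; exact: sphere_poly_cst.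
by under eq_fun do rewrite big_cons; exact: sphere_poly_mul.
Qed.

Lemma sphere_poly_elem f : sphere_poly f -> elem f.
Proof.
elim=> {f} [c||i|f g _ ef _ eg|f g _ ef _ eg].
- exact: elem_cst.
- exact: elem_rho.
- by apply: elem_mul; [exact: elem_rho|exact: elem_coord].
- exact: elem_add.
- exact: elem_mul.
Qed.

(** The sign of x_i - t is that of [rho 1] times x_i - t, a sphere polynomial bounded by 1 + |t|.
    The affine change maps it into [0, 1] with the threshold at 1/2, the input that [step_poly]
    expects. *)
Definition half_level (t : R) i x : R := (1 + (rho 1 x * x ord0 i - t * rho 1 x) / (1 + `|t|)) / 2.

Lemma sphere_poly_half_level t i : sphere_poly (half_level t i).
Proof.
apply: sphere_poly_mul; last exact: sphere_poly_cst.
apply: sphere_poly_add; first exact: sphere_poly_cst.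
apply: sphere_poly_mul; last exact: sphere_poly_cst.
apply: sphere_poly_add; first exact: sphere_poly_coord.
apply: sphere_poly_opp; apply: sphere_poly_mul; last exact: sphere_poly_rho.
exact: sphere_poly_cst.
Qed.

Lemma coord_sqr_le_sqn i x : x ord0 i ^+ 2 <= sqn x.
Proof.
by rewrite /sqn (bigD1 i)//= lerDl; apply: sumr_ge0 => j _; exact: sqr_ge0.
Qed.

Lemma rho1_le1 x : rho 1 x <= 1.
Proof. by have := @rho_le R N 1 0 x ler01; rewrite rho0. Qed.

Lemma half_level_itv t i x : 0 <= half_level t i x <= 1.
Proof.
have r0 := rho_gt0 1 x; have r1 := rho1_le1 x.
have c1 : `|rho 1 x * x ord0 i| <= 1.
  rewrite normrM (ger0_norm (ltW r0)) rho1E [_ * `|_|]mulrC ler_pdivrMr ?sqn1_gt0// mul1r.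
  have := coord_sqr_le_sqn i x; rewrite -real_normK ?num_real//.
  by have := sqr_ge0 (`|x ord0 i| - 1); nra.
have c2 : `|t * rho 1 x| <= `|t|.
  by rewrite normrM (ger0_norm (ltW r0)) ler_piMr.
have : `|(rho 1 x * x ord0 i - t * rho 1 x) / (1 + `|t|)| <= 1.
  have t0 : 0 < 1 + `|t| by rewrite ltr_pwDl.
  rewrite normrM normfV (ger0_norm (ltW t0)) ler_pdivrMr// mul1r.
  by rewrite (le_trans (ler_normB _ _))// lerD.
rewrite ler_norml /half_level => /andP[]; lra.
Qed.

Lemma half_level_ge t i x : (2^-1 <= half_level t i x) = (t <= x ord0 i).
Proof.
have r0 := rho_gt0 1 x.
have t0 : 0 < 1 + `|t| by rewrite ltr_pwDl.
rewrite /half_level -[leLHS]mul1r ler_pM2r ?invr_gt0// lerDl pmulr_lge0 ?invr_gt0//.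
by rewrite subr_ge0 mulrC ler_pM2l.
Qed.

Definition orthant a : set V := [set x | forall i, a ord0 i <= x ord0 i].

Lemma measurable_orthant a : measurable (orthant a).
Proof.
apply: closed_measurable_rV.
rewrite (_ : orthant a = \bigcap_i ((fun x : V => x ord0 i) @^-1` [set t | a ord0 i <= t])).
  apply: closed_bigI => i _; apply: closed_comp => [x _|]; first exact: coord_rV_continuous.
  exact: closed_ge.
by apply/seteqP; split => x /= Hx => [i _|i]; exact: Hx.
Qed.

(** Orthants are also stable under intersection, so the vanishing of an integral over orthants
    propagates to all measurable sets by the Dynkin argument. *)
Lemma measurable_rV_orthant :
  @measurable _ V = <<s [set orthant a | a in [set: V]] >>.
Proof.
apply/seteqP; split; last first.
  apply: smallest_sub; first exact: sigma_algebra_measurable.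
  by move=> _ [a _ <-]; exact: measurable_orthant.
apply: smallest_sub; first exact: smallest_sigma_algebra.
move=> A; rewrite -bigcup_seq/= => -[i _].
pose T := g_sigma_algebraType [set orthant a | a in [set: V]].
have mi : measurable_fun setT (rV_coord i : T -> measurableTypeR R).
  apply: (measurability _ (RGenCInfty.measurableE R)).
  move=> _ [_ [t ->] <-]; rewrite setTI.
  (* A half-space is a union of orthants whose other corner coordinates go to minus infinity; the
     sum of the |x_j| bounds how far one must go for a given [x]. *)
  have -> : (rV_coord i : V -> R) @^-1` `[t, +oo[%classic =
      \bigcup_k orthant (\row_j if j == i then t else - k%:R).
    apply/seteqP; split => [x|x [k _ Hx]]; rewrite /rV_coord/= in_itv/= andbT; last first.
      by have := Hx i; rewrite mxE eqxx.
    move=> tx; exists (Num.truncn (\sum_j `|x ord0 j|)).+1 => //= j.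
    rewrite mxE; case: eqP => [->//|_]; rewrite lerNl.
    rewrite (le_trans (ler_norm _))// normrN ltW//.
    apply: le_lt_trans (truncnS_gt _); rewrite (bigD1 j)//= lerDl.
    by apply: sumr_ge0.
  by apply: bigcup_measurable => k _; apply: sub_sigma_algebra; eexists.
by move=> [B mB <-]; exact: mi.
Qed.

(* A finite signed density orthogonal to [sphere_poly] vanishes: the indicator of
   an orthant is a bounded pointwise limit of sphere polynomials. *)
Lemma sphere_poly_dense g : mu.-integrable setT (EFin \o g) ->
  (forall f, sphere_poly f -> (\int[mu]_x (g x * f x)%:E = 0)%E) ->
  \forall x \ae mu, g x = 0.
Proof.
move=> ig H; have mg : measurable_fun setT g by apply/measurable_EFinP; exact: measurable_int ig.
have HQ a : (\int[mu]_(x in orthant a) (g x)%:E = 0)%E.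
  pose F n x : R := \prod_i step_poly n (half_level (a ord0 i) i x).
  have sF n : sphere_poly (F n).
    apply: sphere_poly_prod => i; apply: sphere_poly_add; first exact: sphere_poly_cst.
    apply: sphere_poly_opp; apply: sphere_poly_exp; apply: sphere_poly_add; first exact: sphere_poly_cst.
    by apply: sphere_poly_opp; apply: sphere_poly_exp; exact: sphere_poly_half_level.
  have F01 n x : 0 <= F n x <= 1.
    have := fun i => step_poly_itv n (half_level_itv (a ord0 i) i x) => Hi.
    apply/andP; split; first by apply: prodr_ge0 => i _; case/andP: (Hi i).
    by apply: prodr_ile1 => i _; exact: Hi.
  have cF x : F n x @[n --> \oo] --> (\1_(orthant a) x : R).
    have -> : \1_(orthant a) x = \prod_i (2^-1 <= half_level (a ord0 i) i x)%R%:R :> R.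
      rewrite indicE; have [Hx|Hx] := boolP (x \in orthant a).
        by rewrite big1// => i _; rewrite half_level_ge; move: Hx; rewrite inE => ->.
      move: Hx; rewrite notin_setE /orthant/= -existsNE => -[i Hi].
      by rewrite (bigD1 i)//= half_level_ge (negPf (introN idP Hi)) mul0r.
    rewrite /F; elim: (index_enum _) => [|i r IH].
      by under eq_fun do rewrite big_nil; rewrite big_nil; exact: cvg_cst.
    under eq_fun do rewrite big_cons; rewrite big_cons; apply: cvgM => //.
    by apply: cvg_step_poly; exact: half_level_itv.
  have [|||||_ _ C] := @dominated_convergence _ _ R mu setT measurableT
    (fun n x => (g x * F n x)%:E) (fun x => (g x * \1_(orthant a) x)%:E)
    (fun x => `|(g x)%:E|%E).
  - move=> n; apply/measurable_EFinP; apply: measurable_funM => //.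
    by apply: continuous_measurable_rV; apply: elem_continuous; exact: sphere_poly_elem.
  - apply/measurable_EFinP; apply: measurable_funM => //.
    by apply: measurable_indic; exact: measurable_orthant.
  - by apply: aeW => x _; apply: cvg_EFin; [exact: nearW|apply: cvgMr; exact: cF].
  - exact: integrable_abse.
  - apply: aeW => x n _; rewrite lee_fin normrM ler_piMr//.
    by have /andP[F0 F1] := F01 n x; rewrite ger0_norm.
  rewrite integral_mkcond.
  transitivity (\int[mu]_x (g x * \1_(orthant a) x)%:E)%E.
    apply: eq_integral => x _; rewrite patchE indicE.
    by case: ifPn => _; rewrite ?mulr1 ?mulr0.
  rewrite -(cvg_lim (@ereal_hausdorff R) C).
  rewrite (_ : (fun n => _) = (fun=> 0%E)); first exact: lim_cst.
  by apply/funext => n; exact: H.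
have HB B : measurable B -> (\int[mu]_(x in B) (g x)%:E = 0)%E.
  move=> mB.
  (* Orthogonality to the constant 1 gives the vanishing total integral, on which the complement
     step of the Dynkin argument relies. *)
  have HT : (\int[mu]_x (g x)%:E = 0)%E.
    rewrite -[RHS](H _ (sphere_poly_cst 1)); apply: eq_integral => x _.
    by rewrite mulr1.
  apply: (dynkin_induction (P := fun B => (\int[mu]_(x in B) (g x)%:E = 0)%E)
    measurable_rV_orthant) => //.
  - move=> _ _ [a _ <-] [b _ <-]; exists (\row_i Num.max (a ord0 i) (b ord0 i)) => //.
    apply/seteqP; split => [x Hx|x [Ha Hb] i]; last by rewrite mxE ge_max Ha Hb.
    by split=> i; have := Hx i; rewrite mxE ge_max => /andP[].
  - by move=> _ [a _ <-]; exact: HQ.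
  - move=> S mS S0; move: HT; rewrite -(setUv S) integral_setU//.
    + by rewrite S0 add0e.
    + exact: measurableC.
    + by rewrite setUv; exact/measurable_EFinP.
    + by rewrite disj_set2E setICr.
  - move=> F mF tF F0; rewrite integral_bigcup//; first by rewrite eseries0.
    apply: integrableS ig => //; exact: bigcup_measurable.
  - by rewrite -measurable_rV_orthant.
have Hae : ae_eq mu setT (EFin \o g) (cst 0%E).
  apply: integral_ae_eq => // E _ mE.
  by rewrite integral_cst// mul0e HB.
by apply: filterS Hae => x /(_ Logic.I)[].
Qed.

End density.

(** * Decay rates and integrability *)

Section decay.
Context {R : realType} {N : nat}.
Local Notation V := 'rV[R]_N.
Local Notation mu := (@lebesgue_rV R N).
Implicit Types (f g : V -> R) (x : V) (c : R).

(** Exponents count powers of 1 + |x|^2, so the rate is |x|^(-2c) at infinity. The bound is global,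
    and negative [c] records growth. *)
Definition decays c f := exists C, forall x, `|f x| <= C * rho c x.

Lemma decays_nonneg c f : decays c f -> exists2 C, 0 <= C & forall x, `|f x| <= C * rho c x.
Proof.
move=> [C HC]; exists C => //; have := HC 0; have := rho_gt0 c (0 : V).
move=> r0 /(le_trans (normr_ge0 _)); by rewrite pmulr_lge0.
Qed.

Lemma decays_add c f g : decays c f -> decays c g -> decays c (fun x => f x + g x).
Proof.
move=> [C HC] [D HD]; exists (C + D) => x; rewrite mulrDl.
by rewrite (le_trans (ler_normD _ _))// lerD.
Qed.

Lemma decays_mul c c' f g : decays c f -> decays c' g -> decays (c + c') (fun x => f x * g x).
Proof.
move=> [C HC] [D HD]; exists (C * D) => x.
by rewrite normrM rhoD mulrACA ler_pM.
Qed.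

Lemma decays_weaken c c' f : c' <= c -> decays c f -> decays c' f.
Proof.
move=> cc /decays_nonneg[C C0 HC]; exists C => x; apply: (le_trans (HC x)).
by rewrite ler_wpM2l// rho_le.
Qed.

Lemma decays_rho c : decays c (rho c).
Proof. by exists 1 => x; rewrite mul1r ger0_norm// ltW// rho_gt0. Qed.

Lemma decays_cst (a : R) : decays 0 (fun _ : V => a).
Proof. by exists `|a| => x; rewrite rho0 mulr1. Qed.

Lemma decays_zero c : decays c (fun _ : V => 0).
Proof. by exists 0 => x; rewrite normr0 mul0r. Qed.

Lemma decays_scale (a : R) c f : decays c f -> decays c (fun x => a * f x).
Proof. by move=> df; rewrite -[c]add0r; apply: decays_mul => //; exact: decays_cst. Qed.

Lemma decays_sum c (I : Type) (r : seq I) (F : I -> V -> R) :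
  (forall i, decays c (F i)) -> decays c (fun x => \sum_(i <- r) F i x).
Proof.
move=> HF; elim: r => [|i r IH].
  by under eq_fun do rewrite big_nil; exact: decays_zero.
by under eq_fun do rewrite big_cons; exact: decays_add.
Qed.

Lemma decays_coord i : decays (- 2^-1) (fun x => x ord0 i).
Proof.
exists 1 => x; rewrite mul1r /rho opprK powR12_sqrt ?(ltW (sqn1_gt0 x))//.
rewrite -sqrtr_sqr ler_wsqrtr// (le_trans (coord_sqr_le_sqn i x))// lerDr//.
Qed.

Lemma decays_hpoly d f : hpoly d f -> decays (- (d%:R / 2)) f.
Proof.
elim=> {d f} [d|c|d i f _ IH|d f g _ IH1 _ IH2].
- exact: decays_zero.
- by rewrite mul0r oppr0; exact: decays_cst.
- rewrite -[d.+1%:R]natr1 mulrDl opprD addrC mul1r; apply: decays_mul => //; exact: decays_coord.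
- exact: decays_add.
Qed.

Lemma xi_itv x : `|xi x| <= 1.
Proof.
have := rho1_le1 x; have := rho_gt0 1 x.
by rewrite ler_norml /xi => r0 r1; apply/andP; split; lra.
Qed.

Lemma decays_rho_poly c (p : {poly R}) : decays c (rho_poly c p : V -> R).
Proof.
rewrite -[X in decays X](addr0 c); apply: decays_mul; first exact: decays_rho.
exists (\sum_(i < size p) `|p`_i|) => x; rewrite rho0 mulr1 horner_coef.
apply: (le_trans (ler_norm_sum _ _ _)); apply: ler_sum => i _.
by rewrite normrM ler_piMr// normrX exprn_ile1// xi_itv.
Qed.

(** The power of [rho] has exponent h + (N - 2)/2 and [H] costs only h/2. The surplus h/2 is given
    away to obtain the rate of the bubble, uniform in h. *)
Lemma decays_whpoly n h H : hpoly h H -> decays ((N%:R - 2) / 2) (whpoly n h H).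
Proof.
move=> hH; apply: (@decays_weaken (@bexp R N h + - (h%:R / 2))).
  by have := ler0n R h; rewrite /bexp; move: (h%:R : R) (N%:R : R) => a d; lra.
by apply: decays_mul; [exact: decays_rho_poly|exact: decays_hpoly].
Qed.

(** Differentiating [rho] costs a coordinate but gains a factor [rho 1], and differentiating [H]
    lowers its degree; each improves the rate by at least 1/2. *)
Lemma decays_partial_whpoly n h H i : hpoly h H ->
  decays ((N%:R - 1) / 2) (partial i (whpoly n h H)).
Proof.
move=> hH; have h0 : (0 : R) <= h%:R by [].
set b := @bexp R N h; set J := jac_poly (n - h) b.
rewrite (_ : partial i _ = fun x => (x ord0 i * (- (2 * b) * rho_poly (b + 1) J x
    + (- 4) * rho_poly (b + 2) J^`() x)) * H x + rho_poly b J x * partial i H x); last first.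
  apply/funext => x; rewrite partial_mul; [|exact: elem_rho_poly|exact: hpoly_elem hH].
  by rewrite partial_rho_poly mulNr.
apply: decays_add.
  apply: (@decays_weaken (- 2^-1 + (b + 1) + - (h%:R / 2))); first by move: h0; rewrite /b /bexp; move: (h%:R : R) (N%:R : R) => a d; lra.
  apply: decays_mul; last exact: decays_hpoly.
  apply: decays_mul; first exact: decays_coord.
  apply: decays_add; apply: decays_scale; first exact: decays_rho_poly.
  by apply: (@decays_weaken (b + 2)); [rewrite lerD2l ler1n|exact: decays_rho_poly].
have bE : b = h%:R + (N%:R - 2) / 2 by [].
clearbody J b; have := hpoly_partial i hH; case: h hH h0 bE => [|h] hH h0 bE.
  by move=> ->; under eq_fun do rewrite mulr0; exact: decays_zero.
move=> hdH; apply: (@decays_weaken (b + - (h%:R / 2))).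
  by have := ler0n R h; rewrite bE -[h.+1%:R]natr1; move: (h%:R : R) (N%:R : R) => a d; lra.
by apply: decays_mul; [exact: decays_rho_poly|exact: decays_hpoly].
Qed.

Lemma decays_Lnorm_lty c r f : (0 < N)%N -> 0 < r -> N%:R / 2 < c * r ->
  measurable_fun setT f -> decays c f -> ('N[mu]_r%:E[EFin \o f] < +oo)%E.
Proof.
move=> N0 r0 cr mf /decays_nonneg[C C0 HC].
rewrite unlock; apply: poweR_lty.
apply: (@le_lt_trans _ _ (\int[mu]_x ((C `^ r)%:E * (rho (c * r) x)%:E))%E).
  apply: ge0_le_integral => [//|x _|||x _] /=.
  - by rewrite lee_fin powR_ge0.
  - by apply/measurable_EFinP; apply: (measurableT_comp (measurable_powR _)); exact: measurableT_comp.
  - apply: measurable_funeM; apply/measurable_EFinP; apply: continuous_measurable_rV.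
    by apply: elem_continuous; exact: elem_rho.
  - rewrite -EFinM lee_fin.
    have -> : C `^ r * rho (c * r) x = (C * rho c x) `^ r.
      by rewrite powRM// ?(ltW (rho_gt0 _ _))// /rho -powRrM mulNr.
    by apply: ge0_ler_powR; rewrite ?nnegrE ?(ltW r0)// mulr_ge0// ltW// rho_gt0.
have /integrableP[_ irho] := rho_integrable N0 cr.
rewrite ge0_integralZl//=; last 3 first.
- apply/measurable_EFinP; apply: continuous_measurable_rV.
  by apply: elem_continuous; exact: elem_rho.
- by move=> x _; rewrite lee_fin ltW// rho_gt0.
- by rewrite lee_fin powR_ge0.
apply: lte_mul_pinfty => //; first by rewrite lee_fin powR_ge0.
apply: le_lt_trans irho; apply: ge0_le_integral => [//|x _|||x _] /=.
- by rewrite lee_fin ltW// rho_gt0.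
- apply/measurable_EFinP; apply: continuous_measurable_rV.
  by apply: elem_continuous; exact: elem_rho.
- apply/measurable_EFinP; apply: measurableT_comp => //; apply: continuous_measurable_rV.
  by apply: elem_continuous; exact: elem_rho.
- by rewrite lee_fin ler_norm.
Qed.

Lemma decays_Lfun c r f : (0 < N)%N -> 0 < r -> N%:R / 2 < c * r ->
  measurable_fun setT f -> decays c f -> f \in Lfun mu r%:E.
Proof.
move=> N0 r0 cr mf df; rewrite inE; apply/andP; split; first by rewrite inE.
rewrite inE/= /finite_norm; exact: (decays_Lnorm_lty N0 r0 cr mf df).
Qed.

Local Notation crit := (@crit_exp R N).

Lemma crit_gt1 : (2 < N)%N -> 1 < crit.
Proof.
move=> N2; have : (2 : R) < N%:R by rewrite ltr_nat.
by rewrite /crit_exp natrM => n2; rewrite ltr_pdivlMr ?subr_gt0//; lra.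
Qed.

Lemma Lfun_measurable (r : R) f : f \in Lfun mu r%:E -> measurable_fun setT f.
Proof. by rewrite inE => /andP[]; rewrite inE. Qed.

(** Hölder's inequality with the dual exponent q = 2N/(N + 2). Since N > 2 this q exceeds 1, so
    decay of order N/2 is enough for [g] to lie in L^q. *)
Lemma crit_mul_integrable f g : (2 < N)%N -> f \in Lfun mu crit%:E ->
  measurable_fun setT g -> decays (N%:R / 2) g ->
  mu.-integrable setT (fun x => (f x * g x)%:E).
Proof.
move=> N2 fL mg dg; have mf := Lfun_measurable fL.
have n2 : (2 : R) < N%:R by rewrite ltr_nat.
apply/integrableP; split; first by apply/measurable_EFinP; exact: measurable_funM.
pose q : R := (2 * N)%:R / (N%:R + 2).
have q0 : 0 < q by rewrite /q divr_gt0// ?ltr0n ?muln_gt0 ?(ltn_trans _ N2)//; lra.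
have p0 : 0 < crit by apply: lt_trans (crit_gt1 N2).
have pq : crit^-1 + q^-1 = 1.
  rewrite /crit_exp /q natrM !invf_div -mulrDl.
  have -> : N%:R - 2 + (N%:R + 2) = 2 * N%:R :> R by ring.
  by rewrite divff// mulf_neq0 ?gt_eqF//; lra.
have := hoelder mu mf mg p0 q0 pq; rewrite Lnorm1 => /le_lt_trans; apply.
apply: lte_mul_pinfty.
- exact: Lnorm_ge0.
- rewrite ge0_fin_numE ?Lnorm_ge0//.
  by move: fL; rewrite inE => /andP[_]; rewrite inE.
- have N0 : (0 < N)%N by apply: ltn_trans N2.
  have cq : N%:R / 2 < N%:R / 2 * q.
    rewrite /q natrM mulrA ltr_pdivlMr; last by lra.
    by rewrite ltr_pM2l ?divr_gt0 ?ltr0n//; lra.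
  exact: (decays_Lnorm_lty N0 q0 cq mg dg).
Qed.

End decay.

(** * Test functions and weak gradients *)

Section test_functions.
Context {R : realType} {N : nat}.
Local Notation V := 'rV[R]_N.
Local Notation mu := (@lebesgue_rV R N).
Local Notation e i := (delta_mx ord0 i : V).
Implicit Types (f g u w phi psi : V -> R) (x : V).

Lemma smooth_continuous phi : smooth phi -> continuous phi.
Proof. by move=> /(_ [::])[]. Qed.

Lemma smooth_is_derive phi i x : smooth phi -> is_derive x (e i) phi (partial i phi x).
Proof. by move=> /(_ [::])[_ D]; apply/derivableP; exact: D. Qed.

Lemma smooth_partial i phi : smooth phi -> smooth (partial i phi).
Proof. by move=> sphi s; have := sphi (rcons s i); rewrite foldr_rcons. Qed.

Lemma test_function_partial i phi : test_function phi -> test_function (partial i phi).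
Proof.
move=> [sphi cphi]; split; first exact: smooth_partial.
apply: (subclosed_compact _ cphi); first exact: closed_closure.
have -> : closure [set x | phi x != 0] = closure (closure [set x | phi x != 0]).
  by apply/closure_id; exact: closed_closure.
apply: closureS => x /=; apply: contraNP => xc; apply/eqP.
apply: partialE; apply: (@near_eq_is_derive _ _ _ (cst 0)).
have oc : open (~` closure [set x | phi x != 0]) by apply: closed_openC; exact: closed_closure.
apply: filterS (open_nbhs_nbhs (conj oc xc)) => y yc; apply/esym/eqP.
by apply: contra_notT yc => y0; exact: (@subset_closure _ [set x | phi x != 0]).
Qed.

Lemma test_function_support phi : test_function phi ->
  exists2 M, 0 <= M & forall x, ~ cube 0 M x -> phi x = 0.
Proof.
move=> [_ /compact_sub_cube[M M0 H]]; exists M => // x xM; apply/eqP.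
apply: contra_notT xM => x0; apply: H.
exact: (@subset_closure _ [set x | phi x != 0]).
Qed.

Lemma continuous_locally_integrable f : continuous f -> locally_integrable_rV f.
Proof. by move=> cf K cK; exact: continuous_integrable_compact. Qed.

Lemma locally_integrable_mul_compact g psi M : locally_integrable_rV g -> continuous psi ->
  (forall x, ~ cube 0 M x -> psi x = 0) ->
  mu.-integrable setT (fun x => (g x * psi x)%:E).
Proof.
move=> lg cpsi psi0; have cK := @cube_compact R N M.
have mK : measurable (cube (0 : V) M) by exact: cube_measurable.
have : mu.-integrable (cube 0 M) ((EFin \o psi) \* (EFin \o g))%E.
  apply: integrableMr => //.
  - by apply: measurable_funTS; exact: continuous_measurable_rV.
  - have : compact (psi @` cube 0 M) by apply: continuous_compact => //; exact: continuous_subspaceT.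
    move=> /compact_bounded[B [Br HB]]; exists B; split => // y By x Kx.
    by apply: (HB y By); exists x.
  - exact: lg.
rewrite integrable_mkcond//; apply: eq_integrable => // x _; rewrite patchE.
case: ifPn => [_|/negP xc] /=; first by rewrite -EFinM mulrC.
by rewrite psi0 ?mulr0// => Hx; apply: xc; rewrite inE.
Qed.

Lemma locally_integrable_mul_test g phi : locally_integrable_rV g -> test_function phi ->
  mu.-integrable setT (fun x => (g x * phi x)%:E).
Proof.
move=> lg tphi; have [M _ phi0] := test_function_support tphi.
by apply: locally_integrable_mul_compact lg _ phi0; exact: smooth_continuous tphi.1.
Qed.

Lemma elem_locally_integrable w : elem w -> locally_integrable_rV w.
Proof. by move=> ew; apply: continuous_locally_integrable; exact: elem_continuous. Qed.

(** The product of [w] with the test function has bounded support, so its partial derivative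
    integrates to 0. *)
Lemma elem_integration_by_parts l w phi : elem w -> test_function phi ->
  (\int[mu]_x (w x * partial l phi x)%:E = - \int[mu]_x (partial l w x * phi x)%:E)%E.
Proof.
move=> ew tphi; have tdphi := test_function_partial l tphi.
have edw := elem_partial l ew.
have i1 := locally_integrable_mul_test (elem_locally_integrable ew) tdphi.
have i2 := locally_integrable_mul_test (elem_locally_integrable edw) tphi.
have [M M0 phi0] := test_function_support tphi.
have : (\int[mu]_x (partial l w x * phi x + w x * partial l phi x)%:E = 0)%E.
  apply: (@integral_partial_eq0 _ _ (fun x => w x * phi x) _ l M) => //.
  - have [c1 c2] := (smooth_continuous tphi.1, smooth_continuous tdphi.1).
    have [c3 c4] := (elem_continuous edw, elem_continuous ew).
    move=> x; apply: (@continuousD _ _ _ (fun x => partial l w x * phi x)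
      (fun x => w x * partial l phi x)); apply: continuousM;
      [exact: c3|exact: c1|exact: c4|exact: c2].
  - move=> x; apply: is_derive_mulf; first exact: elem_is_derive.
    exact: smooth_is_derive tphi.1.
  - by move=> x xM; rewrite phi0// mulr0.
under eq_integral do rewrite EFinD.
rewrite integralD// => /eqP; rewrite addeC.
have fi : (\int[mu]_x (partial l w x * phi x)%:E)%E \is a fin_num by exact: integrable_fin_num.
move=> /eqP H; rewrite -[LHS]adde0 -(subee fi) addeA H add0e//.
Qed.

Definition gradient w x : V := \row_l partial l w x.

Lemma elem_weak_gradient w : elem w -> weak_gradient w (gradient w).
Proof.
move=> ew; split=> [|l]; first exact: elem_locally_integrable.
have E : (fun x => gradient w x ord0 l) = partial l w by apply/funext => x; rewrite mxE.
split=> [|phi tphi]; first by rewrite E; apply/elem_locally_integrable/elem_partial.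
rewrite (elem_integration_by_parts l ew tphi); congr (- _)%E.
by apply: eq_integral => x _; rewrite mxE.
Qed.

(* Pairing with [partial l phi], again a test function, turns any weak gradient
   into the distributional Laplacian; uniqueness of weak gradients is not needed. *)
Lemma weak_gradient_laplacian u G phi : weak_gradient u G -> test_function phi ->
  (\int[mu]_x (\sum_l G x ord0 l * partial l phi x)%:E =
   - \int[mu]_x (u x * laplacian phi x)%:E)%E.
Proof.
move=> [lu HG] tphi.
have i1 l : mu.-integrable setT (fun x => (G x ord0 l * partial l phi x)%:E).
  by apply: locally_integrable_mul_test; [case: (HG l)|exact: test_function_partial].
have i2 l : mu.-integrable setT (fun x => (u x * partial l (partial l phi) x)%:E).
  by apply: locally_integrable_mul_test => //; do 2 apply: test_function_partial.
under eq_integral do rewrite -sumEFin.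
rewrite integral_sum//.
under [in RHS]eq_integral do rewrite /laplacian mulr_sumr -sumEFin.
rewrite integral_sum// -sumeN; last first.
  by move=> l l' _ _; rewrite fin_num_adde_defl//; exact: integrable_fin_num.
apply: eq_bigr => l _; have [_ H] := HG l.
rewrite (H _ (test_function_partial l tphi)) oppeK//.
Qed.

End test_functions.

(** * From explicit solutions to weak solutions *)

Section weak_solutions.
Context {R : realType} {N : nat}.
Local Notation V := 'rV[R]_N.
Local Notation mu := (@lebesgue_rV R N).
Local Notation crit := (@crit_exp R N).
Implicit Types (f g u w phi psi : V -> R) (x : V).

Lemma potentialE x : (N * (N + 2))%:R / (1 + enorm x ^+ 2) ^+ 2 = potential x.
Proof. by rewrite /potential enorm_sqr rho1E exprVn. Qed.

Lemma elem_potential : elem (potential : V -> R).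
Proof. by apply: elem_scale; apply: elem_exp; exact: elem_rho. Qed.

Lemma decays_potential : decays 2 (potential : V -> R).
Proof. by apply: decays_scale; under eq_fun do rewrite -rho_nat; exact: decays_rho. Qed.

Lemma elem_measurable w : elem w -> measurable_fun setT w.
Proof. by move=> ew; apply: continuous_measurable_rV; exact: elem_continuous. Qed.

Lemma ae_eq_integral_mul u w psi : measurable_fun setT u -> measurable_fun setT w ->
  measurable_fun setT psi -> (\forall x \ae mu, u x = w x) ->
  (\int[mu]_x (u x * psi x)%:E = \int[mu]_x (w x * psi x)%:E)%E.
Proof.
move=> mf mw mp uw; apply: ae_eq_integral => //.
- by apply/measurable_EFinP; exact: measurable_funM.
- by apply/measurable_EFinP; exact: measurable_funM.
- by apply: filterS uw => x -> _.
Qed.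

Lemma ae_eq_locally_integrable u w : measurable_fun setT u -> measurable_fun setT w ->
  (\forall x \ae mu, u x = w x) -> locally_integrable_rV w -> locally_integrable_rV u.
Proof.
move=> mf mw uw lw K cK; have /integrableP[m1 i1] := lw K cK.
have [mK _] := compact_lebesgue_rV cK.
apply/integrableP; split; first by apply/measurable_EFinP; exact: measurable_funTS.
apply: le_lt_trans i1; rewrite le_eqVlt; apply/orP; left; apply/eqP.
apply: ae_eq_integral => //.
- by apply: measurableT_comp => //; apply/measurable_EFinP; exact: measurable_funTS.
- by apply: measurableT_comp => //; apply/measurable_EFinP; exact: measurable_funTS.
- by apply: filterS uw => x /= -> _.
Qed.

Lemma sum_sqr_le (y : V) : sqn y <= (\sum_i `|y ord0 i|) ^+ 2.
Proof.
suff [] : 0 <= \sum_i `|y ord0 i| /\ sqn y <= (\sum_i `|y ord0 i|) ^+ 2 by [].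
rewrite /sqn; elim/big_rec2: _ => [|i a b _ [b0 ab]]; first by rewrite expr0n.
split; first by rewrite addr_ge0.
have := normr_ge0 (y ord0 i); rewrite -(real_normK (num_real (y ord0 i))).
by move: (`|_|) => t t0; nra.
Qed.

Lemma enorm_le_sum (y : V) : enorm y <= \sum_i `|y ord0 i|.
Proof.
have s0 : 0 <= \sum_i `|y ord0 i| by apply: sumr_ge0.
rewrite -[leRHS]ger0_norm// -sqrtr_sqr ler_wsqrtr//; exact: sum_sqr_le.
Qed.

(** Stated up to almost everywhere equality so that representatives ill-behaved at the origin are
    covered. The products of decay and integrability exponents are N for [w] and N - 1 for its
    gradient, both above the threshold N/2. *)
Lemma elem_D12 u w : (2 < N)%N -> measurable_fun setT u -> elem w ->
  decays ((N%:R - 2) / 2) w -> (forall l, decays ((N%:R - 1) / 2) (partial l w)) ->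
  (\forall x \ae mu, u x = w x) -> D12 u.
Proof.
move=> N2 mf ew dw ddw uw; have mw := elem_measurable ew.
have n2 : (2 : R) < N%:R by rewrite ltr_nat.
have N0 : (0 < N)%N by apply: ltn_trans N2.
have c0 : 0 < crit by apply: lt_trans (crit_gt1 N2).
split.
- rewrite inE; apply/andP; split; first by rewrite inE.
  rewrite inE/= /finite_norm.
  have cc : N%:R / 2 < (N%:R - 2) / 2 * crit.
    rewrite /crit_exp natrM mulrACA.
    have -> : (N%:R - 2) * (2 * N%:R) * (2^-1 / (N%:R - 2)) = N%:R :> R.
      by field; rewrite gt_eqF// subr_gt0.
    by lra.
  apply: le_lt_trans (decays_Lnorm_lty N0 c0 cc mw dw).
  rewrite le_eqVlt; apply/orP; left; apply/eqP; rewrite unlock.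
  apply: (congr1 (fun t => t `^ crit^-1)%E); apply: ae_eq_integral => //=.
  + apply/measurable_EFinP; apply: (measurableT_comp (measurable_powR _)).
    exact: measurableT_comp.
  + apply/measurable_EFinP; apply: (measurableT_comp (measurable_powR _)).
    exact: measurableT_comp.
  + by apply: filterS uw => x /= -> _.
- exists (gradient w).
    have [lw HG] := elem_weak_gradient ew; split.
      exact: ae_eq_locally_integrable uw lw.
    move=> l; have [lG H] := HG l; split=> // phi tphi; rewrite -H//.
    apply: ae_eq_integral_mul => //; apply: continuous_measurable_rV.
    by apply: smooth_continuous; apply: smooth_partial; case: tphi.
  have meg : measurable_fun setT (enorm \o gradient w).
    rewrite (_ : _ \o _ = fun x => Num.sqrt (\sum_l partial l w x ^+ 2)); last first.
      by apply/funext => x; rewrite /= /enorm; congr Num.sqrt; apply: eq_bigr => l _; rewrite mxE.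
    apply: (measurableT_comp (continuous_measurable_fun (@sqrt_continuous R))); apply: measurable_sum => l.
    by apply: measurable_funX; apply: elem_measurable; exact: elem_partial.
  apply: (@decays_Lfun _ _ ((N%:R - 1) / 2)) => //; first by lra.
  have [C HC] : decays ((N%:R - 1) / 2) (fun x => \sum_l `|partial l w x|).
    apply: decays_sum => l; have [D HD] := ddw l; exists D => x.
    by rewrite normr_id.
  exists C => x; apply: le_trans (HC x).
  rewrite ger0_norm ?sqrtr_ge0// ger0_norm ?sumr_ge0//.
  by apply: (le_trans (enorm_le_sum _)); apply: ler_sum => l _; rewrite mxE.
Qed.

Context (k : nat) (A : 'M[R]_k).

(** Both derivatives are moved onto the test function, which leaves no gradient of [v] to control in
    the cutoff limit. *)
Lemma weak_solution_distribution v i phi : weak_solution A v -> test_function phi ->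
  (\int[mu]_x (v x i ord0 * laplacian phi x)%:E =
   - \int[mu]_x (potential x * (\sum_j A i j * v x j ord0) * phi x)%:E)%E.
Proof.
move=> [D W] tphi; have [_ [G wG _]] := D i.
rewrite -[LHS]oppeK -(weak_gradient_laplacian wG tphi) (W i G wG phi tphi).
by congr (- _)%E; apply: eq_integral => x _; rewrite potentialE.
Qed.

(** An arbitrary weak gradient of [v] is never compared with that of [w]: paired with the gradient
    of a test function, each gives minus the integral against its Laplacian, and these integrals
    agree. *)
Lemma elem_weak_solution (v w : V -> 'cV[R]_k) : (2 < N)%N ->
  (forall i, measurable_fun setT (fun x => v x i ord0)) ->
  (\forall x \ae mu, v x = w x) ->
  (forall i, elem (fun x => w x i ord0)) ->
  (forall i, decays ((N%:R - 2) / 2) (fun x => w x i ord0)) ->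
  (forall i l, decays ((N%:R - 1) / 2) (partial l (fun x => w x i ord0))) ->
  (forall i x, laplacian (fun x => w x i ord0) x =
     - (potential x * \sum_j A i j * w x j ord0)) ->
  weak_solution A v.
Proof.
move=> N2 mv vw ew dw ddw Lw.
have vwi i : \forall x \ae mu, v x i ord0 = w x i ord0 by apply: filterS vw => x ->.
split=> [i|i G wG phi tphi]; first exact: (elem_D12 N2 (mv i) (ew i) (dw i) (ddw i) (vwi i)).
have mphi : measurable_fun setT phi.
  by apply: continuous_measurable_rV; apply: smooth_continuous; case: tphi.
have mw i' := elem_measurable (ew i').
rewrite (weak_gradient_laplacian wG tphi).
have tdd l := test_function_partial l tphi.
have -> : (\int[mu]_x (v x i ord0 * laplacian phi x)%:E =
   \int[mu]_x (w x i ord0 * laplacian phi x)%:E)%E.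
  apply: ae_eq_integral_mul => //; apply: measurable_sum => l.
  apply: continuous_measurable_rV; apply: smooth_continuous.
  by case: (test_function_partial l (tdd l)).
rewrite -(weak_gradient_laplacian (elem_weak_gradient (ew i)) tphi).
transitivity (- \int[mu]_x (laplacian (fun x => w x i ord0) x * phi x)%:E)%E.
  have i1 l : mu.-integrable setT (fun x => (gradient (fun x => w x i ord0) x ord0 l * partial l phi x)%:E).
    by apply: locally_integrable_mul_test => //; case: (elem_weak_gradient (ew i)) => _ /(_ l)[].
  have i2 l : mu.-integrable setT (fun x => (partial l (partial l (fun x => w x i ord0)) x * phi x)%:E).
    by apply: locally_integrable_mul_test => //; apply: elem_locally_integrable; do 2 apply: elem_partial.
  under eq_integral do rewrite -sumEFin.
  rewrite integral_sum//.
  under [in RHS]eq_integral do rewrite /laplacian mulr_suml -sumEFin.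
  rewrite integral_sum// -sumeN; last first.
    by move=> l l' _ _; rewrite fin_num_adde_defl//; exact: integrable_fin_num.
  apply: eq_bigr => l _; rewrite -elem_integration_by_parts//; last exact: elem_partial.
  by apply: eq_integral => x _; rewrite mxE.
have ep := elem_potential.
have el : elem (fun x => potential x * \sum_j A i j * w x j ord0).
  by apply: elem_mul => //; apply: elem_sum => j; apply: elem_scale.
have i3 := locally_integrable_mul_test (elem_locally_integrable el) tphi.
under eq_integral do rewrite Lw mulNr -mulN1r EFinM.
rewrite integralZl// mulN1e.
rewrite oppeK; under [RHS]eq_integral do rewrite potentialE.
apply: ae_eq_integral => //.
- apply/measurable_EFinP; apply: measurable_funM => //; apply: measurable_funM => //.
    exact: elem_measurable.
  by apply: measurable_sum => j; apply: measurable_funM.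
- apply/measurable_EFinP; apply: measurable_funM => //; apply: measurable_funM => //.
    exact: elem_measurable.
  by apply: measurable_sum => j; apply: measurable_funM.
- by apply: filterS vw => x -> _.
Qed.

End weak_solutions.

(** * Cutoffs with bounds uniform in the scale *)

Section cutoff.
Context {R : realType} {N : nat}.
Local Notation V := 'rV[R]_N.
Local Notation mu := (@lebesgue_rV R N).
Implicit Types (f g u w phi psi : V -> R) (x : V) (s : R).

Lemma bump_bound k s x : `|bump k s x| <= k.+1%:R ^+ k.
Proof. exact: bump_profile_bound. Qed.

Lemma bump_eq0 k s x : 1 <= s * sqn x -> bump k s x = 0.
Proof. by move=> H; rewrite /bump /bump_profile ltNge subr_le0 H. Qed.

(** Where the bump is nonzero, s |x|^2 < 1 and s <= 1, hence s (1 + |x|^2) <= 2. A factor s produced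
    by differentiating the cutoff is thus worth one factor [rho 1], uniformly in s. *)
Lemma bump_scaled_bound k s x : 0 <= s <= 1 ->
  s * `|bump k s x| <= 2 * k.+1%:R ^+ k * rho 1 x.
Proof.
move=> /andP[s0 s1]; have r0 := ltW (rho_gt0 1 x).
have C0 : (0 : R) <= k.+1%:R ^+ k by rewrite exprn_ge0.
have [H|H] := leP 1 (s * sqn x).
  by rewrite bump_eq0// normr0 mulr0 !mulr_ge0.
have sr : s <= 2 * rho 1 x.
  by rewrite rho1E ler_pdivlMr ?sqn1_gt0// mulrDr mulr1; lra.
rewrite [leRHS]mulrAC; apply: ler_pM => //; exact: bump_bound.
Qed.

Lemma bump_scaled_sqn_bound k s x : 0 <= s <= 1 ->
  s * (s * sqn x) * `|bump k s x| <= 2 * k.+1%:R ^+ k * rho 1 x.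
Proof.
move=> s01; have [s0 s1] := andP s01; apply: le_trans (bump_scaled_bound k x s01).
have [H|H] := leP 1 (s * sqn x); first by rewrite bump_eq0// normr0 !mulr0.
by rewrite ler_wpM2r// ler_piMr// ltW.
Qed.

Lemma partial_bump0 i s x : partial i (bump 0 s) x = - (2 * s) * x ord0 i * bump 2 s x.
Proof. by rewrite (partialE (is_derive_bump i 0 s x)) mul0r subr0. Qed.

Lemma laplacian_bump0 s x : laplacian (bump 0 s) x =
  - (2 * N%:R) * (s * bump 2 s x) + 4 * (s * (s * sqn x) * (bump 4 s x - 2 * bump 3 s x)).
Proof.
rewrite /laplacian.
transitivity (\sum_(i < N) (- (2 * s) * bump 2 s x
   + x ord0 i ^+ 2 * (4 * s * s * (bump 4 s x - 2 * bump 3 s x)))).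
  apply: eq_bigr => i _.
  have -> : partial i (bump 0 s) = (fun y => - (2 * s) * (y ord0 i * bump 2 s y)).
    by apply/funext => y; rewrite partial_bump0 mulrA.
  have H := is_derive_scalef (- (2 * s)) (is_derive_mulf (is_derive_coord i i x) (is_derive_bump i 2 s x)).
  rewrite (partialE H) eqxx (_ : true%:R = 1 :> R)//.
  by move: (bump 2 s x) (bump 3 s x) (bump 4 s x) (x ord0 i) => a b c d; ring.
rewrite big_split/= sumr_const card_ord -mulr_suml (_ : \sum_(i < N) x ord0 i ^+ 2 = sqn x)// -[_ *+ N]mulr_natl.
by move: (bump 2 s x) (bump 3 s x) (bump 4 s x) (sqn x) => a b c d; ring.
Qed.

Lemma test_function_cutoff w s : elem w -> 0 < s -> test_function (fun x => bump 0 s x * w x).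
Proof.
move=> ew s0; split.
  by apply: elem_smooth; apply: elem_mul => //; exact: elem_bump.
have H : [set x | bump 0 s x * w x != 0] `<=` cube 0 (Num.sqrt s^-1).
  move=> x /= xw i; rewrite mxE sub0r normrN -sqrtr_sqr ler_wsqrtr//.
  apply: (le_trans (coord_sqr_le_sqn i x)); rewrite -[s^-1]mul1r ler_pdivlMr// mulrC ltW//.
  by rewrite ltNge; apply: contra xw => /bump_eq0 ->; rewrite mul0r.
apply: (subclosed_compact _ (@cube_compact R N (Num.sqrt s^-1))); first exact: closed_closure.
have /closure_id -> := @cube_closed R N 0 (Num.sqrt s^-1); exact: closureS.
Qed.

Definition cutoff_laplacian w s x : R :=
  (- (2 * N%:R) * (s * bump 2 s x) + 4 * (s * (s * sqn x) * (bump 4 s x - 2 * bump 3 s x))) * w x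
  + 2 * (\sum_i (- 2 * x ord0 i * (s * bump 2 s x)) * partial i w x)
  + bump 0 s x * laplacian w x.

Lemma laplacian_cutoff w s x : elem w ->
  laplacian (fun x => bump 0 s x * w x) x = cutoff_laplacian w s x.
Proof.
move=> ew; rewrite laplacian_mul//; last exact: elem_bump.
rewrite laplacian_bump0; congr (_ + _ * _ + _); apply: eq_bigr => i _.
by rewrite partial_bump0; congr (_ * _); ring.
Qed.

(** The numbers 3^2, 4^3 and 5^4 are the bounds of [bump_bound] for k = 2, 3, 4. The scale s no
    longer appears. *)
Definition cutoff_dominator w x : R :=
  (4 * N%:R * 3 ^+ 2 + 8 * (5 ^+ 4 + 2 * 4 ^+ 3)) * rho 1 x * `|w x|
  + 2 * (\sum_i 4 * 3 ^+ 2 * `|x ord0 i| * rho 1 x * `|partial i w x|)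
  + `|laplacian w x|.

Lemma cutoff_laplacian_le w s x : 0 <= s <= 1 ->
  `|cutoff_laplacian w s x| <= cutoff_dominator w x.
Proof.
move=> s01; have [s0 s1] := andP s01.
have B2 := bump_scaled_bound 2 x s01.
have B3 := bump_scaled_sqn_bound 3 x s01.
have B4 := bump_scaled_sqn_bound 4 x s01.
rewrite /cutoff_laplacian /cutoff_dominator.
apply: (le_trans (ler_normD _ _)); apply: lerD; last first.
  by rewrite normrM ler_piMl//; have := bump_bound 0 s x; rewrite expr0.
apply: (le_trans (ler_normD _ _)); apply: lerD; last first.
  rewrite normrM ger0_norm// ler_wpM2l//.
  apply: (le_trans (ler_norm_sum _ _ _)); apply: ler_sum => i _.
  rewrite normrM ler_wpM2r// !normrM normrN (ger0_norm s0) [`|2|]ger0_norm//.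
  have := ler_wpM2l (normr_ge0 (x ord0 i)) B2.
  move: (`|bump 2 s x|) (`|x ord0 i|) (rho 1 x) => a b c H.
  rewrite (_ : 4 * 3 ^+ 2 * b * c = 2 * (b * (2 * 3 ^+ 2 * c))); last by ring.
  by rewrite -mulrA; apply: ler_wpM2l.
rewrite normrM ler_wpM2r//.
apply: (le_trans (ler_normD _ _)).
have -> : (4 * N%:R * 3 ^+ 2 + 8 * (5 ^+ 4 + 2 * 4 ^+ 3)) * rho 1 x =
  2 * N%:R * (2 * 3 ^+ 2 * rho 1 x) +
  4 * (2 * 5 ^+ 4 * rho 1 x + 2 * (2 * 4 ^+ 3 * rho 1 x)) by ring.
have q0 : 0 <= s * (s * sqn x) by rewrite !mulr_ge0// sqn_ge0.
apply: lerD.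
  rewrite normrM normrN [`|2 * _|]ger0_norm ?mulr_ge0//; apply: ler_wpM2l; first by rewrite mulr_ge0.
  by rewrite normrM ger0_norm.
rewrite normrM ger0_norm//; apply: ler_wpM2l => //.
rewrite normrM (ger0_norm q0).
apply: (@le_trans _ _ (s * (s * sqn x) * (`|bump 4 s x| + 2 * `|bump 3 s x|))).
  by apply: ler_wpM2l => //; rewrite (le_trans (ler_normB _ _))// normrM ger0_norm.
by rewrite mulrDr [_ * (2 * _)]mulrCA; apply: lerD => //; apply: ler_wpM2l.
Qed.

(** Both 1 + (N - 2)/2 and -1/2 + 1 + (N - 1)/2 equal N/2, the rate at which [crit_mul_integrable]
    pairs with the critical space. *)
Lemma cutoff_dominator_decays w : elem w -> decays ((N%:R - 2) / 2) w ->
  (forall l, decays ((N%:R - 1) / 2) (partial l w)) -> decays (N%:R / 2) (laplacian w) ->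
  decays (N%:R / 2) (cutoff_dominator w) /\ measurable_fun setT (cutoff_dominator w).
Proof.
move=> ew dw ddw Lw.
have nd c f : decays c f -> decays c (fun x => `|f x|).
  by move=> [C HC]; exists C => x; rewrite normr_id.
have mn f : elem f -> measurable_fun setT (fun x => `|f x|).
  by move=> ef; apply: measurableT_comp => //; exact: elem_measurable.
have mrho : measurable_fun setT (rho 1 : V -> R) by apply: elem_measurable; exact: elem_rho.
split.
- apply: decays_add; last exact: nd.
  apply: decays_add.
    have -> : N%:R / 2 = 1 + (N%:R - 2) / 2 :> R by field.
    apply: decays_mul; last exact: nd.
    by apply: decays_scale; exact: decays_rho.
  apply: decays_scale; apply: decays_sum => i.
  have -> : N%:R / 2 = (- 2^-1 + 1) + (N%:R - 1) / 2 :> R by field.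
  apply: decays_mul; last exact: nd.
  apply: decays_mul; last exact: decays_rho.
  by apply: decays_scale; apply: nd; exact: decays_coord.
- apply: measurable_funD; last by apply: mn; exact: elem_laplacian.
  apply: measurable_funD.
    by apply: measurable_funM; [exact: measurable_funM|exact: mn].
  apply: measurable_funM => //; apply: measurable_sum => i.
  apply: measurable_funM; last by apply: mn; exact: elem_partial.
  apply: measurable_funM => //; apply: measurable_funM => //; apply: mn; exact: elem_coord.
Qed.

(** The cutoff is not normalised: it tends to e^(-1), the value of every [bump_profile k] at 1. The
    same factor appears on both sides of the equation and is cancelled at the end. *)
Lemma cutoff_laplacian_cvg w x :
  cutoff_laplacian w (n.+1%:R^-1) x @[n --> \oo] --> expR (-1) * laplacian w x.
Proof.
have cs : (fun n => n.+1%:R^-1 : R) @ \oo --> (0 : R) by exact: cvg_harmonic.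
have cb k : bump k (n.+1%:R^-1) x @[n --> \oo] --> expR (-1).
  have -> : expR (-1) = bump_profile k (1 - 0 * sqn x).
    by rewrite mul0r subr0 /bump_profile ltr01 invr1 expr1n mul1r.
  apply: (@cvg_comp _ _ _ (fun n => 1 - n.+1%:R^-1 * sqn x) (bump_profile k)).
    by apply: cvgB; [exact: cvg_cst|apply: cvgMl; exact: cs].
  exact: (is_derive_continuous (is_derive_bump_profile k _)).
(* The limit is written in the shape of [cutoff_laplacian] at s = 0, so that convergence can be
   checked factor by factor. *)
have -> : expR (-1) * laplacian w x =
  (- (2 * N%:R) * (0 * expR (-1)) + 4 * (0 * (0 * sqn x) * (expR (-1) - 2 * expR (-1)))) * w x
  + 2 * (\sum_i (- 2 * x ord0 i * (0 * expR (-1))) * partial i w x)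
  + expR (-1) * laplacian w x.
  rewrite big1 => [|i _]; last by rewrite !(mul0r, mulr0).
  by rewrite !(mul0r, mulr0, addr0, add0r).
have cM (a b : nat -> R) (la lb : R) : a @ \oo --> la -> b @ \oo --> lb ->
    (fun n => a n * b n) @ \oo --> la * lb by exact: cvgM.
have cD (a b : nat -> R) (la lb : R) : a @ \oo --> la -> b @ \oo --> lb ->
    (fun n => a n + b n) @ \oo --> la + lb by exact: cvgD.
have cC (c : R) : (fun _ : nat => c) @ \oo --> c by exact: cvg_cst.
apply: (cD); last by apply: (cM); [exact: cb|exact: cC].
apply: (cD).
  apply: (cM); last exact: cC.
  apply: (cD); apply: (cM); [exact: cC| | exact: cC| ].
    by apply: (cM); [exact: cs|exact: cb].
  apply: (cM); first by apply: (cM); [exact: cs|apply: (cM); [exact: cs|exact: cC]].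
  by apply: cvgB; [exact: cb|apply: (cM); [exact: cC|exact: cb]].
apply: (cM); first exact: cC.
elim: (index_enum _) => [|i r IH].
  by under eq_fun do rewrite big_nil; rewrite big_nil; exact: cC.
under eq_fun do rewrite big_cons; rewrite big_cons; apply: (cD) => //.
apply: (cM); last exact: cC.
by apply: (cM); [exact: cC|apply: (cM); [exact: cs|exact: cb]].
Qed.

Lemma bump0_cvg x : bump 0 (n.+1%:R^-1) x @[n --> \oo] --> expR (-1).
Proof.
have -> : expR (-1) = bump_profile 0 (1 - 0 * sqn x).
  by rewrite mul0r subr0 /bump_profile ltr01 invr1 expr0 mul1r.
apply: (@cvg_comp _ _ _ (fun n => 1 - n.+1%:R^-1 * sqn x) (bump_profile 0)).
  by apply: cvgB; [exact: cvg_cst|apply: cvgMl; exact: cvg_harmonic].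
exact: (is_derive_continuous (is_derive_bump_profile 0 _)).
Qed.

End cutoff.

(** * Weighted moments and testing with explicit solutions *)

Section moments.
Context {R : realType} {N : nat}.
Local Notation V := 'rV[R]_N.
Local Notation mu := (@lebesgue_rV R N).
Local Notation crit := (@crit_exp R N).
Implicit Types (f g u w : V -> R) (x : V).

(** Splitting off (1 + |x|^2)^(-(N - 2)/2) from both arguments leaves a multiple of (1 +
    |x|^2)^(-N), the density of the sphere: up to a constant this is the L^2 product on S^N. *)
Definition moment u w : R := fine (\int[mu]_x (u x * (potential x * w x))%:E)%E.

Lemma moment_integrable u w : (2 < N)%N -> u \in Lfun mu crit%:E ->
  measurable_fun setT w -> decays ((N%:R - 2) / 2) w ->
  mu.-integrable setT (fun x => (u x * (potential x * w x))%:E).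
Proof.
move=> N2 uL mw dw; apply: crit_mul_integrable => //.
  by apply: measurable_funM => //; apply: elem_measurable; exact: elem_potential.
apply: (@decays_weaken _ _ (2 + (N%:R - 2) / 2)); first by lra.
by apply: decays_mul => //; exact: decays_potential.
Qed.

Lemma momentE u w : (2 < N)%N -> u \in Lfun mu crit%:E ->
  measurable_fun setT w -> decays ((N%:R - 2) / 2) w ->
  (\int[mu]_x (u x * (potential x * w x))%:E = (moment u w)%:E)%E.
Proof.
move=> N2 uL mw dw; rewrite /moment fineK//.
by apply: integrable_fin_num => //; exact: moment_integrable.
Qed.

Lemma eq_momentr u w w' : w =1 w' -> moment u w = moment u w'.
Proof. by move=> ww'; congr moment; apply/funext. Qed.

Lemma moment_addr u w w' : (2 < N)%N -> u \in Lfun mu crit%:E ->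
  measurable_fun setT w -> decays ((N%:R - 2) / 2) w ->
  measurable_fun setT w' -> decays ((N%:R - 2) / 2) w' ->
  moment u (fun x => w x + w' x) = moment u w + moment u w'.
Proof.
move=> N2 uL mw dw mw' dw'; apply: EFin_inj; rewrite EFinD -!momentE//; last 2 first.
- exact: measurable_funD.
- exact: decays_add.
rewrite -integralD//; [|exact: moment_integrable..].
by apply: eq_integral => x _; rewrite -EFinD !mulrDr.
Qed.

Lemma moment_scaler u c w : (2 < N)%N -> u \in Lfun mu crit%:E ->
  measurable_fun setT w -> decays ((N%:R - 2) / 2) w ->
  moment u (fun x => c * w x) = c * moment u w.
Proof.
move=> N2 uL mw dw; apply: EFin_inj; rewrite EFinM -!momentE//; last 2 first.
- exact: measurable_funM.
- exact: decays_scale.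
rewrite -integralZl//; last exact: moment_integrable.
by apply: eq_integral => x _; rewrite -EFinM; congr EFin; ring.
Qed.

Lemma moment0r u : moment u (fun=> 0) = 0.
Proof.
by rewrite /moment; under eq_integral do rewrite !mulr0; rewrite integral0.
Qed.

Lemma moment_sumr u (I : Type) (r : seq I) (c : I -> R) (F : I -> V -> R) :
  (2 < N)%N -> u \in Lfun mu crit%:E ->
  (forall i, measurable_fun setT (F i)) -> (forall i, decays ((N%:R - 2) / 2) (F i)) ->
  moment u (fun x => \sum_(i <- r) c i * F i x) = \sum_(i <- r) c i * moment u (F i).
Proof.
move=> N2 uL mF dF; elim: r => [|i r IH].
  rewrite big_nil -[RHS](moment0r u); apply: eq_momentr => x; exact: big_nil.
rewrite big_cons -IH -moment_scaler// -moment_addr//.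
- by apply: eq_momentr => x; rewrite big_cons.
- exact: measurable_funM.
- exact: decays_scale.
- by apply: measurable_sum => j; exact: measurable_funM.
- by apply: decays_sum => j; exact: decays_scale.
Qed.

Lemma moment_suml w (I : Type) (r : seq I) (c : I -> R) (F : I -> V -> R) :
  (2 < N)%N -> measurable_fun setT w -> decays ((N%:R - 2) / 2) w ->
  (forall i, F i \in Lfun mu crit%:E) ->
  moment (fun x => \sum_(i <- r) c i * F i x) w = \sum_(i <- r) c i * moment (F i) w.
Proof.
move=> N2 mw dw LF; apply: EFin_inj; rewrite -sumEFin.
have E i : ((c i * moment (F i) w)%:E =
    \int[mu]_x ((c i)%:E * (F i x * (potential x * w x))%:E))%E.
  by rewrite EFinM -momentE// integralZl//; exact: moment_integrable.
under [RHS]eq_bigr do rewrite E.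
rewrite -integral_sum//; last first.
  by move=> i; apply: integrableZl => //; exact: moment_integrable.
rewrite /moment fineK; last first.
  apply: integrable_fin_num => //.
  apply: (@eq_integrable _ _ _ mu setT measurableT
    (fun x => (\sum_(i <- r) (c i)%:E * (F i x * (potential x * w x))%:E)%E)).
    by move=> x _; rewrite mulr_suml -sumEFin; apply: eq_bigr => i _; rewrite -EFinM -mulrA.
  apply: integrable_sum => // i _; apply: integrableZl => //; exact: moment_integrable.
apply: eq_integral => x _; rewrite mulr_suml -sumEFin.
by apply: eq_bigr => i _; rewrite -EFinM -mulrA.
Qed.

(** This is Green's identity for [v] and [w] without boundary terms: test with the cutoff times [w],
    then let the scale 1/(n + 1) tend to 0. *)
Lemma weak_solution_moment k (A : 'M[R]_k) v w (lam : R) i : (2 < N)%N ->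
  weak_solution A v -> elem w -> decays ((N%:R - 2) / 2) w ->
  (forall l, decays ((N%:R - 1) / 2) (partial l w)) ->
  (forall x, laplacian w x = - (lam * (potential x * w x))) ->
  \sum_j A i j * moment (fun x => v x j ord0) w = lam * moment (fun x => v x i ord0) w.
Proof.
move=> N2 Wv ew dw ddw Lw.
have vL j : (fun x => v x j ord0) \in Lfun mu crit%:E by case: Wv => /(_ j)[].
have mv j := Lfun_measurable (vL j).
have mw := elem_measurable ew.
have dL : decays (N%:R / 2) (laplacian w).
  rewrite (_ : laplacian w = fun x => - lam * (potential x * w x)); last first.
    by apply/funext => x; rewrite Lw mulNr.
  apply: decays_scale; apply: (@decays_weaken _ _ (2 + (N%:R - 2) / 2)); first by lra.
  by apply: decays_mul => //; exact: decays_potential.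
have [dD mD] := cutoff_dominator_decays ew dw ddw dL.
pose s n : R := n.+1%:R^-1.
have s0 n : 0 < s n by rewrite invr_gt0.
have s01 n : 0 <= s n <= 1 by rewrite ltW//= invf_le1// ler1n.
(* Both sides of the tested equation are put into one integrand, whose integral is 0 for every n; a
   single dominated limit then leads to [E']. *)
pose E n x : R := v x i ord0 * cutoff_laplacian w (s n) x
   + \sum_j A i j * (v x j ord0 * (potential x * (bump 0 (s n) x * w x))).
pose E' x : R := v x i ord0 * (expR (-1) * laplacian w x)
   + \sum_j A i j * (v x j ord0 * (potential x * (expR (-1) * w x))).
pose D x : R := `|v x i ord0 * cutoff_dominator w x|
   + \sum_j `|A i j| * `|v x j ord0 * (potential x * w x)|.
have mcl n : measurable_fun setT (cutoff_laplacian w (s n)).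
  rewrite (_ : cutoff_laplacian w (s n) = laplacian (fun x => bump 0 (s n) x * w x)).
    by apply: elem_measurable; apply: elem_laplacian; apply: elem_mul => //; exact: elem_bump.
  by apply/funext => x; rewrite laplacian_cutoff.
have mpot : measurable_fun setT (potential : V -> R) by apply: elem_measurable; exact: elem_potential.
have mbw n : measurable_fun setT (fun x => bump 0 (s n) x * w x).
  by apply: elem_measurable; apply: elem_mul => //; exact: elem_bump.
have dbw n : decays ((N%:R - 2) / 2) (fun x => bump 0 (s n) x * w x).
  have [C HC] := dw; exists C => x; apply: le_trans (HC x).
  by rewrite normrM ler_piMl//; have := bump_bound 0 (s n) x; rewrite expr0.
have iC n : mu.-integrable setT (fun x => (v x i ord0 * cutoff_laplacian w (s n) x)%:E).
  apply: crit_mul_integrable => //; have [C HC] := dD; exists C => x.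
  apply: le_trans (HC x); apply: (le_trans (cutoff_laplacian_le _ _ (s01 n))).
  exact: ler_norm.
have iB n j := moment_integrable N2 (vL j) (mbw n) (dbw n).
have E0 n : (\int[mu]_x (E n x)%:E = 0)%E.
  have H := weak_solution_distribution i Wv (test_function_cutoff ew (s0 n)).
  have HL : (\int[mu]_x (v x i ord0 * laplacian (fun x => bump 0 (s n) x * w x) x)%:E =
     \int[mu]_x (v x i ord0 * cutoff_laplacian w (s n) x)%:E)%E.
    by apply: eq_integral => x _; rewrite laplacian_cutoff.
  rewrite {}HL in H; rewrite /E; under eq_integral do rewrite EFinD.
  have is_ : mu.-integrable setT (fun x => (\sum_j A i j * (v x j ord0 * (potential x * (bump 0 (s n) x * w x))))%:E).
    apply: (@eq_integrable _ _ _ mu setT measurableT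
      (fun x => (\sum_j (A i j)%:E * (v x j ord0 * (potential x * (bump 0 (s n) x * w x)))%:E)%E)).
      by move=> x _; rewrite -sumEFin; apply: eq_bigr => j _; rewrite EFinM.
    by apply: integrable_sum => // j _; apply: integrableZl.
  rewrite integralD// H.
  have -> : (\int[mu]_x (potential x * (\sum_j A i j * v x j ord0) * (bump 0 (s n) x * w x))%:E =
     \int[mu]_x (\sum_j A i j * (v x j ord0 * (potential x * (bump 0 (s n) x * w x))))%:E)%E.
    apply: eq_integral => x _; congr EFin; rewrite mulr_sumr mulr_suml; apply: eq_bigr => j _.
    by move: (potential x) (A i j) (v x j ord0) (bump 0 (s n) x * w x) => a b c d; ring.
  by rewrite addeC subee//; exact: integrable_fin_num.
have [|||||_ _ CV] := @dominated_convergence _ _ R mu setT measurableT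
    (fun n x => (E n x)%:E) (fun x => (E' x)%:E) (fun x => (D x)%:E).
- move=> n; apply/measurable_EFinP; apply: measurable_funD; first exact: measurable_funM.
  by apply: measurable_sum => j; do 3 apply: measurable_funM => //.
- apply/measurable_EFinP; apply: measurable_funD.
    apply: measurable_funM => //; apply: measurable_funM => //.
    by apply: elem_measurable; exact: elem_laplacian.
  by apply: measurable_sum => j; do 4 apply: measurable_funM => //.
- apply: aeW => x _; apply: cvg_EFin; first exact: nearW.
  apply: (@cvgD _ _ _ _ _ (fun n => v x i ord0 * cutoff_laplacian w (s n) x)
     (fun n => \sum_j A i j * (v x j ord0 * (potential x * (bump 0 (s n) x * w x))))).
    by apply: cvgMr; exact: cutoff_laplacian_cvg.
  elim: (index_enum _) => [|j r IH].
    by under eq_fun do rewrite big_nil; rewrite big_nil; exact: cvg_cst.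
  under eq_fun do rewrite big_cons; rewrite big_cons.
  apply: (@cvgD _ _ _ _ _ (fun n => A i j * (v x j ord0 * (potential x * (bump 0 (s n) x * w x))))
     (fun n => \sum_(j <- r) A i j * (v x j ord0 * (potential x * (bump 0 (s n) x * w x))))) => //.
  by do 3 apply: cvgMr; apply: cvgMl; exact: bump0_cvg.
- apply: (@eq_integrable _ _ _ mu setT measurableT
    (fun x => (`|(v x i ord0 * cutoff_dominator w x)%:E| +
        \sum_j (`|A i j|)%:E * `|(v x j ord0 * (potential x * w x))%:E|)%E)).
    by move=> x _; rewrite EFinD -sumEFin; congr (_ + _)%E.
  apply: integrableD => //.
    by apply: integrable_abse; exact: crit_mul_integrable.
  apply: integrable_sum => // j _; apply: integrableZl => //.
  by apply: integrable_abse; exact: moment_integrable.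
- apply: aeW => x n _; rewrite lee_fin; apply: (le_trans (ler_normD _ _)); apply: lerD.
    rewrite !normrM ler_wpM2l//; apply: (le_trans (cutoff_laplacian_le _ _ (s01 n))).
    exact: ler_norm.
  apply: (le_trans (ler_norm_sum _ _ _)); apply: ler_sum => j _.
  rewrite !normrM; do 3 apply: ler_wpM2l => //.
  by rewrite ler_piMl//; have := bump_bound 0 (s n) x; rewrite expr0.
have : (\int[mu]_x (E' x)%:E = 0)%E.
  rewrite -(cvg_lim (@ereal_hausdorff R) CV).
  by rewrite (_ : (fun n => _) = (fun=> 0%E)) ?lim_cst//; apply/funext => n; exact: E0.
have im j := moment_integrable N2 (vL j) mw dw.
have -> : (\int[mu]_x (E' x)%:E = (expR (-1))%:E *
   (\int[mu]_x (- lam * (v x i ord0 * (potential x * w x)) +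
      \sum_j A i j * (v x j ord0 * (potential x * w x)))%:E))%E.
  have isum : mu.-integrable setT (fun x => (\sum_j A i j * (v x j ord0 * (potential x * w x)))%:E).
    apply: (@eq_integrable _ _ _ mu setT measurableT
      (fun x => (\sum_j (A i j)%:E * (v x j ord0 * (potential x * w x))%:E)%E)).
      by move=> x _; rewrite -sumEFin; apply: eq_bigr => j _; rewrite EFinM.
    by apply: integrable_sum => // j _; apply: integrableZl.
  rewrite -integralZl//; last first.
    apply: (@eq_integrable _ _ _ mu setT measurableT
      (fun x => ((- lam)%:E * (v x i ord0 * (potential x * w x))%:E +
         (\sum_j A i j * (v x j ord0 * (potential x * w x)))%:E)%E)).
      by move=> x _; rewrite -EFinM -EFinD.
    by apply: integrableD => //; apply: integrableZl.
  apply: eq_integral => x _; rewrite -EFinM; congr EFin.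
  rewrite /E' Lw mulrDr mulr_sumr; congr (_ + _); first by ring.
  by apply: eq_bigr => j _; ring.
have -> : (\int[mu]_x (- lam * (v x i ord0 * (potential x * w x)) +
      \sum_j A i j * (v x j ord0 * (potential x * w x)))%:E =
   (- lam * moment (fun x => v x i ord0) w + \sum_j A i j * moment (fun x => v x j ord0) w)%:E)%E.
  under eq_integral do rewrite EFinD EFinM -sumEFin.
  under eq_integral do under eq_bigr do rewrite EFinM.
  rewrite integralD//; last 2 first.
  - exact: integrableZl.
  - by apply: integrable_sum => // j _; exact: integrableZl.
  rewrite integralZl// integral_sum//; last by move=> j; exact: integrableZl.
  rewrite EFinD EFinM -sumEFin momentE//; congr (_ + _)%E.
  by apply: eq_bigr => j _; rewrite integralZl// EFinM momentE.
move=> /eqP; rewrite -EFinM eqe mulf_eq0 gt_eqF ?expR_gt0//= mulNr addrC subr_eq0.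
by move/eqP.
Qed.

End moments.

(** * Vanishing moments force a function to vanish *)

Section completeness.
Context {R : realType} {N : nat}.
Local Notation V := 'rV[R]_N.
Local Notation mu := (@lebesgue_rV R N).
Local Notation crit := (@crit_exp R N).
Local Notation b0 := ((N%:R - 2) / 2 : R).
Implicit Types (f g u w Q H : V -> R) (x : V).

(** Normal form of a sphere polynomial: each monomial carries as many factors [rho 1] as its degree
    in x, and j counts the extra ones. Homogeneity of [Q] is what makes the harmonic decomposition
    applicable. *)
Inductive rho_hpoly : (V -> R) -> Prop :=
| rho_hpoly_atom j d Q : hpoly d Q -> rho_hpoly (fun x => rho 1 x ^+ j * (rho 1 x ^+ d * Q x))
| rho_hpoly_add f g : rho_hpoly f -> rho_hpoly g -> rho_hpoly (fun x => f x + g x).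

Lemma rho_hpoly_mul f g : rho_hpoly f -> rho_hpoly g -> rho_hpoly (fun x => f x * g x).
Proof.
move=> hf; elim=> {g} [j d Q hQ|g1 g2 _ IH1 _ IH2].
  elim: hf => {f} [j' d' Q' hQ'|f1 f2 _ IH1 _ IH2].
    have := @rho_hpoly_atom (j' + j) _ _ (hpoly_mul hQ' hQ).
    by congr rho_hpoly; apply/funext => x; rewrite !exprD; ring.
  have := rho_hpoly_add IH1 IH2.
  by congr rho_hpoly; apply/funext => x; rewrite -mulrDl.
have := rho_hpoly_add IH1 IH2.
by congr rho_hpoly; apply/funext => x; rewrite -mulrDr.
Qed.

Lemma sphere_poly_rho_hpoly f : sphere_poly f -> rho_hpoly f.
Proof.
elim=> {f} [c||i|f g _ IH1 _ IH2|f g _ IH1 _ IH2].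
- have := rho_hpoly_atom 0 (hpoly_cst c).
  by congr rho_hpoly; apply/funext => x; rewrite !expr0 !mul1r.
- have := rho_hpoly_atom 1 (hpoly_cst (1 : R)).
  by congr rho_hpoly; apply/funext => x; rewrite expr0 expr1 !mulr1.
- have := rho_hpoly_atom 0 (hpoly_coord1 i).
  by congr rho_hpoly; apply/funext => x; rewrite expr0 expr1 mul1r.
- exact: rho_hpoly_add.
- exact: rho_hpoly_mul.
Qed.

Lemma decays_rho_poly_mul h p H : hpoly h H ->
  decays b0 (fun x => rho_poly (@bexp R N h) p x * H x) /\
  measurable_fun setT (fun x => rho_poly (@bexp R N h) p x * H x).
Proof.
move=> hH; split; last first.
  by apply: elem_measurable; apply: elem_mul; [exact: elem_rho_poly|exact: hpoly_elem hH].
apply: (@decays_weaken _ _ (@bexp R N h + - (h%:R / 2))).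
  by have := ler0n R h; rewrite /bexp; move: (h%:R : R) (N%:R : R) => a d; lra.
by apply: decays_mul; [exact: decays_rho_poly|exact: decays_hpoly].
Qed.

(** For a fixed [H] the levels h + m supply the Jacobi polynomials of every degree m with one and
    the same parameter, and these span all polynomials in [xi]. *)
Lemma moment_rho_poly_eq0 u h H p : (2 < N)%N -> u \in Lfun mu crit%:E ->
  hpoly h H -> (forall m, moment u (whpoly (h + m) h H) = 0) ->
  moment u (fun x => rho_poly (@bexp R N h) p x * H x) = 0.
Proof.
move=> N2 uL hH Hm; have bd q := decays_rho_poly_mul q hH.
have n2 : (2 : R) < N%:R by rewrite ltr_nat.
have be0 : 0 <= @bexp R N h by rewrite /bexp addr_ge0// divr_ge0// subr_ge0 ltW.
move: p; apply: (jac_poly_span be0).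
- rewrite -[RHS](moment0r u); apply: eq_momentr => x.
  by rewrite /rho_poly horner0 mulr0 mul0r.
- move=> p q Hp Hq; rewrite -[RHS]addr0 -{1}Hp -Hq -moment_addr//; try by case: (bd p); case: (bd q).
  by apply: eq_momentr => x; rewrite /rho_poly hornerD; ring.
- move=> c p Hp; have [dp mp] := bd p; rewrite -[RHS](mulr0 c) -Hp -moment_scaler//.
  by apply: eq_momentr => x; rewrite /rho_poly hornerZ; ring.
- by move=> m; rewrite -[RHS](Hm m); apply: eq_momentr => x; rewrite /whpoly addKn.
Qed.

Lemma moment_sphere_poly_eq0 u f : (2 < N)%N -> u \in Lfun mu crit%:E ->
  (forall n h H, (h <= n)%N -> harmonic_hpoly h H -> moment u (whpoly n h H) = 0) ->
  sphere_poly f -> moment u (fun x => rho b0 x * f x) = 0.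
Proof.
move=> N2 uL Hm sf; have N0 : (0 < N)%N by apply: ltn_trans N2.
pose P w := [/\ decays b0 (fun x => rho b0 x * w x),
  measurable_fun setT (fun x => rho b0 x * w x) & moment u (fun x => rho b0 x * w x) = 0].
have PD w w' : P w -> P w' -> P (fun x => w x + w' x).
  move=> [d1 m1 z1] [d2 m2 z2]; rewrite /P.
  have -> : (fun x => rho b0 x * (w x + w' x)) = (fun x => rho b0 x * w x + rho b0 x * w' x).
    by apply/funext => x; rewrite mulrDr.
  split; [exact: decays_add|exact: measurable_funD|].
  by rewrite moment_addr// z1 z2 addr0.
suff [] : P f by [].
elim: (sphere_poly_rho_hpoly sf) => {f sf} [j d Q hQ|f g _ Pf _ Pg]; last exact: PD.
elim: (harmonic_decomposition N0 hQ) => {d Q hQ} [i h H hH|d Q1 Q2 _ IH1 _ IH2]; last first.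
  have := PD _ _ IH1 IH2; congr P; apply/funext => x.
  by rewrite !mulrDr.
(* At [xi x] this polynomial takes the value [rho 1 x]. Since 1 - rho = rho |x|^2, the value of r (1
   - r) is rho^2 |x|^2, so the radial factors become a polynomial in [xi]. *)
pose r : {poly R} := 2^-1 *: ('X + 1).
pose q : {poly R} := r ^+ j * (r * (1 - r)) ^+ i.
have E : (fun x => rho b0 x * (rho 1 x ^+ j * (rho 1 x ^+ (h + 2 * i) * (sqn x ^+ i * H x)))) =
   (fun x => rho_poly (@bexp R N h) q x * H x).
  apply/funext => x; rewrite /rho_poly /bexp rhoD rho_nat.
  have -> : q.[xi x] = rho 1 x ^+ j * (rho 1 x * (1 - rho 1 x)) ^+ i.
    rewrite /q !(hornerM, horner_exp) hornerD hornerN hornerC /r hornerZ hornerD hornerX hornerC.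
    by rewrite /xi subrK mulKf.
  have -> : 1 - rho 1 x = rho 1 x * sqn x.
    by rewrite sqn_rho1 mulrBr divff ?mulr1// gt_eqF// rho_gt0.
  rewrite exprD exprM expr2 !exprMn -/b0.
  by move: (rho 1 x ^+ j) (rho 1 x ^+ h) (rho 1 x ^+ i) (sqn x ^+ i) (rho b0 x) (H x) => a b c e k l; ring.
rewrite /P E; have [hpH _] := hH; have [dq mq] := decays_rho_poly_mul q hpH.
split=> //; apply: moment_rho_poly_eq0 => // m.
by apply: Hm => //; exact: leq_addr.
Qed.

(* The span of the [whpoly n h H] contains [rho b0] times every polynomial in the
   stereographic coordinates, and these are dense. *)
Lemma moments_eq0_ae u : (2 < N)%N -> u \in Lfun mu crit%:E ->
  (forall n h H, (h <= n)%N -> harmonic_hpoly h H -> moment u (whpoly n h H) = 0) ->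
  \forall x \ae mu, u x = 0.
Proof.
move=> N2 uL Hm; have mf := Lfun_measurable uL.
(* The positive weight makes [g] integrable, which [u] alone need not be, and turns its integrals
   against sphere polynomials into moments of [u]. *)
pose g x := u x * (potential x * rho b0 x).
have erho : elem (rho b0 : V -> R) by exact: elem_rho.
have g0 : \forall x \ae mu, g x = 0.
  apply: sphere_poly_dense => [|f sf].
    by apply: moment_integrable => //; [exact: elem_measurable|exact: decays_rho].
  have df : decays 0 f.
    elim: sf => {f} [c||i|f f' _ df _ df'|f f' _ df _ df'].
    - exact: decays_cst.
    - by apply: (@decays_weaken _ _ 1) => //; exact: decays_rho.
    - apply: (@decays_weaken _ _ (1 + - 2^-1)); first by lra.
      by apply: decays_mul; [exact: decays_rho|exact: decays_coord].
    - exact: decays_add.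
    - by rewrite -[0]addr0; apply: decays_mul.
  rewrite (_ : (fun x => _) = fun x => (u x * (potential x * (rho b0 x * f x)))%:E); last first.
    by apply/funext => x; rewrite /g !mulrA.
  rewrite momentE//; first by rewrite moment_sphere_poly_eq0.
    by apply: elem_measurable; apply: elem_mul => //; exact: sphere_poly_elem.
  by have := decays_mul (decays_rho b0) df; rewrite addr0.
apply: filterS g0 => x gx; apply/eqP; move/eqP: gx; rewrite /g mulf_eq0.
have p0 : 0 < potential x.
  by rewrite mulr_gt0 ?exprn_gt0 ?rho_gt0// ltr0n muln_gt0 addn_gt0 orbT (ltn_trans _ N2).
by rewrite [_ * _ == 0]gt_eqF ?orbF// mulr_gt0// rho_gt0.
Qed.

End completeness.

(** * Spherical harmonics and harmonic polynomials *)

Section spherical_harmonics.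
Context {R : realType} {N : nat}.
Local Notation V := 'rV[R]_N.
Local Notation e i := (delta_mx ord0 i : V).
Implicit Types (f g H P Y : V -> R) (x y : V) (h d : nat) (c : R).

Lemma sqn_gt0 x : (0 < sqn x) = (x != 0).
Proof.
rewrite lt_def sqn_ge0 andbT; congr (~~ _); apply/eqP/eqP => [s0|->].
  apply/rowP => i; rewrite mxE; apply/eqP; rewrite -sqrf_eq0; apply/eqP.
  by apply: (psumr_eq0P _ s0) => // j _; exact: sqr_ge0.
by apply: big1 => i _; rewrite mxE expr0n.
Qed.

Lemma open_neq0 : open [set x : V | x != 0].
Proof.
rewrite (_ : [set x : V | x != 0] = sqn @^-1` [set t | 0 < t]).
  have /continuousP cs := elem_continuous (@elem_sqn R N).
  exact/cs/open_gt.
by apply/seteqP; split => x /=; rewrite sqn_gt0.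
Qed.

Lemma near_neq0 x : x != 0 -> \forall y \near x, y != 0.
Proof. by move=> x0; apply: (open_nbhs_nbhs (conj open_neq0 x0)). Qed.

Lemma partial_eq_neq0 f g i x : (forall y, y != 0 -> f y = g y) -> x != 0 ->
  partial i f x = partial i g x.
Proof.
move=> fg x0; apply: near_eq_derive.
by apply: filterS (near_neq0 x0) => y /fg.
Qed.

Lemma laplacian_eq_neq0 f g x : (forall y, y != 0 -> f y = g y) -> x != 0 ->
  laplacian f x = laplacian g x.
Proof.
move=> fg x0; apply: eq_bigr => i _; apply: partial_eq_neq0 => // y y0.
exact: partial_eq_neq0.
Qed.

Lemma is_derive_sqn_powR i c x : x != 0 ->
  is_derive x (e i) (fun y => sqn y `^ c) (2 * c * x ord0 i * sqn x `^ (c - 1)).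
Proof.
rewrite -sqn_gt0 => s0.
have H := is_derive_comp (is_derive_sqn i x) (is_derive1_powR c s0).
by apply: is_derive_eqr H _; ring.
Qed.

Lemma enorm_gt0 x : x != 0 -> 0 < enorm x.
Proof. by rewrite -sqn_gt0 => s0; rewrite sqrtr_gt0. Qed.

Lemma hpoly_radial h H y : hpoly h H -> y != 0 ->
  H ((enorm y)^-1 *: y) = sqn y `^ (- (h%:R / 2)) * H y.
Proof.
move=> hH y0; rewrite (hpoly_homogeneous _ _ hH); congr (_ * _).
have /ltW e0 := enorm_gt0 y0; rewrite -enorm_sqr; move: (enorm y) e0 => t t0.
rewrite -(powR_mulrn 2 t0) -powRrM exprVn -(powR_mulrn h t0) -powRN.
by congr (_ `^ _); field.
Qed.

(** The extension constant along rays is |y|^(-h) H(y), that is |y|^2 to the power c = -h/2 times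
    [H]. At |x| = 1, Leibniz and Euler give the coefficient 2 c N + 4 c (c - 1) + 4 c h = -h (h + N
    - 2). *)
Lemma laplace_beltrami_harmonic h H x : harmonic_hpoly h H -> enorm x = 1 ->
  laplace_beltrami H x = - (h%:R * (h%:R + N%:R - 2) * H x).
Proof.
move=> [hH H0] x1.
have s1 : sqn x = 1 by rewrite -enorm_sqr x1 expr1n.
have x0 : x != 0 by rewrite -sqn_gt0 s1.
set c : R := - (h%:R / 2).
rewrite /laplace_beltrami (@laplacian_eq_neq0 _ (fun y => sqn y `^ c * H y))//; last first.
  by move=> y y0; rewrite (hpoly_radial hH).
have eH := hpoly_elem hH.
have D1 i y : y != 0 -> partial i (fun y => sqn y `^ c * H y) y =
    2 * c * y ord0 i * sqn y `^ (c - 1) * H y + sqn y `^ c * partial i H y.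
  move=> y0; apply: partialE; apply: is_derive_mulf; first exact: is_derive_sqn_powR.
  exact: elem_is_derive.
rewrite /laplacian.
transitivity (\sum_i (2 * c * H x + 4 * c * (c - 1) * H x * x ord0 i ^+ 2
   + 4 * c * (x ord0 i * partial i H x) + partial i (partial i H) x)).
  apply: eq_bigr => i _; rewrite (partial_eq_neq0 _ (D1 i))//.
  have A := is_derive_mulf (is_derive_scalef (2 * c) (is_derive_coord i i x)) (is_derive_sqn_powR i (c - 1) x0).
  have B := is_derive_mulf A (elem_is_derive i x eH).
  have C := is_derive_mulf (is_derive_sqn_powR i c x0) (elem_is_derive i x (elem_partial i eH)).
  rewrite (partialE (is_derive_addf B C)) s1 !powR1 eqxx (_ : true%:R = 1 :> R)//.
  move: (H x) (partial i H x) (partial i (partial i H) x) (x ord0 i) => a b d t.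
  by clearbody c; ring.
rewrite !big_split/= sumr_const card_ord -!mulr_sumr -/(laplacian H x) H0.
rewrite (hpoly_euler _ hH) (_ : \sum_(i < N) x ord0 i ^+ 2 = 1)// -[_ *+ N]mulr_natl /c.
by move: (H x) (h%:R : R) (N%:R : R) => a b d; field.
Qed.

Lemma harmonic_spherical_harmonic h H : harmonic_hpoly h H ->
  spherical_harmonic_eig (h%:R * (h%:R + N%:R - 2)) H.
Proof.
move=> hH; split; last by move=> x x1; rewrite (laplace_beltrami_harmonic hH x1) opprK.
exists h, H; split => //; last by case: hH.
by apply: homogeneous_of_hpoly; case: hH.
Qed.

Lemma harmonic_hpoly_zero h : harmonic_hpoly h (fun _ : V => 0).
Proof.
split=> [|x]; first exact: hpoly_zero.
rewrite /laplacian big1// => i _.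
have -> : partial i (fun _ : V => 0) = (fun=> 0 : R) by apply/funext => y; exact: partial_cst.
exact: partial_cst.
Qed.

Lemma harmonic_hpoly_cst (a : R) : harmonic_hpoly 0 (fun _ : V => a).
Proof.
split; first exact: hpoly_cst.
move=> x; apply: big1 => i _; rewrite -[RHS](@partial_cst R N i 0 x).
by congr (partial i _ x); apply/funext => y; exact: partial_cst.
Qed.

(** [Y] comes from a polynomial of some degree d. If d differs from h, then so do the two
    eigenvalues, which forces [Y] to vanish on the sphere, and the zero polynomial serves in degree
    h. *)
Lemma spherical_harmonic_eigP h Y : (2 < N)%N ->
  spherical_harmonic_eig (h%:R * (h%:R + N%:R - 2)) Y ->
  exists2 H, harmonic_hpoly h H & forall y, enorm y = 1 -> Y y = H y.
Proof.
move=> N2 [[d [P [hP P0 YP]]] EY].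
have hdP : harmonic_hpoly d P by split => //; exact: hpoly_of_homogeneous.
have [<-|hd] := eqVneq d h; first by exists P.
exists (fun=> 0) => [|y y1]; first exact: harmonic_hpoly_zero.
have y0 : y != 0 by rewrite -sqn_gt0 -enorm_sqr y1 expr1n.
have LB : laplace_beltrami Y y = laplace_beltrami P y.
  apply: laplacian_eq_neq0 => // z z0; rewrite YP//.
  have z1 := enorm_gt0 z0.
  rewrite {1}/enorm; under eq_bigr do rewrite mxE exprMn.
  rewrite -mulr_sumr -/(sqn z) -enorm_sqr -exprMn mulVf ?gt_eqF// expr1n sqrtr1//.
have Py : P y = Y y by rewrite YP.
have := EY y y1; rewrite LB (laplace_beltrami_harmonic hdP y1) opprK Py.
move/eqP; rewrite -subr_eq0 -mulrBl mulf_eq0 => /orP[|/eqP//].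
have -> : d%:R * (d%:R + N%:R - 2) - h%:R * (h%:R + N%:R - 2) =
  (d%:R - h%:R) * (d%:R + h%:R + (N%:R - 2)) :> R by ring.
have q0 : 0 < d%:R + h%:R + (N%:R - 2) :> R.
  have n2 : (2 : R) < N%:R by rewrite ltr_nat.
  by apply: ltr_wpDl; [exact: addr_ge0|rewrite subr_gt0].
rewrite mulf_eq0 (gt_eqF q0) orbF subr_eq0 => dh.
have {}dh : d == h by rewrite -(@eqr_nat R).
by rewrite dh in hd.
Qed.

End spherical_harmonics.

(** * Finite-dimensional levels and orthogonal projection *)

Lemma submodule_row_space (F : fieldType) p (P : 'rV[F]_p -> Prop) : P 0 ->
  (forall a u v, P u -> P v -> P (a *: u + v)) ->
  exists M : 'M[F]_p, forall u, P u <-> (u <= M)%MS.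
Proof.
move=> P0 PD.
(* A matrix of largest rank among those with row space inside [P] captures all of [P]: a missing
   vector could be appended and would raise the rank. *)
pose Q r := exists2 M : 'M[F]_p, (forall u : 'rV_p, (u <= M)%MS -> P u) & \rank M = r.
have exQ : exists r, `[< Q r >].
  exists 0%N; apply/asboolP; exists 0; last exact: mxrank0.
  by move=> u; rewrite submx0 => /eqP ->.
have bQ r : `[< Q r >] -> (r <= p)%N by move=> /asboolP[M _ <-]; exact: rank_leq_row.
case: (ex_maxnP exQ bQ) => r /asboolP[M MP rM] rmax.
exists M => u; split=> [Pu|]; last exact: MP.
apply/negP => /negP uM.
have /rmax : `[< Q (\rank (M + u)%MS) >].
  apply/asboolP; exists (M + u)%MS => // w /sub_addsmxP[[w1 w2] ->] /=.
  rewrite addrC [w2]mx11_scalar mul_scalar_mx; apply: PD => //.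
  by apply: MP; exact: submxMl.
rewrite leqNgt => /negP; apply; rewrite -rM; apply: rank_ltmx.
by rewrite ltmxE addsmxSl addsmx_sub submx_refl.
Qed.

(** The functions [B i] only span a space containing [S] and may fail [S] themselves. The
    coefficient rows whose combination lies in [S] form a subspace, and the rows of a matrix
    generating it give generators inside [S]. *)
Lemma finite_spanning (R : realType) (T : Type) (I : finType) (B : I -> T -> R)
    (S : (T -> R) -> Prop) : S (fun=> 0) ->
  (forall a f g, S f -> S g -> S (fun x => a * f x + g x)) ->
  (forall f, S f -> exists c : I -> R, f = fun x => \sum_i c i * B i x) ->
  exists r (g : 'I_r -> T -> R), (forall j, S (g j)) /\
    forall f, S f -> exists c : 'I_r -> R, f = fun x => \sum_j c j * g j x.
Proof.
move=> S0 SD SB; pose p := #|I|.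
pose f_ (u : 'rV[R]_p) x := \sum_i u ord0 (enum_rank i) * B i x.
have f0 : f_ 0 = fun=> 0.
  by apply/funext => x; rewrite /f_ big1// => i _; rewrite mxE mul0r.
have fD a u v : f_ (a *: u + v) = fun x => a * f_ u x + f_ v x.
  apply/funext => x; rewrite /f_ mulr_sumr -big_split; apply: eq_bigr => i _ /=.
  by rewrite !mxE mulrDl mulrA.
have [||M HM] := @submodule_row_space R p (fun u => S (f_ u)).
- by rewrite f0.
- by move=> a u v Su Sv; rewrite fD; exact: SD.
exists p, (fun j => f_ (row j M)); split=> [j|f /[dup] Sf /SB[c cE]].
  by apply/HM; exact: row_sub.
have fE : f = f_ (\row_j c (enum_val j)).
  by rewrite cE; apply/funext => x; apply: eq_bigr => i _; rewrite mxE enum_rankK.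
move: Sf; rewrite fE => /HM /submxP[D DE]; exists (fun j => D ord0 j).
apply/funext => x; rewrite DE /f_; under [RHS]eq_bigr do rewrite mulr_sumr.
rewrite exchange_big; apply: eq_bigr => i _ /=; rewrite mxE mulr_suml.
by apply: eq_bigr => j _; rewrite mxE mulrA.
Qed.

Section eigenspaces.
Context {R : realType} {N : nat}.
Local Notation V := 'rV[R]_N.
Local Notation mu := (@lebesgue_rV R N).
Local Notation crit := (@crit_exp R N).
Local Notation b0 := ((N%:R - 2) / 2 : R).
Implicit Types (f g u w H : V -> R) (x : V).

Definition eigenspace_sol n f := exists2 H : nat -> V -> R,
  forall h, (h <= n)%N -> harmonic_hpoly h (H h) &
  f = fun x => \sum_(h < n.+1) whpoly n h (H h) x.

Lemma hpoly_bounded_monomials n h f : (h <= n)%N -> hpoly h f ->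
  exists c : {ffun 'I_N -> 'I_n.+1} -> R, forall x, f x = \sum_a c a * \prod_i x ord0 i ^+ a i.
Proof.
move=> hn /homogeneous_of_hpoly[c cE].
pose Z f := exists c : {ffun 'I_N -> 'I_n.+1} -> R,
  forall x, f x = \sum_a c a * \prod_i x ord0 i ^+ a i.
suff : Z f by [].
rewrite (_ : f = fun x => \sum_(a : {ffun 'I_N -> 'I_h.+1} | (\sum_i a i == h)%N)
            c a * \prod_i x ord0 i ^+ a i); last exact/funext.
have ZD f1 f2 : Z f1 -> Z f2 -> Z (fun x => f1 x + f2 x).
  move=> [c1 E1] [c2 E2]; exists (fun a => c1 a + c2 a) => x.
  by rewrite E1 E2 -big_split; apply: eq_bigr => a _; rewrite mulrDl.
have Zmon (t : R) (a : {ffun 'I_N -> 'I_h.+1}) : Z (fun x => t * \prod_i x ord0 i ^+ a i).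
  have le i : (a i < n.+1)%N by apply: leq_trans (ltn_ord _) _.
  pose a0 : {ffun 'I_N -> 'I_n.+1} := [ffun i => Ordinal (le i)].
  exists (fun b => if b == a0 then t else 0) => x.
  rewrite (bigD1 a0)//= eqxx [X in _ + X]big1 ?addr0 => [|b /negPf ->]; last by rewrite mul0r.
  by congr (_ * _); apply: eq_bigr => i _; rewrite ffunE.
elim: (index_enum _) => [|a s IH].
  by exists (fun=> 0) => x; rewrite big_nil big1// => a _; rewrite mul0r.
under eq_fun do rewrite big_cons.
by case: (_ == _) => //; apply: ZD.
Qed.

(** The harmonic polynomials involved are combinations of monomials with exponents at most n.
    Monomials are not harmonic in general, hence the detour through [finite_spanning]. *)
Lemma eigenspace_sol_spanning n : exists r (g : 'I_r -> V -> R),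
  (forall j, eigenspace_sol n (g j)) /\
  forall f, eigenspace_sol n f -> exists c : 'I_r -> R, f = fun x => \sum_j c j * g j x.
Proof.
apply: (@finite_spanning _ _ ('I_n.+1 * {ffun 'I_N -> 'I_n.+1})%type
  (fun p x => whpoly n p.1 (fun x => \prod_i x ord0 i ^+ p.2 i) x)).
- exists (fun _ _ => 0) => [h _|]; first exact: harmonic_hpoly_zero.
  by apply/funext => x; rewrite big1// => h _; rewrite /whpoly mulr0.
- move=> a _ _ [H HH ->] [K HK ->]; exists (fun h x => a * H h x + K h x) => [h hn|].
    have [[h1 h2] [k1 k2]] := (HH h hn, HK h hn).
    have [e1 e2] := (hpoly_elem h1, hpoly_elem k1); split.
      by apply: hpoly_add => //; exact: hpoly_scale.
    by move=> x; rewrite laplacian_add ?laplacian_scale ?h2 ?k2 ?mulr0 ?addr0//; exact: elem_scale.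
  apply/funext => x; rewrite mulr_sumr -big_split; apply: eq_bigr => h _.
  by rewrite /whpoly /=; ring.
- move=> _ [H HH ->].
  have /choice[c cE] : forall h : 'I_n.+1, exists c : {ffun 'I_N -> 'I_n.+1} -> R,
      forall x, H h x = \sum_a c a * \prod_i x ord0 i ^+ a i.
    move=> h; have hn : (h <= n)%N by rewrite -ltnS.
    have [hH _] := HH h hn; exact: (hpoly_bounded_monomials hn hH).
  exists (fun p => c p.1 p.2); apply/funext => x.
  rewrite -(pair_bigA _ (fun h a => c h a * whpoly n h (fun x => \prod_i x ord0 i ^+ a i) x))/=.
  apply: eq_bigr => h _; rewrite /whpoly cE mulr_sumr; apply: eq_bigr => a _.
  by rewrite mulrCA.
Qed.

Lemma eigenspace_sol_elem n f : eigenspace_sol n f -> [/\ elem f, decays b0 f,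
  forall l, decays ((N%:R - 1) / 2) (partial l f) &
  (0 < N)%N -> forall x, laplacian f x = - (lambda N n * (potential x * f x))].
Proof.
move=> [H HH ->].
have {}HH (h : 'I_n.+1) : harmonic_hpoly h (H h) by apply: HH; rewrite -ltnS.
elim: (index_enum _) => [|h r [IH1 IH2 IH3 IH4]].
  under eq_fun do rewrite big_nil.
  have p0 l : partial l (fun _ : V => 0) = (fun=> 0 : R) by apply/funext => y; exact: partial_cst.
  split=> [||l|N0 x]; [exact: elem_cst|exact: decays_zero|rewrite p0; exact: decays_zero|].
  rewrite big_nil !mulr0 oppr0 /laplacian big1// => i _; rewrite p0; exact: partial_cst.
under eq_fun do rewrite big_cons.
have [hpH _] := HH h; have e1 := elem_whpoly n hpH.
split=> [||l|N0 x].
- exact: elem_add.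
- by apply: decays_add => //; exact: decays_whpoly.
- rewrite (_ : partial l _ = fun x => partial l (whpoly n h (H h)) x
     + partial l (fun x => \sum_(h <- r) whpoly n h (H h) x) x); last first.
    by apply/funext => x; exact: partial_add.
  by apply: decays_add => //; exact: decays_partial_whpoly.
- rewrite laplacian_add// IH4// laplacian_whpoly//; last by rewrite -ltnS.
  by rewrite big_cons; ring.
Qed.

Lemma decays_Lfun_crit f : (2 < N)%N -> measurable_fun setT f -> decays b0 f ->
  f \in Lfun mu crit%:E.
Proof.
move=> N2 mf df; have n2 : (2 : R) < N%:R by rewrite ltr_nat.
have c0 : 0 < crit by apply: lt_trans (crit_gt1 N2).
have N0 : (0 < N)%N by apply: ltn_trans N2.
apply: (decays_Lfun N0 c0 _ mf df).
rewrite /crit_exp natrM mulrACA.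
have -> : (N%:R - 2) * (2 * N%:R) * (2^-1 / (N%:R - 2)) = N%:R :> R.
  by field; rewrite gt_eqF// subr_gt0.
by lra.
Qed.

Lemma moment_self_eq0 f : (2 < N)%N -> elem f -> decays b0 f -> moment f f = 0 ->
  \forall x \ae mu, f x = 0.
Proof.
move=> N2 ef df f0; have mf := elem_measurable ef.
have n2 : (2 : R) < N%:R by rewrite ltr_nat.
have N0 : (0 < N)%N by apply: ltn_trans N2.
have fL := decays_Lfun_crit N2 mf df.
have p0 x : 0 < potential x.
  by rewrite mulr_gt0 ?exprn_gt0 ?rho_gt0// ltr0n muln_gt0 addn_gt0 orbT N0.
have mp : measurable_fun setT (potential : V -> R) by apply: elem_measurable; exact: elem_potential.
have := momentE N2 fL mf df; rewrite f0.
have -> : (\int[mu]_x (f x * (potential x * f x))%:E = \int[mu]_x `|(f x * (potential x * f x))%:E|)%E.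
  apply: eq_integral => x _; rewrite gee0_abs// lee_fin mulrCA mulr_ge0 ?(ltW (p0 x))// -expr2 sqr_ge0//.
have mff : measurable_fun setT (fun x => (f x * (potential x * f x))%:E).
  by apply/measurable_EFinP; do 2 apply: measurable_funM => //.
move=> H; have /(_ H) Hae := (ae_eq_integral_abs mu measurableT mff).1.
apply: filterS Hae => x /(_ Logic.I)[] /eqP; rewrite mulf_eq0 => /orP[/eqP//|].
by rewrite mulf_eq0 (gt_eqF (p0 x)) => /eqP.
Qed.

(* Orthogonal projection for the inner product [moment]: the kernel of the Gram
   matrix annihilates the right-hand sides, so the normal equations are solvable. *)
Lemma moment_projection r (g : 'I_r -> V -> R) k (u : 'I_k -> V -> R) : (2 < N)%N ->
  (forall j, elem (g j)) -> (forall j, decays b0 (g j)) ->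
  (forall i, u i \in Lfun mu crit%:E) ->
  exists K : 'M[R]_r, let C := K *m \matrix_(j < r, i < k) moment (u i) (g j) in
    forall i l, moment (fun x => \sum_j C j i * g j x) (g l) = moment (u i) (g l).
Proof.
move=> N2 eg dg uL; have mg j := elem_measurable (eg j).
have gL j := decays_Lfun_crit N2 (mg j) (dg j).
pose B : 'M[R]_(r, k) := \matrix_(j, i) moment (u i) (g j).
pose M : 'M[R]_r := \matrix_(l, j) moment (g j) (g l).
have sBM : (B^T <= M^T)%MS.
  rewrite submxE; apply/eqP/matrixP => i q; rewrite !mxE.
  set Z := cokermx M^T; pose f x := \sum_l Z l q * g l x.
  have MZ j : \sum_l Z l q * moment (g j) (g l) = 0.
    have := mulmx_coker M^T => /matrixP /(_ j q); rewrite !mxE => H.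
    by rewrite -[RHS]H; apply: eq_bigr => l _; rewrite !mxE mulrC.
  have ef : elem f by apply: elem_sum => l; exact: elem_scale.
  have df : decays b0 f by apply: decays_sum => l; exact: decays_scale.
  have f0 : \forall x \ae mu, f x = 0.
    apply: moment_self_eq0 => //; rewrite moment_suml//; last exact: elem_measurable.
    by rewrite big1// => j _; rewrite moment_sumr// MZ mulr0.
  transitivity (moment (u i) f).
    by rewrite moment_sumr//; apply: eq_bigr => l _; rewrite !mxE mulrC.
  rewrite -[RHS](moment0r (u i)) /moment; congr fine.
  apply: ae_eq_integral => //.
  - apply/measurable_EFinP; apply: measurable_funM; first exact: Lfun_measurable (uL i).
    apply: measurable_funM; last exact: elem_measurable.
    by apply: elem_measurable; exact: elem_potential.
  - apply/measurable_EFinP; apply: measurable_funM; first exact: Lfun_measurable (uL i).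
    apply: measurable_funM; last exact: measurable_cst.
    by apply: elem_measurable; exact: elem_potential.
  - by apply: filterS f0 => x -> _.
exists (pinvmx M^T)^T => C i l; rewrite moment_suml//.
have : M *m C = B.
  by apply: trmx_inj; rewrite /C -/B trmx_mul [(_ *m B)^T]trmx_mul trmxK mulmxKpV.
move=> /matrixP /(_ l i); rewrite !mxE => <-.
by apply: eq_bigr => j _; rewrite !mxE mulrC.
Qed.

End eigenspaces.

(** * Linear spans *)

Section linear_span.
Context {R : realType} {V : lmodType R}.
Implicit Types (S : set V) (u v : V).

Lemma lin_span_zero S : lin_span S 0.
Proof. by exists 0%N, (fun=> 0), (fun=> 0); split=> [[]//|]; rewrite big_ord0. Qed.

Lemma lin_span_add S u v : lin_span S u -> lin_span S v -> lin_span S (u + v).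
Proof.
move=> [m [a [g [Sg ->]]]] [m' [a' [g' [Sg' ->]]]].
exists (m + m')%N, (fun j : 'I_(m + m') => match fintype.split j with inl i => a i | inr i => a' i end),
  (fun j : 'I_(m + m') => match fintype.split j with inl i => g i | inr i => g' i end); split.
  by move=> j; case: (fintype.split j).
rewrite big_split_ord /=; congr (_ + _); apply: eq_bigr => i _.
  by rewrite (unsplitK (inl i)).
by rewrite (unsplitK (inr i)).
Qed.

Lemma lin_span_gen S u : S u -> lin_span S u.
Proof. by move=> Su; exists 1%N, (fun=> 1), (fun=> u); split=> //; rewrite big_ord1 scale1r. Qed.

Lemma lin_span_ind S (Q : V -> Prop) : Q 0 -> (forall u v, Q u -> Q v -> Q (u + v)) ->
  (forall a u, Q u -> Q (a *: u)) -> (forall u, S u -> Q u) -> forall u, lin_span S u -> Q u.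
Proof.
move=> Q0 QD QZ QS _ [m [a [g [Sg ->]]]].
by elim/big_ind: _ => // j _; apply: QZ; apply: QS.
Qed.

End linear_span.

Lemma ae_neq0 (R : realType) N (P : 'rV[R]_N -> Prop) : (2 < N)%N ->
  (forall x, x != 0 -> P x) -> \forall x \ae lebesgue_rV N, P x.
Proof.
case: N P => // N P _ H; exists [set 0]; split.
- apply: closed_measurable_rV; apply: accessible_closed_set1.
  exact: hausdorff_accessible (@norm_hausdorff _ _).
- exact: lebesgue_rV_set1.
- by move=> x /= Px; apply: contrapT => /eqP x0; apply: Px; exact: H.
Qed.

(** * Explicit vector-valued solutions *)

Section classification.
Context {R : realType} {N k : nat} (A : 'M[R]_k).
Context (N2 : (2 < N)%N).
Local Notation V := 'rV[R]_N.
Local Notation mu := (@lebesgue_rV R N).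
Local Notation crit := (@crit_exp R N).
Local Notation b0 := ((N%:R - 2) / 2 : R).
Implicit Types (v w u : V -> 'cV[R]_k) (f : V -> R) (x : V).

Definition classical_solution w := [/\ forall i, elem (fun x => w x i ord0),
  forall i, decays b0 (fun x => w x i ord0),
  forall i l, decays ((N%:R - 1) / 2) (partial l (fun x => w x i ord0)) &
  forall i x, laplacian (fun x => w x i ord0) x =
     - (potential x * \sum_j A i j * w x j ord0)].

Lemma classical_solution_zero : classical_solution (fun=> 0).
Proof.
have E i : (fun x : V => (0 : 'cV[R]_k) i ord0) = (fun=> 0) by apply/funext => x; rewrite mxE.
have p0 l : partial l (fun _ : V => 0) = (fun=> 0 : R) by apply/funext => y; exact: partial_cst.
split=> [i|i|i l|i x]; rewrite E; first exact: elem_cst.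
- exact: decays_zero.
- by rewrite p0; exact: decays_zero.
- under [in RHS]eq_bigr do rewrite mxE mulr0.
  rewrite big1// mulr0 oppr0 /laplacian big1// => l _; rewrite p0; exact: partial_cst.
Qed.

Lemma classical_solution_add w w' : classical_solution w -> classical_solution w' ->
  classical_solution (fun x => w x + w' x).
Proof.
move=> [e1 d1 p1 L1] [e2 d2 p2 L2].
have E i : (fun x : V => (w x + w' x) i ord0) = (fun x => w x i ord0 + w' x i ord0).
  by apply/funext => x; rewrite mxE.
split=> [i|i|i l|i x]; rewrite E; first exact: elem_add.
- exact: decays_add.
- rewrite (_ : partial l _ = fun x => partial l (fun x => w x i ord0) x
      + partial l (fun x => w' x i ord0) x).
    exact: decays_add.
  by apply/funext => x; exact: partial_add.
- rewrite laplacian_add// L1 L2 -opprD -mulrDr -big_split; congr (- (_ * _)).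
  by apply: eq_bigr => j _; rewrite mxE mulrDr.
Qed.

Lemma classical_solution_scale a w : classical_solution w ->
  classical_solution (fun x => a *: w x).
Proof.
move=> [e1 d1 p1 L1].
have E i : (fun x : V => (a *: w x) i ord0) = (fun x => a * w x i ord0).
  by apply/funext => x; rewrite mxE.
split=> [i|i|i l|i x]; rewrite E; first exact: elem_scale.
- exact: decays_scale.
- rewrite (_ : partial l _ = fun x => a * partial l (fun x => w x i ord0) x).
    exact: decays_scale.
  by apply/funext => x; exact: partial_scale.
- rewrite laplacian_scale// L1 mulrN mulrCA; congr (- (_ * _)).
  by rewrite mulr_sumr; apply: eq_bigr => j _; rewrite mxE mulrCA.
Qed.

Lemma classical_solution_eigen n f (c : 'cV[R]_k) : eigenspace_sol n f ->
  A *m c = lambda N n *: c -> classical_solution (fun x => f x *: c).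
Proof.
move=> /eigenspace_sol_elem[ef df pf Lf] Ac.
have E i : (fun x : V => (f x *: c) i ord0) = (fun x => c i ord0 * f x).
  by apply/funext => x; rewrite mxE mulrC.
split=> [i|i|i l|i x]; rewrite E; first exact: elem_scale.
- exact: decays_scale.
- rewrite (_ : partial l _ = fun x => c i ord0 * partial l f x); first exact: decays_scale.
  by apply/funext => x; exact: partial_scale.
- rewrite laplacian_scale// Lf//; last by apply: ltn_trans N2.
  have -> : \sum_j A i j * (f x *: c) j ord0 = f x * (lambda N n * c i ord0).
    have := congr1 (fun M : 'cV_k => M i ord0) Ac; rewrite !mxE => <-.
    by rewrite mulr_sumr; apply: eq_bigr => j _; rewrite mxE mulrCA.
  by ring.
Qed.

Lemma whpoly_eigenspace n h (H : V -> R) : (h <= n)%N -> harmonic_hpoly h H ->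
  eigenspace_sol n (whpoly n h H).
Proof.
move=> hn hH; exists (fun h' => if h' == h then H else fun=> 0) => [h' _|].
  by case: eqP => [->//|_]; exact: harmonic_hpoly_zero.
have hn' : (h < n.+1)%N by rewrite ltnS.
apply/funext => x; rewrite (bigD1 (Ordinal hn'))//= eqxx big1 ?addr0// => i ih.
by rewrite ifF ?/whpoly ?mulr0//; apply: contra_neqF ih => /eqP ih; apply/val_inj.
Qed.

(** Adjusting a function at the origin adds a multiple of the indicator of the measurable set {0}.
    This deals with the arbitrary value of [wfun] there. *)
Lemma measurable_eq_neq0 (f g : V -> R) : measurable_fun setT g ->
  (forall x, x != 0 -> f x = g x) -> measurable_fun setT f.
Proof.
move=> mg fg.
rewrite (_ : f = fun x => g x + (f 0 - g 0) * \1_[set 0] x); last first.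
  apply/funext => x; rewrite indicE; have [->|x0] := eqVneq x 0.
    by rewrite mem_set// mulr1 addrC subrK.
  by rewrite memNset ?mulr0 ?addr0 ?fg// => /= /eqP; rewrite (negPf x0).
apply: measurable_funD => //; apply: measurable_funM => //; apply: measurable_indic.
apply: closed_measurable_rV; apply: accessible_closed_set1.
exact: hausdorff_accessible (@norm_hausdorff _ _).
Qed.

Lemma classical_weak_solution v w : classical_solution w -> (forall x, x != 0 -> v x = w x) ->
  weak_solution A v.
Proof.
move=> [ew dw pw Lw] vw; apply: (elem_weak_solution N2 _ _ ew dw pw Lw); last exact: ae_neq0.
move=> i; apply: (measurable_eq_neq0 (elem_measurable (ew i))) => x x0.
by rewrite vw.
Qed.

Lemma lin_span_classical (S : set (V -> 'cV[R]_k)) u :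
  (forall u, S u -> exists2 w, classical_solution w & forall x, x != 0 -> u x = w x) ->
  lin_span S u -> exists2 w, classical_solution w & forall x, x != 0 -> u x = w x.
Proof.
move=> HS; move: u; apply: lin_span_ind => [|u1 u2 [w1 W1 E1] [w2 W2 E2]|a u1 [w1 W1 E1]|//].
- by exists (fun=> 0) => //; exact: classical_solution_zero.
- exists (fun x => w1 x + w2 x) => [|x x0]; first exact: classical_solution_add.
  by rewrite -E1// -E2.
- exists (fun x => a *: w1 x) => [|x x0]; first exact: classical_solution_scale.
  by rewrite -E1.
Qed.

Lemma associated_classical n u : associated_solutions N A n u ->
  exists2 w, classical_solution w & forall x, x != 0 -> u x = w x.
Proof.
apply: lin_span_classical => _ [h [c [Y [hn Ac YE ->]]]].
have [H hH YH] := spherical_harmonic_eigP N2 YE.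
exists (fun x => whpoly n h H x *: c) => [|x x0].
  by apply: (@classical_solution_eigen n) => //; exact: whpoly_eigenspace.
by rewrite (wfunE _ (proj1 hH) YH).
Qed.

Lemma span_associated_classical (P : set nat) u :
  lin_span (\bigcup_(n in P) associated_solutions N A n) u ->
  exists2 w, classical_solution w & forall x, x != 0 -> u x = w x.
Proof. by apply: lin_span_classical => v [n _]; exact: associated_classical. Qed.

(** The difference is a nonzero multiple of (n - m)(n + m + N - 1), whose second factor is
    positive. *)
Lemma lambda_inj n m : lambda N n = lambda N m :> R -> n = m.
Proof.
have N0 : (0 < N)%N by apply: ltn_trans N2.
move=> E; have := congr1 (fun t => (N * (N + 2))%:R * t) E; rewrite !lambdaE// => {}E.
have n2 : (2 : R) < N%:R by rewrite ltr_nat.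
have : (n%:R - m%:R) * (n%:R + m%:R + N%:R - 1) = 0 :> R.
  move: E; have := ler0n R n; have := ler0n R m.
  by move: (n%:R : R) (m%:R : R) (N%:R : R) => a b d; lra.
move=> /eqP; rewrite mulf_eq0 subr_eq0 => /orP[|].
  by rewrite (@eqr_nat R) => /eqP.
have : 0 < n%:R + m%:R + N%:R - 1 :> R.
  by have := ler0n R n; have := ler0n R m; move: (n%:R : R) (m%:R : R) n2 => a b; lra.
by move=> /gt_eqF ->.
Qed.

End classification.

(** * Expansion of a weak solution into levels *)

Section spectrum.
Context {R : realType} {N k : nat} (A : 'M[R]_k) (N2 : (2 < N)%N).
Local Notation V := 'rV[R]_N.
Local Notation mu := (@lebesgue_rV R N).
Local Notation crit := (@crit_exp R N).
Local Notation b0 := ((N%:R - 2) / 2 : R).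
Implicit Types (v w u : V -> 'cV[R]_k) (f g : V -> R) (x : V).

Lemma eigenspace_solE n f : eigenspace_sol n f -> [/\ elem f, decays b0 f,
  forall l, decays ((N%:R - 1) / 2) (partial l f) &
  forall x, laplacian f x = - (lambda N n * (potential x * f x))].
Proof.
move=> /eigenspace_sol_elem[ef df pf Lf]; split => //; apply: Lf.
exact: ltn_trans N2.
Qed.

Lemma weak_solution_Lfun v i : weak_solution A v -> (fun x => v x i ord0) \in Lfun mu crit%:E.
Proof. by case=> /(_ i)[]. Qed.

Lemma weak_solution_moment_eigen n f v i : weak_solution A v -> eigenspace_sol n f ->
  \sum_j A i j * moment (fun x => v x j ord0) f = lambda N n * moment (fun x => v x i ord0) f.
Proof.
move=> Wv /eigenspace_solE[ef df pf Lf]; exact: weak_solution_moment Wv ef df pf Lf.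
Qed.

(** [f] is itself a weak solution for the 1 by 1 matrix lambda_n. Testing it against [g] multiplies
    the moment by lambda_m as well, and the two numbers differ. *)
Lemma eigenspace_orthogonal n m f g : n != m -> eigenspace_sol n f -> eigenspace_sol m g ->
  moment f g = 0.
Proof.
move=> nm Ef Eg.
have W : weak_solution (lambda N n)%:M (fun x => f x *: (1 : 'cV[R]_1)).
  apply: (@classical_weak_solution _ _ _ _ N2 _ (fun x => f x *: 1)) => //.
  by apply: (classical_solution_eigen N2 Ef); rewrite mul_scalar_mx.
have [eg dg pg Lg] := eigenspace_solE Eg.
have := weak_solution_moment ord0 N2 W eg dg pg Lg.
rewrite big_ord1 mxE eqxx mulr1n.
rewrite (_ : (fun x => _) = f); last by apply/funext => x; rewrite !mxE mulr1.
move=> /eqP; rewrite -subr_eq0 -mulrBl mulf_eq0 => /orP[|/eqP//].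
by rewrite subr_eq0 => /eqP /(lambda_inj N2) /eqP; rewrite (negPf nm).
Qed.

Lemma associated_sum n (I : Type) (r : seq I) (F : I -> V -> 'cV[R]_k) :
  (forall i, exists2 u, associated_solutions N A n u & forall x, x != 0 -> F i x = u x) ->
  exists2 u, associated_solutions N A n u & forall x, x != 0 -> \sum_(i <- r) F i x = u x.
Proof.
move=> HF; elim: r => [|i r [u Su Eu]].
  by exists 0 => [|x _]; [exact: lin_span_zero|rewrite big_nil].
have [u' Su' Eu'] := HF i; exists (u' + u) => [|x x0]; first exact: lin_span_add.
by rewrite big_cons Eu// Eu'.
Qed.

(** [U] projects every component of [v] onto level n. Its coefficient vectors are eigenvectors of
    [A], so it is itself a solution, and subtracting it changes the moments of level n only. *)
Lemma weak_solution_component n v : weak_solution A v -> exists U : V -> 'cV[R]_k,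
  [/\ classical_solution A U,
      exists2 u, associated_solutions N A n u & forall x, x != 0 -> U x = u x,
      forall i f, eigenspace_sol n f ->
        moment (fun x => U x i ord0) f = moment (fun x => v x i ord0) f &
      forall m i f, m != n -> eigenspace_sol m f -> moment (fun x => U x i ord0) f = 0].
Proof.
move=> Wv; have vL i := weak_solution_Lfun i Wv.
have [r [g [gS gspan]]] := @eigenspace_sol_spanning R N n.
have eg j : elem (g j) by have [] := eigenspace_solE (gS j).
have dg j : decays b0 (g j) by have [] := eigenspace_solE (gS j).
have mg j := elem_measurable (eg j).
have gL j := decays_Lfun_crit N2 (mg j) (dg j).
have [K] := moment_projection N2 eg dg vL.
set B := \matrix_(_, _) _; move=> /=; set C := K *m B => HC.
(* The projection is given as [K] times the matrix of moments precisely so that the eigenvector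
   relation satisfied by the moments passes to the coefficients. *)
have CA : C *m A^T = lambda N n *: C.
  rewrite /C -mulmxA scalemxAr; congr (_ *m _); apply/matrixP => j i; rewrite !mxE.
  rewrite -(weak_solution_moment_eigen i Wv (gS j)).
  by apply: eq_bigr => q _; rewrite !mxE mulrC.
pose c j : 'cV[R]_k := (row j C)^T.
have Ac j : A *m c j = lambda N n *: c j.
  by apply: trmx_inj; rewrite trmx_mul !trmxK -row_mul CA !linearZ /= trmxK.
pose U x := \sum_j g j x *: c j.
have UE i : (fun x => U x i ord0) = fun x => \sum_j C j i * g j x.
  by apply/funext => x; rewrite summxE; apply: eq_bigr => j _; rewrite !mxE mulrC.
exists U; split.
- rewrite /U; elim: (index_enum _) => [|j s IH].
    under eq_fun do rewrite big_nil; exact: classical_solution_zero.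
  under eq_fun do rewrite big_cons; apply: classical_solution_add => //.
  exact: (classical_solution_eigen N2 (gS j)).
- apply: associated_sum => j; have [H HH gE] := gS j.
  have [u Su Eu] : exists2 u, associated_solutions N A n u &
      forall x, x != 0 -> \sum_(h < n.+1) whpoly n h (H h) x *: c j = u x.
    apply: associated_sum => h; have hn : (h <= n)%N by rewrite -ltnS.
    exists (fun x => wfun n h (H h) x *: c j) => [|x x0].
      apply: lin_span_gen; exists h, (c j), (H h); split => //.
      exact/harmonic_spherical_harmonic/HH.
    by rewrite (@wfunE _ _ n h (H h) (H h))//; case: (HH h hn).
  by exists u => // x x0; rewrite -Eu// gE scaler_suml.
- move=> i f /gspan[d ->]; rewrite UE.
  have UL : (fun x => \sum_j C j i * g j x) \in Lfun mu crit%:E.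
    apply: decays_Lfun_crit => //.
      by apply: elem_measurable; apply: elem_sum => j; exact: elem_scale.
    by apply: decays_sum => j; exact: decays_scale.
  by rewrite !moment_sumr//; apply: eq_bigr => j _; rewrite HC.
- move=> m i f mn Ef; have [ef df _ _] := eigenspace_solE Ef.
  rewrite UE moment_suml//; last exact: elem_measurable.
  rewrite big1// => j _; rewrite (eigenspace_orthogonal _ (gS j) Ef) ?mulr0//.
  by rewrite eq_sym.
Qed.

Lemma weak_solution_expansion (ns : seq nat) v : uniq ns ->
  (forall n (c : 'cV[R]_k), A *m c = lambda N n *: c -> n \notin ns -> c = 0) ->
  weak_solution A v ->
  exists2 u, lin_span (\bigcup_(n in [set` ns]) associated_solutions N A n) u &
    \forall x \ae mu, v x = u x.
Proof.
move=> uns Hns Wv; have vL i := weak_solution_Lfun i Wv.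
have /choice[U HU] := fun n => weak_solution_component n Wv.
have [u Su Eu] : exists2 u, lin_span (\bigcup_(n in [set` ns]) associated_solutions N A n) u &
    forall x, x != 0 -> \sum_(n <- ns) U n x = u x.
  suff sumE s : {subset s <= ns} ->
      exists2 u, lin_span (\bigcup_(n in [set` ns]) associated_solutions N A n) u &
      forall x, x != 0 -> \sum_(n <- s) U n x = u x by exact: sumE.
  elim: s => [|n s IH] sub.
    by exists 0 => [|x _]; [exact: lin_span_zero|rewrite big_nil].
  have [|u Su Eu] := IH; first by move=> q qs; apply: sub; rewrite inE qs orbT.
  have [_ [u' Su' Eu'] _ _] := HU n; exists (u' + u) => [|x x0].
    apply: lin_span_add => //; apply: lin_span_gen; exists n => //=.
    by apply: sub; rewrite inE eqxx.
  by rewrite big_cons Eu// Eu'.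
have UL n i : (fun x => U n x i ord0) \in Lfun mu crit%:E.
  have [[eU dU _ _] _ _ _] := HU n.
  by apply: decays_Lfun_crit => //; exact: elem_measurable.
have D0 i : \forall x \ae mu, v x i ord0 - \sum_(n <- ns) U n x i ord0 = 0.
  (* [None] stands for [v] and [Some n] for its projection on level n, so that the remainder is one
     finite combination to which the linearity of moments applies. *)
  pose F (o : option nat) x := if o is Some n then U n x i ord0 else v x i ord0.
  pose a (o : option nat) : R := if o is Some n then - 1 else 1.
  pose s := None :: map Some ns.
  have DE : (fun x => v x i ord0 - \sum_(n <- ns) U n x i ord0) =
      fun x => \sum_(o <- s) a o * F o x.
    apply/funext => x; rewrite big_cons big_map /= mul1r -sumrN; congr (_ + _).
    by apply: eq_bigr => n _; rewrite mulN1r.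
  have FL o : F o \in Lfun mu crit%:E by case: o => [n|]; [exact: UL|exact: vL].
  suff : \forall x \ae mu, \sum_(o <- s) a o * F o x = 0.
    by apply: filterS => x; have /= -> := congr1 (fun f : V -> R => f x) DE.
  apply: moments_eq0_ae => //.
    have c1 : 1 <= crit by rewrite ltW// crit_gt1.
    rewrite (_ : (fun x => _) = \sum_(o <- s) a o *: F o); last first.
      by apply/funext => x; rewrite fct_sumE.
    have [S0 SD] := Lfun_submod_closed mu (c1 : (1 <= crit%:E)%E).
    by elim: (s) => [|o r IH]; rewrite (big_nil, big_cons)//; exact: SD.
  move=> m h H hm hH; have Ef := whpoly_eigenspace hm hH.
  have [ef df _ _] := eigenspace_solE Ef; have mf := elem_measurable ef.
  rewrite moment_suml// big_cons big_map mul1r.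
  under eq_bigr do rewrite mulN1r.
  rewrite sumrN; apply/eqP; rewrite subr_eq0; apply/eqP.
  (* On a listed level the projection has the moment of [v] and the other projections have none. On
     any other level the moment vector of [v] satisfies the eigenvector equation for lambda_m, so it
     vanishes by [Hns]. *)
  have [ms|ms] := boolP (m \in ns).
    rewrite (bigD1_seq m)//= big1 ?addr0 => [|n nm].
      by have [_ _ -> ] := HU m.
    by have [_ _ _ U0] := HU n; apply: (U0 m) => //; rewrite eq_sym.
  rewrite big_seq big1 => [|n ns_n]; last first.
    by have [_ _ _ U0] := HU n; apply: (U0 m) => //; apply: contraNneq ms => ->.
  pose c : 'cV[R]_k := \col_j moment (fun x => v x j ord0) (whpoly m h H).
  have : c = 0.
    apply: (Hns m) => //; apply/matrixP => j q; rewrite !mxE.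
    rewrite -(weak_solution_moment_eigen j Wv Ef).
    by apply: eq_bigr => l _; rewrite !mxE.
  by move=> /matrixP /(_ i ord0); rewrite !mxE.
exists u => //.
have D : \forall x \ae mu, forall i, v x i ord0 - \sum_(n <- ns) U n x i ord0 = 0.
  exact: filter_forall.
apply: filterS2 D (ae_neq0 N2 Eu) => x Dx <-; apply/matrixP => i q; rewrite ord1 summxE.
by apply/eqP; rewrite -subr_eq0 Dx.
Qed.

End spectrum.

(** * Derivatives of the bubble as solutions of level 1 *)

Section kernel_of_linearization.
Context {R : realType} {N : nat}.
Local Notation V := 'rV[R]_N.
Local Notation b0 := ((N%:R - 2) / 2 : R).
Local Notation kap := ((N%:R * (N%:R - 2)) `^ ((N%:R - 2) / 4) : R).
Implicit Types (f H : V -> R) (x : V).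

Lemma hpoly0_cst f x : hpoly 0 f -> f x = f 0.
Proof. by move=> hf; rewrite -[in RHS](scale0r x) (hpoly_homogeneous _ _ hf) mul1r. Qed.

Lemma hpoly1_linear f : hpoly 1 f -> exists a : 'I_N -> R, forall x, f x = \sum_i a i * x ord0 i.
Proof.
move=> hf; exists (fun i => partial i f 0) => x.
rewrite -[LHS]mul1r -(hpoly_euler x hf); apply: eq_bigr => i _.
by rewrite (hpoly0_cst _ (hpoly_partial i hf)) mulrC.
Qed.

Lemma bubbleE x : bubble x = kap * rho b0 x.
Proof. by rewrite /bubble /rho enorm_sqr powRN. Qed.

Lemma partial_bubble i x :
  partial i bubble x = - (2 * b0 * kap) * (x ord0 i * rho (b0 + 1) x).
Proof.
rewrite (_ : bubble = fun y => kap * rho b0 y); last by apply/funext => y; exact: bubbleE.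
rewrite partial_scale; last exact: elem_rho.
by rewrite (partialE (is_derive_rho i b0 x)); ring.
Qed.

Lemma dilation_bubble x : \sum_i x ord0 i * partial i bubble x + b0 * bubble x =
  b0 * kap * ((1 - sqn x) * rho (b0 + 1) x).
Proof.
under eq_bigr do rewrite partial_bubble.
rewrite bubbleE.
have -> : \sum_i x ord0 i * (- (2 * b0 * kap) * (x ord0 i * rho (b0 + 1) x)) =
    - (2 * b0 * kap) * (sqn x * rho (b0 + 1) x).
  rewrite /sqn mulr_suml mulr_sumr; apply: eq_bigr => i _.
by move: (rho (b0 + 1) x) (x ord0 i) kap b0 => r y a b; ring.
have -> : rho b0 x = (1 + sqn x) * rho (b0 + 1) x.
  rewrite (@rhoD _ _ b0 1) mulrCA rho1E divff ?mulr1// gt_eqF//; exact: sqn1_gt0.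
by move: (rho (b0 + 1) x) (sqn x) kap b0 => r y a b; ring.
Qed.

(** The Jacobi polynomial of degree 1 with both parameters b is (1 + b) xi, and xi (1 + |x|^2) = 1 -
    |x|^2. *)
Lemma whpoly_1_0 (a : R) x :
  whpoly 1 0 (fun=> a) x = a * (1 + b0) * ((1 - sqn x) * rho (b0 + 1) x).
Proof.
rewrite /whpoly /rho_poly horner_jac_poly /bexp /jacobi /gbinom !big_ord_recr !big_ord0 /=.
rewrite ?subn0 ?subnn ?big_ord_recr ?big_ord0 /= ?factS ?fact0 ?add0r muln1.
have -> : 1 - sqn x = xi x * (1 + sqn x).
  rewrite /xi rho1E; have := sqn1_gt0 x; move: (sqn x) => s s0.
  by field; rewrite gt_eqF.
have -> : rho b0 x = (1 + sqn x) * rho (b0 + 1) x.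
  rewrite (@rhoD _ _ b0 1) mulrCA rho1E divff ?mulr1// gt_eqF//; exact: sqn1_gt0.
by move: (rho (b0 + 1) x) (sqn x) (xi x) b0 => r y a' b; field.
Qed.

Lemma whpoly_1_1 H x : whpoly 1 1 H x = H x * rho (b0 + 1) x.
Proof.
rewrite /whpoly /rho_poly horner_jac_poly /bexp /jacobi /gbinom subnn !big_ord_recr !big_ord0 /=.
by rewrite ?subnn ?big_ord0 ?fact0 [1 + b0]addrC !expr0 add0r divr1 !mulr1 mulrC.
Qed.

End kernel_of_linearization.

(** * The solutions for the eigenvalue 1 *)

Section first_eigenvalue.
Context {R : realType} {N k : nat} (A : 'M[R]_k) (N2 : (2 < N)%N).
Local Notation V := 'rV[R]_N.
Local Notation mu := (@lebesgue_rV R N).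
Local Notation b0 := ((N%:R - 2) / 2 : R).
Local Notation kap := ((N%:R * (N%:R - 2)) `^ ((N%:R - 2) / 4) : R).
Implicit Types (v u : V -> 'cV[R]_k) (x : V).

Lemma lambda1 : lambda N 1 = 1 :> R.
Proof.
have n2 : (2 : R) < N%:R by rewrite ltr_nat.
rewrite /lambda; move: (N%:R : R) n2 => t t2.
by field; rewrite !gt_eqF//; lra.
Qed.

Let e0 x := (1 - sqn x) * rho (b0 + 1) x.
Let e i x := x ord0 i * rho (b0 + 1) x.

(** An intermediate form, free of the constants of the bubble and of the Jacobi polynomial, and
    stated off the origin only. *)
Let sol1 u := exists (c0 : 'cV[R]_k) (c : 'I_N -> 'cV[R]_k),
  [/\ A *m c0 = c0, (forall i, A *m c i = c i) &
    forall x, x != 0 -> u x = e0 x *: c0 + \sum_i e i x *: c i].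

Let associated_sol1 u : associated_solutions N A 1 u -> sol1 u.
Proof.
move: u; apply: lin_span_ind.
- exists 0, (fun=> 0); split => [|i|x _]; rewrite ?mulmx0//.
  by rewrite scaler0 add0r big1// => i _; rewrite scaler0.
- move=> u u' [c0 [c [c0A cA uE]]] [c0' [c' [c0A' cA' uE']]].
  exists (c0 + c0'), (fun i => c i + c' i); split => [|i|x x0].
  + by rewrite mulmxDr c0A c0A'.
  + by rewrite mulmxDr cA cA'.
  + rewrite [LHS](_ : _ = u x + u' x)// uE// uE'// scalerDr addrACA; congr (_ + _).
    by rewrite -big_split; apply: eq_bigr => i _; rewrite scalerDr.
- move=> a u [c0 [c [c0A cA uE]]]; exists (a *: c0), (fun i => a *: c i); split => [|i|x x0].
  + by rewrite -scalemxAr c0A.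
  + by rewrite -scalemxAr cA.
  + rewrite [LHS](_ : _ = a *: u x)// uE// scalerDr scaler_sumr scalerA mulrC -scalerA.
    by congr (_ + _); apply: eq_bigr => i _; rewrite scalerA mulrC -scalerA.
move=> _ [h [c [Y [h1 Ac YE ->]]]]; rewrite lambda1 scale1r in Ac.
have [H hH YH] := spherical_harmonic_eigP N2 YE.
have wE x : x != 0 -> wfun 1 h Y x = whpoly 1 h H x.
  by move=> x0; rewrite (wfunE _ (proj1 hH) YH).
case: h h1 YE hH YH wE => [|[|//]] _ _ [hH _] _ wE.
- exists ((H 0 * (1 + b0)) *: c), (fun=> 0); split => [|i|x x0].
  + by rewrite -scalemxAr Ac.
  + by rewrite mulmx0.
  + rewrite big1 ?addr0 => [|i _]; last by rewrite scaler0.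
    rewrite wE// scalerA (_ : H = fun=> H 0); last by apply/funext => y; exact: hpoly0_cst.
    by rewrite whpoly_1_0 mulrC.
- have [a Ha] := hpoly1_linear hH.
  exists 0, (fun i => a i *: c); split => [|i|x x0].
  + by rewrite mulmx0.
  + by rewrite -scalemxAr Ac.
  + rewrite scaler0 add0r wE// whpoly_1_1 Ha mulr_suml scaler_suml.
    by apply: eq_bigr => i _; rewrite scalerA -mulrA mulrC.
Qed.

Let sol1_associated u : sol1 u ->
  exists2 u', associated_solutions N A 1 u' & forall x, x != 0 -> u x = u' x.
Proof.
have Hgen h (H : V -> R) (c : 'cV[R]_k) : (h <= 1)%N -> harmonic_hpoly h H -> A *m c = c ->
    exists2 u', associated_solutions N A 1 u' &
      forall x, x != 0 -> whpoly 1 h H x *: c = u' x.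
  move=> h1 hH Ac; exists (fun x => wfun 1 h H x *: c) => [|x x0].
    apply: lin_span_gen; exists h, c, H; split => //; first by rewrite lambda1 scale1r.
    exact: harmonic_spherical_harmonic.
  by rewrite (@wfunE _ _ 1 h H H)//; case: hH.
move=> [c0 [c [c0A cA uE]]].
have n2 : (2 : R) < N%:R by rewrite ltr_nat.
(* The constant harmonic polynomial is chosen to cancel the factor 1 + b0 of [whpoly_1_0]. *)
have [|u0 Su0 Eu0] := @Hgen 0 (fun=> (1 + b0)^-1) c0 _ (harmonic_hpoly_cst _) c0A => //.
have [u1 Su1 Eu1] : exists2 u', associated_solutions N A 1 u' &
    forall x, x != 0 -> \sum_i whpoly 1 1 (fun x => x ord0 i) x *: c i = u' x.
  apply: associated_sum => i; apply: Hgen => //; split; first exact: hpoly_coord1.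
  move=> x; apply: big1 => j _; rewrite -[RHS](@partial_cst R N j (j == i)%:R x).
  by congr (partial j _ x); apply/funext => y; exact: partial_coord.
exists (u0 + u1) => [|x x0]; first exact: lin_span_add.
rewrite uE// [RHS](_ : _ = u0 x + u1 x)// -Eu0// -Eu1//; congr (_ + _).
  rewrite whpoly_1_0 mulVf ?mul1r// gt_eqF// addr_gt0// divr_gt0// subr_gt0//.
by apply: eq_bigr => i _; rewrite whpoly_1_1.
Qed.

Lemma associated_solutions1P v :
  (exists2 u, associated_solutions N A 1 u & \forall x \ae mu, v x = u x) <->
  exists (c0 : 'cV[R]_k) (c : 'I_N -> 'cV[R]_k),
    [/\ A *m c0 = c0, (forall i, A *m c i = c i) &
        \forall x \ae mu,
          v x = (\sum_i x ord0 i * partial i bubble x + b0 * bubble x) *: c0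
                + \sum_i partial i bubble x *: c i].
Proof.
have n2 : (2 : R) < N%:R by rewrite ltr_nat.
have k0 : kap != 0 by rewrite gt_eqF// powR_gt0// mulr_gt0 ?subr_gt0//; lra.
have bn0 : b0 != 0 by rewrite gt_eqF// divr_gt0// subr_gt0.
have bk0 : b0 * kap != 0 by rewrite mulf_neq0.
have bk2 : - (2 * b0 * kap) != 0 by rewrite oppr_eq0 -mulrA mulf_neq0.
split=> [[u /associated_sol1[c0 [c [c0A cA uE]]] vu]|[c0 [c [c0A cA vE]]]].
  (* The scalars invert the constants in [dilation_bubble] and [partial_bubble]. *)
  exists ((b0 * kap)^-1 *: c0), (fun i => (- (2 * b0 * kap))^-1 *: c i); split=> [|i|].
  - by rewrite -scalemxAr c0A.
  - by rewrite -scalemxAr cA.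
  apply: filterS2 vu (ae_neq0 N2 uE) => x -> ->; rewrite dilation_bubble scalerA.
  congr (_ *: _ + _); first by rewrite mulrAC divff ?mul1r.
  by apply: eq_bigr => i _; rewrite partial_bubble scalerA mulrAC divff ?mul1r.
have [u Su Eu] : exists2 u', associated_solutions N A 1 u' &
    forall x, x != 0 -> (\sum_i x ord0 i * partial i bubble x + b0 * bubble x) *: c0
                + \sum_i partial i bubble x *: c i = u' x.
  apply: sol1_associated.
  exists ((b0 * kap) *: c0), (fun i => (- (2 * b0 * kap)) *: c i); split=> [|i|x _].
  - by rewrite -scalemxAr c0A.
  - by rewrite -scalemxAr cA.
  rewrite dilation_bubble scalerA; congr (_ *: _ + _); first by rewrite mulrC.
  by apply: eq_bigr => i _; rewrite partial_bubble scalerA mulrC.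
by exists u => //; apply: filterS2 vE (ae_neq0 N2 Eu) => x ->.
Qed.

End first_eigenvalue.

(** * Eigenvalues of real symmetric matrices *)

Lemma char_poly_prod_eigenvector (F : fieldType) k (A : 'M[F]_k) (L : 'I_k -> F) a :
  A^T = A -> char_poly A = \prod_i ('X - (L i)%:P) ->
  (exists i, L i = a) <-> exists2 c : 'cV_k, A *m c = a *: c & c != 0.
Proof.
move=> symA AL.
have -> : (exists i, L i = a) <-> eigenvalue A a.
  rewrite eigenvalue_root_char AL rootE horner_prod; split=> [[i <-]|/prodf_eq0[i _]].
    by apply/prodf_eq0; exists i => //; rewrite !hornerE subrr.
  by rewrite !hornerE subr_eq0 => /eqP aL; exists i.
(* [eigenvalue] concerns row vectors; symmetry of [A] allows the passage to column vectors by
   transposition. *)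
split=> [/eigenvalueP[c cA c0]|[c Ac c0]]; last (apply/eigenvalueP; exists c^T).
- exists c^T; last by rewrite trmx_eq0.
  by apply: trmx_inj; rewrite trmx_mul linearZ /= !trmxK symA.
- by rewrite -{1}symA -trmx_mul Ac linearZ.
- by rewrite trmx_eq0.
Qed.

Lemma char_poly_similar_diag (F : fieldType) k (P : 'M[F]_k) (d : 'rV_k) : P \in unitmx ->
  char_poly (invmx P *m diag_mx d *m P) = \prod_i ('X - (d ord0 i)%:P).
Proof.
move=> uP; transitivity (char_poly (diag_mx d)).
  rewrite /char_poly /char_poly_mx.
  have E : map_mx polyC (invmx P) *m map_mx polyC P = 1%:M.
    by rewrite -map_mxM mulVmx// map_mx1.
  have -> : 'X%:M - map_mx polyC (invmx P *m diag_mx d *m P) =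
      map_mx polyC (invmx P) *m ('X%:M - map_mx polyC (diag_mx d)) *m map_mx polyC P.
    by rewrite mulmxBr mulmxBl !map_mxM scalar_mxC -(mulmxA 'X%:M) E mulmx1.
  by rewrite !det_mulmx mulrAC -det_mulmx E det1 mul1r.
rewrite char_poly_trig ?diag_mx_is_trig//.
by apply: eq_bigr => i _; rewrite !mxE eqxx.
Qed.

(** Over the complex numbers [A] is Hermitian, hence diagonalisable with a real diagonal. The
    factorisation descends to [R] because the embedding is injective on polynomials. *)
Lemma char_poly_symmetric_splits (R : rcfType) k (A : 'M[R]_k) : A^T = A ->
  exists L : 'I_k -> R, char_poly A = \prod_i ('X - (L i)%:P).
Proof.
move=> symA; pose B := map_mx (real_complex R) A.
have hB : B \is hermsymmx.
  apply: realsym_hermsym.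
    by apply/is_hermitianmxP; rewrite expr0 scale1r map_mx_id// /B map_trmx symA.
  by apply/mxOverP => i j; rewrite mxE; apply/complex_realP; exists (A i j).
have /hermitian_normalmx/orthomx_spectralP BE := hB.
have /mxOverP dreal := hermitian_spectral_diag_real hB.
exists (fun i => complex.Re (spectral_diag B ord0 i)).
apply: (map_poly_inj (real_complex R)); rewrite map_char_poly -/B map_prod_XsubC.
rewrite [in LHS]BE char_poly_similar_diag ?spectral_unit//.
apply: eq_bigr => i _; congr (_ - _%:P).
by have /complex_realP[t ->] := dreal ord0 i.
Qed.

(** The all-ones vector is an eigenvector for 1, nonzero since the index [i0] exists. A
    transposition of labels brings a root equal to 1 to position [i0]. *)
Lemma char_poly_symmetric_row_sum1 (R : rcfType) k (A : 'M[R]_k) (i0 : 'I_k) : A^T = A ->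
  (forall i, \sum_j A i j = 1) ->
  exists L : 'I_k -> R, char_poly A = \prod_i ('X - (L i)%:P) /\ L i0 = 1.
Proof.
move=> symA rowA; have [L AL] := char_poly_symmetric_splits symA.
have [_ [|i1 Li1]] := char_poly_prod_eigenvector 1 symA AL.
  exists (const_mx 1).
    by apply/colP => i; rewrite !mxE mul1r -[RHS](rowA i); apply: eq_bigr => j _; rewrite mxE mulr1.
  by apply/eqP => /matrixP /(_ i0 ord0); rewrite !mxE => /eqP; rewrite oner_eq0.
exists (L \o tperm i0 i1); split; last by rewrite /= tpermL.
by rewrite AL (reindex_inj (@perm_inj _ (tperm i0 i1))).
Qed.

(** * Nonzero solutions on every level *)

Section nontriviality.
Context {R : realType} {N : nat}.
Local Notation V := 'rV[R]_N.
Local Notation mu := (@lebesgue_rV R N).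
Implicit Types (f : V -> R).

(** At 1 only the summand s = m survives, with a positive coefficient. *)
Lemma jacobi1_neq0 m (b : R) : 0 <= b -> jacobi m b b 1 != 0.
Proof.
move=> b_ge0; rewrite /jacobi big_ord_recr big1 /= => [|s _]; last first.
  by rewrite subrr mul0r expr0n subn_eq0 leqNgt ltn_ord mulr0 mul0r.
rewrite add0r subnn expr0 mulr1 gt_eqF// mulr_gt0//.
  by have := jac_coef_gt0 b_ge0 (leqnn m); rewrite /jac_coef subnn.
Qed.

(** The origin corresponds to xi = 1. With continuity, the nonzero value there gives, for every n, a
    radial function of level n that is not zero almost everywhere. *)
Lemma whpoly_radial_neq0 n (a : R) : (2 < N)%N -> a != 0 -> whpoly n 0 (fun=> a) (0 : V) != 0.
Proof.
move=> N2 a0; have n2 : (2 : R) < N%:R by rewrite ltr_nat.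
have s0 : sqn (0 : V) = 0 by rewrite /sqn big1// => i _; rewrite mxE expr0n.
rewrite /whpoly /rho_poly !mulf_neq0//; first by rewrite gt_eqF// rho_gt0.
rewrite horner_jac_poly /xi rho1E s0 addr0 invr1 (_ : 2 * 1 - 1 = 1 :> R); last by lra.
by apply: jacobi1_neq0; rewrite addr_ge0// divr_ge0// subr_ge0 ltW.
Qed.

Lemma continuous_neq0_not_ae f : continuous f -> f 0 != 0 -> ~ (\forall x \ae mu, f x = 0).
Proof.
move=> cf f0 [B [mB B0 subB]].
have /nbhs_ballP[e /= e_gt0 He] : \forall x \near (0 : V), f x != 0.
  have /continuousP /(_ [set t : R | t != 0]) of0 := cf.
  apply: (open_nbhs_nbhs (conj (of0 _) f0)); exact: open_neq.
have e2 : 0 <= e / 2 by rewrite divr_ge0// ltW.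
have : (mu (cube 0 (e / 2)) <= mu B)%E.
  apply: le_measure; rewrite ?inE//; first exact: cube_measurable.
  move=> x Hx; apply: subB => /=; apply/eqP; apply: He; split=> // i j.
  have := Hx j; rewrite (ord1 i) /ball/= !mxE distrC => /le_lt_trans; apply.
  by rewrite ltr_pdivrMr// ltr_pMr// ltr1n.
rewrite B0 lebesgue_cube// lee_fin leNgt exprn_gt0//.
by rewrite mulrC divfK// pnatr_eq0.
Qed.

End nontriviality.

Lemma lin_span_sub (R : realType) (V : lmodType R) (S S' : set V) : S `<=` S' ->
  lin_span S `<=` lin_span S'.
Proof. by move=> SS' u [m [a [g [Sg ->]]]]; exists m, a, g; split=> // j; exact: SS'. Qed.

(** * Solutions in terms of the spectrum of [A] *)

Section solutions_spectrum.
Context {R : realType} {N k : nat} (A : 'M[R]_k) (N2 : (2 < N)%N) (symA : A^T = A).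
Context (L : 'I_k -> R) (AL : char_poly A = \prod_i ('X - (L i)%:P)).
Local Notation V := 'rV[R]_N.
Local Notation mu := (@lebesgue_rV R N).
Local Notation spectral_n := [set n | exists i, L i = lambda N n].
Implicit Types v u : V -> 'cV[R]_k.

Lemma weak_solution_span v : weak_solution A v ->
  exists2 u, lin_span (\bigcup_(n in spectral_n) associated_solutions N A n) u &
    \forall x \ae mu, v x = u x.
Proof.
move=> Wv.
(* [f i] is the level of the i-th root when it has one; the default 0 of the other roots is filtered
   out of [ns]. *)
have /choice[f Hf] : forall i, exists n, (exists m, L i = lambda N m) -> L i = lambda N n.
  by move=> i; have [[m Lm]|H] := pselect (exists m, L i = lambda N m); [exists m|exists 0%N].
pose ns := undup [seq f i | i <- enum 'I_k & `[< exists m, L i = lambda N m >]].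
have nsP n : n \in ns -> spectral_n n.
  by rewrite mem_undup => /mapP[j]; rewrite mem_filter => /andP[/asboolP Lj _] ->; exists j; exact: Hf.
have [|u Su vu] := weak_solution_expansion N2 (undup_uniq _ : uniq ns) _ Wv.
  move=> n c Ac; apply: contraNeq => c0.
  have [_ [|i Li]] := char_poly_prod_eigenvector (lambda N n) symA AL; first by exists c.
  rewrite mem_undup; apply/mapP; exists i.
    by rewrite mem_filter mem_enum andbT; apply/asboolP; exists n.
  by apply: (@lambda_inj R N N2); rewrite -Li; apply: Hf; exists n.
exists u => //; move: u Su {vu}; apply: lin_span_sub => u [n ns_n Su].
by exists n => //; exact: nsP.
Qed.

Lemma span_weak_solution u v : (forall i, measurable_fun setT (fun x => v x i ord0)) ->
  lin_span (\bigcup_(n in spectral_n) associated_solutions N A n) u ->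
  (\forall x \ae mu, v x = u x) -> weak_solution A v.
Proof.
move=> mv /(span_associated_classical N2)[w [ew dw pw Lw] uw] vu.
apply: (elem_weak_solution N2 _ _ ew dw pw Lw) => //.
by apply: filterS2 vu (ae_neq0 N2 uw) => x ->.
Qed.

Lemma exists_weak_solution : (exists2 v, weak_solution A v & ~ (\forall x \ae mu, v x = 0)) <->
  exists i n, L i = lambda N n.
Proof.
split=> [[v Wv v0]|[i [n Ln]]].
  (* Without an admissible level the span is taken over an empty family, so it contains only 0. *)
  apply: contrapT => nL; apply: v0; have [u Su] := weak_solution_span Wv.
  suff -> : u = 0 by [].
  move: u Su; apply: lin_span_ind => [//|u v' -> ->|a u ->|u [n [i Li]]].
  - exact: addr0.
  - exact: scaler0.
  - by case: nL; exists i, n.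
have /(char_poly_prod_eigenvector _ symA AL)[c Ac c0] : exists i, L i = lambda N n by exists i.
(* The radial function of level n, with h = 0 and constant harmonic polynomial, exists for every
   n. *)
exists (fun x => whpoly n 0 (fun=> 1) x *: c).
  apply: (classical_weak_solution N2 (w := fun x => whpoly n 0 (fun=> 1) x *: c)) => //.
  by apply: (classical_solution_eigen N2 (n := n)) => //; exact/whpoly_eigenspace/harmonic_hpoly_cst.
move=> H; apply: (@continuous_neq0_not_ae R N (whpoly n 0 (fun=> 1))).
- by apply: elem_continuous; apply: elem_whpoly; exact: hpoly_cst.
- by apply: whpoly_radial_neq0 => //; exact: oner_neq0.
- by apply: filterS H => x /eqP; rewrite scaler_eq0 (negPf c0) orbF => /eqP.
Qed.

End solutions_spectrum.

Unset Implicit Arguments.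

(** Eigenvalues with multiplicity are a labelling [L] of the roots of the characteristic polynomial,
    and such a labelling is shown to exist. Measurability of [v] is assumed in the third clause
    because almost everywhere equality with a measurable function does not make [v] measurable for
    the sigma-algebra generated by the coordinates. *)
Theorem proposition1p2 (R : realType) (N k : nat)
    (hN : (3 <= N)%N) (hk : (0 < k)%N)
    (A : 'M[R]_k) (symA : A^T = A) (rowA : forall i, \sum_j A i j = 1) :
  (exists L : 'I_k -> R,
     char_poly A = \prod_i ('X - (L i)%:P) /\ L (Ordinal hk) = 1) /\
  forall L : 'I_k -> R,
    char_poly A = \prod_i ('X - (L i)%:P) -> L (Ordinal hk) = 1 ->
  [/\ (exists2 v : 'rV[R]_N -> 'cV[R]_k, weak_solution A v &
         ~ (\forall x \ae lebesgue_rV N, v x = 0))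
      <-> (exists i n, L i = lambda N n),
      forall n, (exists i, L i = lambda N n) ->
        forall v, associated_solutions N A n v -> weak_solution A v,
      forall v : 'rV[R]_N -> 'cV[R]_k,
        (forall i, measurable_fun setT (fun x => v x i ord0)) ->
        (weak_solution A v <->
         exists2 u, lin_span (\bigcup_(n in [set n | exists i, L i = lambda N n])
                                associated_solutions N A n) u &
                    \forall x \ae lebesgue_rV N, v x = u x),
      L (Ordinal hk) = lambda N 1 &
      forall v : 'rV[R]_N -> 'cV[R]_k,
        (exists2 u, associated_solutions N A 1 u &
                    \forall x \ae lebesgue_rV N, v x = u x) <->
        exists (c0 : 'cV[R]_k) (c : 'I_N -> 'cV[R]_k),
          [/\ A *m c0 = c0, (forall i, A *m c i = c i) &
              \forall x \ae lebesgue_rV N,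
                v x = (\sum_i x ord0 i * partial i bubble x
                       + (N%:R - 2) / 2 * bubble x) *: c0
                      + \sum_i partial i bubble x *: c i]].
Proof.
split; first exact: char_poly_symmetric_row_sum1.
move=> L AL L1; split.
- exact: exists_weak_solution.
- move=> n _ v /(associated_classical hN)[w W vw].
  exact: classical_weak_solution W vw.
- move=> v mv; split=> [|[u Su vu]]; first exact: weak_solution_span.
  exact: span_weak_solution mv Su vu.
- by rewrite L1 lambda1.
- by move=> v; exact: associated_solutions1P.
Qed.
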